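(* Let $\sigma$ be a SODE on $M$ and let $\Phi\in\mathrm{Aut}^v(p)$. Let $\Phi\cdot\nabla^\sigma$ be the linear connection on $M^1$ defined by $$(\Phi\cdot\nabla^\sigma)_XY=\Phi^{(1)}\cdot\Bigl((\nabla^\sigma)_{(\Phi^{(1)})^{-1}\cdot X}\bigl((\Phi^{(1)})^{-1}\cdot Y\bigr)\Bigr),\qquad X,Y\in\mathfrak{X}(M^1),$$ where $\nabla^\sigma$ is the Chern connection of $\sigma$, and let $\Phi\cdot\sigma$ be the SODE $\Phi\cdot\sigma=\Phi^{(2)}\circ\sigma\circ(\Phi^{(1)})^{-1}$. Then $$\Phi\cdot\nabla^\sigma=\nabla^{\Phi\cdot\sigma}.$$
   Context: $M$ is a connected smooth manifold of dimension $n$; $M^0=\mathbb{R}\times M$ with projection $p\colon M^0\to\mathbb{R}$; $M^r=J^r(\mathbb{R},M)$ is the manifold of $r$-jets of smooth maps $\mathbb{R}\to M$, with projections $p^{rs}\colon M^r\to M^s$. Coordinates $(x^i)$ on $M$ induce coordinates $(t,x^i,\dot x^i)$ on $M^1$ and $(t,x^i,\dot x^i,\ddot x^i)$ on $M^2$. The summation convention is used. A SODE on $M$ is a smooth section $\sigma\colon M^1\to M^2$ of $p^{21}$; in coordinates $F^i=\ddot x^i\circ\sigma$. Put $X^\sigma=\frac{\partial}{\partial t}+\dot x^i\frac{\partial}{\partial x^i}+F^i\frac{\partial}{\partial\dot x^i}$ and $X^\sigma_i=\frac{\partial}{\partial x^i}+\frac12\frac{\partial F^j}{\partial\dot x^i}\frac{\partial}{\partial\dot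 x^j}$. The Chern connection $\nabla^\sigma$ is the linear connection on $M^1$ given in every induced coordinate system by $\nabla^\sigma_YX^\sigma=0$ for all $Y$; $\nabla^\sigma_{X^\sigma}X^\sigma_i=-\frac12\frac{\partial F^j}{\partial\dot x^i}X^\sigma_j$, $\nabla^\sigma_{X^\sigma}\frac{\partial}{\partial\dot x^i}=-\frac12\frac{\partial F^j}{\partial\dot x^i}\frac{\partial}{\partial\dot x^j}$; $\nabla^\sigma_{X^\sigma_j}X^\sigma_i=-\frac12\frac{\partial^2F^k}{\partial\dot x^i\partial\dot x^j}X^\sigma_k$, $\nabla^\sigma_{X^\sigma_j}\frac{\partial}{\partial\dot x^i}=-\frac12\frac{\partial^2F^k}{\partial\dot x^i\partial\dot x^j}\frac{\partial}{\partial\dot x^k}$; $\nabla^\sigma_{\partial/\partial\dot x^j}X^\sigma_i=0$, $\nabla^\sigma_{\partial/\partial\dot x^j}\frac{\partial}{\partial\dot x^i}=0$. $\mathrm{Aut}^v(p)$ is the group of $p$-vertical automorphisms: diffeomorphisms $\Phi\colon M^0\to M^0$ of the form $\Phi(t,x)=(t,\phi(t,x))$ with $\phi\in C^\infty(M^0,M)$. Each $\Phi$ induces diffeomorphisms $\Phi^{(r)}\colon M^r\to M^r$, $\Phi^{(r)}(j^r_t\gamma)=j^r_t(\Phi\circ j^0\gamma)$, where $j^0\gamma(t)=(t,\gamma(t))$, and the right-hand side is the $r$-jet at $t$ of the curve $s\mapsto\phi(s,\gamma(s))$. For a diffeomorphism $f\colon N\to N$ and $X\in\mathfrak{X}(N)$,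 $f\cdot X\in\mathfrak{X}(N)$ is $(f\cdot X)_x=f_*(X_{f^{-1}(x)})$. *)

(* Defs.v *)
From HB Require Import structures.
From mathcomp Require Import all_boot all_order all_algebra.
From mathcomp Require Import all_classical all_reals all_analysis.

Set Implicit Arguments.
Unset Strict Implicit.
Unset Printing Implicit Defensive.

Import Order.TTheory GRing.Theory Num.Theory numFieldNormedType.Exports.

Local Open Scope classical_set_scope.
Local Open Scope ring_scope.
Local Open Scope quotient_scope.

(* C^k maps on an open set U.  The spaces V used below are finite dimensional,
   so "the differential is C^k" can be tested on each fixed vector v. *)
Fixpoint Ck (R : realType) (V W : normedModType R) (U : set V) (k : nat)
    (f : V -> W) : Prop :=
  match k with
  | 0%N => forall x, U x -> {for x, continuous f}
  | k'.+1 => (forall x, U x -> differentiable f x) /\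
             forall v, Ck U k' (fun x => 'D_v f x)
  end.

Definition smooth_on (R : realType) (V W : normedModType R) (U : set V)
    (f : V -> W) : Prop := forall k, Ck U k f.

(* The values of coord outside dom are irrelevant. *)
Record chart (R : realType) (V : normedModType R) (T : Type) := Chart {
  dom : set T;
  coord : T -> V }.

(* The map f \o coord^-1 on the open set coord @` dom (and 0 elsewhere). *)
Definition in_chart (R : realType) (V W : normedModType R) (T : Type)
    (c : chart V T) (f : T -> W) : V -> W :=
  fun v => xget 0 (f @` [set p | dom c p /\ coord c p = v]).

Definition chart_image (R : realType) (V : normedModType R) (T : Type)
    (c : chart V T) (A : set T) : set V := coord c @` (dom c `&` A).

Record atlased (R : realType) := Atlased {
  points :> choiceType;
  model : normedModType R;
  charts : set (chart model points) }.
Arguments model {R} N : rename.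
Arguments charts {R} N : rename.

(* Since only the atlas is given, continuity is expressed in it too, by the
   openness of f @^-1` dom d. *)
Definition smooth_map (R : realType) (S T : atlased R) (f : S -> T) : Prop :=
  forall c d, charts S c -> charts T d ->
    let U := chart_image c (f @^-1` dom d) in
    open U /\ smooth_on U (in_chart c (coord d \o f)).

Definition open_in (R : realType) (N : atlased R) (A : set N) : Prop :=
  forall c, charts N c -> open (chart_image c A).

Definition real_line (R : realType) : atlased R :=
  @Atlased R R R [set Chart setT id].

Definition smooth_fun (R : realType) (N : atlased R) (h : N -> R) : Prop :=
  @smooth_map R N (real_line R) h.

Definition smooth_curve (R : realType) (N : atlased R) (g : R -> N) : Prop :=
  @smooth_map R (real_line R) N g.

Definition diffeo (R : realType) (N : atlased R) (f : N -> N) : Prop :=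
  smooth_map f /\
  exists g : N -> N, [/\ smooth_map g, cancel f g & cancel g f].

(* A homeomorphism of the open set dom c onto an open subset of V. *)
Definition homeo_chart (R : realType) (V : normedModType R)
    (T : topologicalType) (c : chart V T) : Prop :=
  [/\ open (dom c),
      {in dom c &, injective (coord c)},
      (forall p, dom c p -> {for p, continuous (coord c)}) &
      forall A, open A -> open (chart_image c A)].

Definition compatible (R : realType) (V : normedModType R) (T : Type)
    (c d : chart V T) : Prop :=
  smooth_on (chart_image c (dom d)) (in_chart c (coord d)) /\
  smooth_on (chart_image d (dom c)) (in_chart d (coord c)).

Record manifold (R : realType) (n : nat) := Manifold {
  mspace : topologicalType;
  mcharts : set (chart 'rV[R]_n mspace);
  _ : hausdorff_space mspace;
  _ : @second_countable mspace;
  _ : forall c, mcharts c -> homeo_chart c;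
  _ : forall p, exists2 c, mcharts c & dom c p;
  _ : forall c d, mcharts c -> mcharts d -> compatible c d;
  _ : forall c, homeo_chart c ->
        (forall d, mcharts d -> compatible c d) -> mcharts c }.
Arguments mspace {R n} M : rename.
Arguments mcharts {R n} M : rename.

Coercion atlased_of_manifold (R : realType) (n : nat) (M : manifold R n) :
  atlased R := @Atlased R (mspace M) 'rV[R]_n (mcharts M).

(* M^0 = R x M *)
Definition evolution (R : realType) (n : nat) (M : manifold R n) : atlased R :=
  @Atlased R (R * mspace M)%type (R * 'rV[R]_n)%type
    [set Chart (fun z : R * mspace M => dom c z.2)
               (fun z : R * mspace M => (z.1, coord c z.2)) | c in mcharts M].

(* M^r = J^r(R, M) *)
Section Jets.
Context {R : realType} {n : nat} (M : manifold R n) (r : nat).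

Definition curves : set (R -> mspace M) :=
  [set g | @smooth_curve R M g].

(* (t, g) and (s, h) define the same r-jet. *)
Definition same_jet : rel (R * curves) := fun a b =>
  `[< [/\ a.1 = b.1, \val a.2 a.1 = \val b.2 b.1 &
       forall c, mcharts M c -> dom c (\val a.2 a.1) ->
         forall k, (k <= r)%N ->
           derive1n k (coord c \o \val a.2) a.1 =
           derive1n k (coord c \o \val b.2) b.1] >].

Lemma same_jet_refl : reflexive same_jet.
Proof. by move=> a; apply/asboolP; split. Qed.

Lemma same_jet_sym : symmetric same_jet.
Proof.
suff h a b : same_jet a b -> same_jet b a by move=> a b; apply/idP/idP; exact: h.
move=> /asboolP[tE pE dE]; apply/asboolP; split=> // c Mc cb k kr.
by rewrite dE // pE.
Qed.

Lemma same_jet_trans : transitive same_jet.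
Proof.
move=> b a e /asboolP[tE pE dE] /asboolP[tE' pE' dE']; apply/asboolP; split.
- by rewrite tE.
- by rewrite pE.
- by move=> c Mc ca k kr; rewrite dE // dE' // -pE.
Qed.

Canonical same_jet_equiv :=
  EquivRel same_jet same_jet_refl same_jet_sym same_jet_trans.

Definition jet := {eq_quot same_jet_equiv}.

(* j^r_t g *)
Definition mk_jet (t : R) (g : curves) : jet := \pi_jet (t, g).

Definition jet_time (j : jet) : R := (repr j).1.
Definition jet_curve (j : jet) : curves := (repr j).2.
Definition jet_base (j : jet) : mspace M := \val (jet_curve j) (jet_time j).

(* Row k of the matrix holds the k-th derivative at t of the coordinates x^i
   along the curve, so the induced coordinates are (t, x^i, xdot^i) for r = 1
   and (t, x^i, xdot^i, xddot^i) for r = 2. *)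
Definition jet_chart (c : chart 'rV[R]_n (mspace M)) :
    chart (R * 'M[R]_(r.+1, n))%type jet :=
  Chart (fun j => dom c (jet_base j))
    (fun j => (jet_time j,
       \matrix_(k < r.+1, i < n)
         derive1n k (coord c \o \val (jet_curve j)) (jet_time j) 0 i)).

Definition jets : atlased R :=
  @Atlased R jet (R * 'M[R]_(r.+1, n))%type [set jet_chart c | c in mcharts M].

End Jets.

(* p^{rs} : M^r -> M^s, meant for s <= r *)
Definition jet_proj (R : realType) (n : nat) (M : manifold R n) (r s : nat)
    (j : jets M r) : jets M s := mk_jet s (jet_time j) (jet_curve j).

Definition sode (R : realType) (n : nat) (M : manifold R n)
    (s : jets M 1 -> jets M 2) : Prop :=
  smooth_map s /\ cancel s (@jet_proj R n M 2 1).

(* Aut^v(p) *)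
Definition vertical_aut (R : realType) (n : nat) (M : manifold R n)
    (Phi : evolution M -> evolution M) : Prop :=
  diffeo Phi /\
  exists phi : evolution M -> M,
    smooth_map phi /\ forall t x, Phi (t, x) = (t, phi (t, x)).

(* Phi^(r) (j^r_t g) is the r-jet at t of s |-> phi (s, g s).  That curve is
   smooth when Phi is, so the default value of insubd is not used. *)
Definition prolong (R : realType) (n : nat) (M : manifold R n) (r : nat)
    (Phi : evolution M -> evolution M) (j : jets M r) : jets M r :=
  mk_jet r (jet_time j)
    (insubd (jet_curve j) (fun s => (Phi (s, \val (jet_curve j) s)).2)).
Arguments prolong {R n M} r Phi j.

(* The inverse of a bijection. *)
Definition inverse (T : choiceType) (f : T -> T) : T -> T :=
  'pinv_id [set: T] f.

(* Tangent vectors at p are the operators h |-> (h \o g)'(0) on smooth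
   functions, for g a smooth curve through p at time 0.  They are extended by 0
   to the other functions, so that equal tangent vectors are Leibniz equal. *)
Section VectorFields.
Context {R : realType} (N : atlased R).

Definition velocity (g : R -> N) : (N -> R) -> R :=
  fun h => if `[< smooth_fun h >] then derive1 (h \o g) 0 else 0.

Definition tangent (p : N) : set ((N -> R) -> R) :=
  [set velocity g | g in [set g | smooth_curve g /\ g 0 = p]].

Definition pre_field := N -> (N -> R) -> R.

Definition vector_field : set pre_field :=
  [set X | (forall p, tangent p (X p)) /\
           forall h, smooth_fun h -> smooth_fun (fun p => X p h)].

Definition push (f : N -> N) (X : pre_field) : pre_field :=
  fun p h => X (inverse f p) (h \o f).

Definition eq_on (A : set N) (X Y : pre_field) : Prop :=
  forall p, A p -> forall h, smooth_fun h -> X p h = Y p h.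

(* Linear connections as covariant derivatives; additivity and the product rule
   in the second argument include R-linearity. *)
Record linear_connection (D : pre_field -> pre_field -> pre_field) : Prop := {
  conn_field : forall X Y,
    vector_field X -> vector_field Y -> vector_field (D X Y);
  conn_addl : forall X X' Y,
    vector_field X -> vector_field X' -> vector_field Y ->
    D (X + X') Y = D X Y + D X' Y;
  conn_scalel : forall f X Y,
    smooth_fun f -> vector_field X -> vector_field Y ->
    D (fun p => f p *: X p) Y = fun p => f p *: D X Y p;
  conn_addr : forall X Y Y',
    vector_field X -> vector_field Y -> vector_field Y' ->
    D X (Y + Y') = D X Y + D X Y';
  conn_leibniz : forall f X Y,
    smooth_fun f -> vector_field X -> vector_field Y ->
    D X (fun p => f p *: Y p) = fun p => X p f *: Y p + f p *: D X Y p }.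

(* D_A B = C on the open set U, for vector fields A, B on U: a connection is a
   local operator, so this is read off global fields extending A and B. *)
Definition conn_on (D : pre_field -> pre_field -> pre_field) (U : set N)
    (A B C : pre_field) : Prop :=
  forall X Y, vector_field X -> vector_field Y ->
    eq_on U X A -> eq_on U Y B -> eq_on U (D X Y) C.

End VectorFields.

Section Chern.
Context {R : realType} {n : nat} {M : manifold R n}.
Let J1 := jets M 1.

Section Coordinates.
Variables (s : J1 -> jets M 2) (c : chart 'rV[R]_n (mspace M)).

Definition partial (u : R * 'M[R]_(2, n)) (h : J1 -> R) (j : J1) : R :=
  'D_u (in_chart (jet_chart 1 c) h) (coord (jet_chart 1 c) j).

Definition d_t : pre_field J1 := fun j h => partial (1, 0) h j.
Definition d_x (i : 'I_n) : pre_field J1 :=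
  fun j h => partial (0, delta_mx ord0 i) h j.
Definition d_xdot (i : 'I_n) : pre_field J1 :=
  fun j h => partial (0, delta_mx ord_max i) h j.

Definition xdot (i : 'I_n) (j : J1) : R :=
  (coord (jet_chart 1 c) j).2 ord_max i.

Definition force (i : 'I_n) (j : J1) : R :=
  (coord (jet_chart 2 c) (s j)).2 ord_max i.

(* dF^k / dxdot^i and d^2 F^k / dxdot^i dxdot^l *)
Definition dforce (k i : 'I_n) (j : J1) : R := d_xdot i j (force k).
Definition d2force (k i l : 'I_n) (j : J1) : R := d_xdot i j (dforce k l).

Definition X_sode : pre_field J1 := fun j =>
  d_t j + \sum_i xdot i j *: d_x i j + \sum_i force i j *: d_xdot i j.

Definition X_hor (i : 'I_n) : pre_field J1 := fun j =>
  d_x i j + 2^-1 *: \sum_k dforce k i j *: d_xdot k j.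

End Coordinates.

Definition is_chern (s : J1 -> jets M 2)
    (D : pre_field J1 -> pre_field J1 -> pre_field J1)
    : Prop :=
  linear_connection D /\
  forall (c : chart 'rV[R]_n (mspace M)) (U : set J1),
    mcharts M c -> open_in U -> U `<=` dom (jet_chart 1 c) ->
    let X0 := X_sode s c in let H := X_hor s c in let V := d_xdot c in
    let dF := dforce s c in let d2F := d2force s c in
    [/\ (forall Y, vector_field Y -> conn_on D U Y X0 0),
        (forall i, conn_on D U X0 (H i)
           (fun j => - 2^-1 *: \sum_k dF k i j *: H k j)) /\
        (forall i, conn_on D U X0 (V i)
           (fun j => - 2^-1 *: \sum_k dF k i j *: V k j)),
        (forall i l, conn_on D U (H l) (H i)
           (fun j => - 2^-1 *: \sum_k d2F k i l j *: H k j)) /\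
        (forall i l, conn_on D U (H l) (V i)
           (fun j => - 2^-1 *: \sum_k d2F k i l j *: V k j)),
        (forall i l, conn_on D U (V l) (H i) 0) &
        (forall i l, conn_on D U (V l) (V i) 0)].

Definition act_sode (Phi : evolution M -> evolution M) (s : J1 -> jets M 2) :
    J1 -> jets M 2 :=
  prolong 2 Phi \o s \o inverse (prolong 1 Phi).

Definition act_conn (Phi : evolution M -> evolution M)
    (D : pre_field J1 -> pre_field J1 -> pre_field J1) :
    pre_field J1 -> pre_field J1 -> pre_field J1 :=
  fun X Y => push (prolong 1 Phi)
    (D (push (inverse (prolong 1 Phi)) X) (push (inverse (prolong 1 Phi)) Y)).

End Chern.

(* Main.v *)
From HB Require Import structures.
From mathcomp Require Import all_boot all_order all_algebra.
From mathcomp Require Import all_classical all_reals all_analysis.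
From mathcomp Require Import ring.
Require Import Defs.

(** Let s' be the sode Phi . s, let Psi be the inverse of Phi and, in charts, let
    F(t, x) be the coordinate expression of the second component of Psi.  The
    first prolongation of Psi is then (t, x, v) |-> (t, F(t, x), DF(1, v)), and
    Psi^(2) o s' = s o Psi^(1) relates the forces f of s and f' of s':
      f^k o Psi^(1) = D^2 F^k((1, v), (1, v)) + f'^l B_l^k,
    where B_l^k = dF^k / dx^l depends on (t, x) only.  The first term is
    quadratic in v; so one derivative along the i-th velocity gives, with the
    symmetry of D^2 F,
      B_i^j (df^k/dv^j o Psi^(1)) =
        2 D^2 F^k(e_i, (1, v)) + (df'^l/dv^i) B_l^k        [force_transform],
    and a second one gives the law for the second derivatives of the forces.

    These laws say two things.  First, the tangent map of Psi^(1) sends X^s' to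
    X^s, X_i^s' to B_i^k X_k^s and d/dv^i to B_i^k d/dv^k: the correction
    (1/2) df^j/dv^i in X_i is what absorbs half of the term with D^2 F
    [push_sode, push_hor, push_dot].  Second, the derivatives of B_i^k along
    X^s', X_l^s' and d/dv^l are exactly what the Leibniz rule needs in order that
    the Chern equations of s at Psi^(1) p become those of s' at p
    [derive_jac_xi0, derive_jac_xiH, derive_jac_dv].  Hence Phi . D satisfies the
    equations that define a Chern connection of s' [chern_push].  Since these
    equations prescribe D on a local frame, and a connection is determined by its
    values on a local frame, any other solution agrees with it [chern_unique].

    The Chern equations speak of global vector fields that agree with the
    coordinate fields on an open set.  To use them one has to extend the frame
    and the functions B_i^k from a neighbourhood of a point to the whole of M^1,
    and to know that connections are local operators.  Both come from bump
    functions; these extend by zero outside a chart because a closed coordinate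
    ball of M is compact, hence closed, M being a Hausdorff space
    [jets_have_bumps].

    The remaining ingredient is that M^1 and M^2 are manifolds on which
    prolongations are smooth.  By the chain rule, the induced coordinates of the
    image of a jet are a smooth function, lift, of those of the jet
    [jet_coord_lift]; applied to the projection of R x M on M this compares two
    induced charts.  Every admissible value of the coordinates is attained,
    because a curve with given 2-jet can be chosen inside a given ball
    [bounded_curve]. *)

Set Implicit Arguments.
Unset Strict Implicit.
Unset Printing Implicit Defensive.

Import Order.TTheory GRing.Theory Num.Theory numFieldNormedType.Exports.

Local Open Scope classical_set_scope.
Local Open Scope ring_scope.

(** * Maps of class C^k *)

Section NearZero.
Context {R : realType} {V W : normedModType R}.
Implicit Types f g h : V -> W.

(** Differentiability is a statement about the differential at the point, so
    that it does not transfer along a local equality by rewriting. The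
    difference of the two functions vanishes near the point, and this case is
    settled by exhibiting the differential 0. *)
Lemma near0_differentiable h (a : V) :
  (\forall x \near a, h x = 0) -> differentiable h a.
Proof.
move=> h0.
have ha : h a = 0 by exact: (nbhs_singleton h0).
have h0' : \forall x \near (0 : V), h (x + a) = 0.
  move: h0; rewrite (near_shift 0 a) /=; apply: filterS => x /=.
  by rewrite subr0.
have ho : h \o shift a = cst (h a) + (0 : V -> W) +o_ 0 id.
  apply/eqaddoP => e e0; near=> x.
  rewrite [X in `|X|](_ : _ = 0) ?normr0 ?mulr_ge0 ?(ltW e0)//.
  rewrite -[LHS]/(h (x + a) - (h a + 0)) ha addr0 subr0; near: x; exact: h0'.
have d0 : 'd h a = (0 : V -> W) :> (V -> W).
  by apply/diff_unique => //; exact: cst_continuous.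
apply/diff_locallyP; rewrite d0; split => //; exact: cst_continuous.
Unshelve. all: by end_near. Qed.

Lemma near_eq_differentiable f g (a : V) :
  (\forall x \near a, f x = g x) -> differentiable f a -> differentiable g a.
Proof.
move=> fg df; rewrite (_ : g = f + (g - f)); last first.
  by apply/funext => x; rewrite -[RHS]/(f x + (g x - f x)) addrC subrK.
apply: (differentiableD df); apply: near0_differentiable.
by move: fg; apply: filterS => x fgx; rewrite -[LHS]/(g x - f x) fgx subrr.
Qed.

End NearZero.

Section CkBasics.
Context {R : realType}.
Implicit Types V W : normedModType R.

Lemma Ck_subset V W (A B : set V) k (f : V -> W) :
  A `<=` B -> Ck B k f -> Ck A k f.
Proof.
move=> AB; elim: k f => [|k IH] f /=; first by move=> + x /AB; apply.
by move=> [df cf]; split=> [x /AB/df//|v]; exact: IH.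
Qed.

Lemma Ck_le V W (U : set V) k (f : V -> W) : Ck U k.+1 f -> Ck U k f.
Proof.
elim: k f => [|k IH] f /= [df cf].
  by move=> x Ux; apply: differentiable_continuous; exact: df.
by split=> // v; apply: IH; exact: cf.
Qed.

(** No openness is asked of the sets A: both clauses of the definition of C^k
    are pointwise in the set, the directional derivatives being taken in the
    whole space. *)
Lemma Ck_local V W (U : set V) k (f : V -> W) :
  (forall x, U x -> exists A, [/\ A x & Ck A k f]) -> Ck U k f.
Proof.
elim: k f => [|k IH] f /= H.
  by move=> x /H[A [Ax]]; apply.
split=> [x /H[A [Ax []]]|v]; first by move=> + _; apply.
by apply: IH => x /H[A [Ax [_ cA]]]; exists A; split.
Qed.

Lemma open_near V (U : set V) (x : V) (P : V -> Prop) :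
  open U -> U x -> (forall y, U y -> P y) -> \forall y \near x, P y.
Proof.
by move=> oU Ux UP; apply: filterS (open_nbhs_nbhs (conj oU Ux)) => y /UP.
Qed.

Lemma Ck_eq V W (U : set V) k (f g : V -> W) :
  open U -> (forall x, U x -> f x = g x) -> Ck U k f -> Ck U k g.
Proof.
move=> oU; elim: k f g => [|k IH] f g fg /=.
  move=> cf x Ux; rewrite /prop_for /continuous_at -(fg x Ux).
  apply: cvg_trans (cf x Ux); apply: near_eq_cvg.
  exact: open_near oU Ux _.
move=> [df cf]; split=> [x Ux|v].
  by apply: near_eq_differentiable (df x Ux); exact: open_near oU Ux _.
apply: IH (cf v) => x Ux; apply: near_eq_derive.
exact: open_near oU Ux _.
Qed.

Lemma smooth_subset V W (A B : set V) (f : V -> W) :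
  A `<=` B -> smooth_on B f -> smooth_on A f.
Proof. by move=> AB sf k; exact: Ck_subset AB (sf k). Qed.

Lemma smooth_eq V W (U : set V) (f g : V -> W) :
  open U -> (forall x, U x -> f x = g x) -> smooth_on U f -> smooth_on U g.
Proof. by move=> oU fg sf k; exact: Ck_eq oU fg (sf k). Qed.

Lemma smooth_local V W (U : set V) (f : V -> W) :
  (forall x, U x -> exists A, A x /\ smooth_on A f) -> smooth_on U f.
Proof.
move=> H k; apply: Ck_local => x /H[A [Ax sA]]; exists A; split=> //.
Qed.

Lemma smooth_differentiable V W (U : set V) (f : V -> W) x :
  smooth_on U f -> U x -> differentiable f x.
Proof. by move=> /(_ 1%N)[df _]; exact: df. Qed.

Lemma smooth_continuous V W (U : set V) (f : V -> W) x :
  smooth_on U f -> U x -> {for x, continuous f}.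
Proof. by move=> /(_ 0%N); apply. Qed.

Lemma smooth_derive V W (U : set V) (f : V -> W) v :
  smooth_on U f -> smooth_on U (fun x => 'D_v f x).
Proof. by move=> sf k; have [_ +] := sf k.+1; apply.
Qed.

Lemma open_preimage_within V W (U : set V) (A : set W) (f : V -> W) :
  open U -> open A -> (forall x, U x -> {for x, continuous f}) ->
  open (U `&` f @^-1` A).
Proof.
move=> oU oA cf; rewrite openE => x [Ux Afx]; apply: filterI.
  exact: open_nbhs_nbhs.
by apply: (cf x Ux); exact: open_nbhs_nbhs.
Qed.

End CkBasics.

Section CkAlgebra.
Context {R : realType}.
Implicit Types V W : normedModType R.

Lemma Ck_cst V W (U : set V) k (w : W) : Ck U k (fun _ : V => w).
Proof.
elim: k w => [|k IH] w /=; first by move=> x _; exact: cst_continuous.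
split=> [x _|v]; first exact: differentiable_cst.
suff -> : 'D_v (fun _ : V => w) = (fun=> 0) by exact: IH.
by apply/funext => x; exact: derive_cst.
Qed.

Lemma Ck_linear V W (U : set V) k (f : {linear V -> W}) :
  continuous f -> Ck U k f.
Proof.
move=> cf; case: k => [|k] /=; first by move=> x _; exact: cf.
split=> [x _|v]; first exact: linear_differentiable.
suff -> : 'D_v f = (fun=> f v) by exact: Ck_cst.
apply/funext => x; rewrite deriveE; last exact: linear_differentiable.
by rewrite diff_lin.
Qed.

Lemma CkD V W (U : set V) k (f g : V -> W) : open U ->
  Ck U k f -> Ck U k g -> Ck U k (fun x => f x + g x).
Proof.
move=> oU; elim: k f g => [|k IH] f g /=.
  by move=> cf cg x Ux; apply: continuousD; [exact: cf|exact: cg].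
move=> [df cf] [dg cg]; split=> [x Ux|v].
  exact: (differentiableD (df x Ux) (dg x Ux)).
apply: Ck_eq oU _ (IH _ _ (cf v) (cg v)) => x Ux /=; apply/esym.
by apply: deriveD; apply: diff_derivable; [exact: df|exact: dg].
Qed.

Lemma Ck_sum V W (U : set V) k (I : Type) (s : seq I) (P : pred I)
    (f : I -> V -> W) : open U ->
  (forall i, P i -> Ck U k (f i)) -> Ck U k (fun x => \sum_(i <- s | P i) f i x).
Proof.
move=> oU cf; elim: s => [|i s IH].
  apply: (Ck_eq oU _ (Ck_cst U k (0 : W))) => x _ /=; by rewrite big_nil.
have [Pi|Pi] := boolP (P i).
  by apply: (Ck_eq oU _ (CkD oU (cf i Pi) IH)) => x _ /=; rewrite big_cons Pi.
by apply: (Ck_eq oU _ IH) => x _ /=; rewrite big_cons (negbTE Pi).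
Qed.

Lemma scale_is_bilinear V :
  bilinear_for
    (GRing.Scale.Law.clone _ _ *:%R _) (GRing.Scale.Law.clone _ _ *:%R _)
    (@GRing.scale R V : R -> V -> V).
Proof.
split=> [u'|u] a x y /=; first by rewrite scalerDl scalerA.
by rewrite scalerDr !scalerA mulrC.
Qed.
HB.instance Definition _ V := bilinear_isBilinear.Build R R V V _ _
  (@GRing.scale R V : R -> V -> V) (@scale_is_bilinear V).

Lemma is_diff_scale V W (a : V -> R) (f : V -> W) x :
  differentiable a x -> differentiable f x ->
  is_diff x (fun x => a x *: f x)
    (fun v => a x *: 'd f x v + 'd a x v *: f x).
Proof.
move=> da df.
have sc : continuous (fun p : R * W => p.1 *: p.2) by exact: scale_continuous.
have db := @differentiable_bilin R R W W (@GRing.scale R W) (a x, f x) sc.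
have dp := differentiable_pair da df.
apply: DiffDef.
  exact: (differentiable_comp dp db).
rewrite (diff_comp dp db); apply/funext => v /=.
by rewrite (diff_bilin _ sc) (diff_pair da df).
Qed.

Lemma derive_scale V W (a : V -> R) (f : V -> W) x v :
  differentiable a x -> differentiable f x ->
  'D_v (fun x => a x *: f x) x = 'D_v a x *: f x + a x *: 'D_v f x.
Proof.
move=> da df; have [dd de] := is_diff_scale da df.
by rewrite !deriveE// de addrC.
Qed.

(** The product rule needs the factors themselves at the lower order, hence
    Ck_le. *)
Lemma CkZ V W (U : set V) k (a : V -> R) (f : V -> W) : open U ->
  Ck U k a -> Ck U k f -> Ck U k (fun x => a x *: f x).
Proof.
move=> oU; elim: k a f => [|k IH] a f.
  by move=> ca cf x Ux; apply: continuousZ; [exact: ca|exact: cf].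
move=> /[dup] Ca [da ca] /[dup] Cf [df cf]; split=> [x Ux|v].
  by case: (is_diff_scale (da x Ux) (df x Ux)).
apply: Ck_eq oU _ (CkD oU (IH _ _ (ca v) (Ck_le Cf)) (IH _ _ (Ck_le Ca) (cf v))).
by move=> x Ux /=; rewrite (derive_scale _ (da x Ux) (df x Ux)).
Qed.

End CkAlgebra.

(** * Composition of C^k maps in finite dimension *)

Section FiniteDim.
Context {R : realType}.
Implicit Types U V W : normedModType R.

(** A finite family e with continuous coordinates l: the form in which finite
    dimension enters the chain rule, and which passes to products at once. *)
Definition findim V := exists (I : finType) (e : I -> V) (l : I -> {linear V -> R}),
  (forall i, continuous (l i)) /\ forall w, w = \sum_i l i w *: e i.

Lemma findimR : findim R.
Proof.
exists unit, (fun _ => 1), (fun _ => idfun : {linear R -> R}); split.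
  by move=> _ x; exact: cvg_id.
by move=> w; rewrite big_const card_unit /= addr0 /idfun/= [RHS]mulr1.
Qed.

Definition mx_entry m n (ij : 'I_m * 'I_n) (A : 'M[R]_(m, n)) : R := A ij.1 ij.2.

Fact mx_entry_linear m n ij : linear (@mx_entry m n ij).
Proof. by move=> a A B; rewrite /mx_entry !mxE. Qed.
HB.instance Definition _ m n ij := GRing.isLinear.Build R 'M[R]_(m, n) R _
  (@mx_entry m n ij) (mx_entry_linear ij).

Lemma mx_entry_continuous m n ij : continuous (@mx_entry m n ij).
Proof.
by move=> A; apply: differentiable_continuous; exact: differentiable_coord.
Qed.

Lemma findim_mx m n : findim 'M[R]_(m, n).
Proof.
exists ('I_m * 'I_n)%type, (fun ij => delta_mx ij.1 ij.2),
  (fun ij => mx_entry ij : {linear 'M[R]_(m, n) -> R}); split.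
  by move=> ij; exact: mx_entry_continuous.
by move=> A; rewrite {1}[A]matrix_sum_delta pair_big.
Qed.

Lemma fst_continuous V W : continuous (fst : V * W -> V).
Proof. by move=> x; exact: cvg_fst. Qed.

Lemma snd_continuous V W : continuous (snd : V * W -> W).
Proof. by move=> x; exact: cvg_snd. Qed.

Lemma findim_prod V W : findim V -> findim W -> findim (V * W)%type.
Proof.
move=> [I [e [l [lc lE]]]] [J [d [k [kc kE]]]].
exists (I + J)%type,
  (fun s => match s with inl i => (e i, 0) | inr j => (0, d j) end),
  (fun s => match s with
   | inl i => (l i \o fst : {linear (V * W)%type -> R})
   | inr j => (k j \o snd : {linear (V * W)%type -> R}) end).
split.
  by move=> [i|j] x; apply: continuous_comp; 
    [exact: fst_continuous|exact: lc|exact: snd_continuous|exact: kc].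
move=> [v w]; rewrite big_sumType /=.
apply: injective_projections => /=.
  rewrite !raddf_sum /= [X in _ + X]big1 ?addr0 => [|j _]; last first.
    by rewrite scaler0.
  exact: lE.
rewrite !raddf_sum /= [X in X + _]big1 ?add0r => [|j _]; last first.
    by rewrite scaler0.
exact: kE.
Qed.

(** A derivative in the direction w is a combination of the finitely many
    derivatives along e. This turns the derivative of a composite, whose
    direction varies with the point, into sums and products of functions to
    which the induction on the order applies. *)
Lemma derive_frame V W (I : finType) (e : I -> V) (l : I -> {linear V -> R})
    (f : V -> W) x (w : V) :
  (forall w, w = \sum_i l i w *: e i) -> differentiable f x ->
  'D_w f x = \sum_i l i w *: 'D_(e i) f x.
Proof.
move=> lE df; rewrite deriveE// {1}(lE w) linear_sum.
by apply: eq_bigr => i _; rewrite linearZ deriveE.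
Qed.

Lemma derive_comp U V W (f : U -> V) (g : V -> W) x u :
  differentiable f x -> differentiable g (f x) ->
  'D_u (g \o f) x = 'D_('D_u f x) g (f x).
Proof.
move=> df dg; rewrite !deriveE//; first by rewrite (diff_comp df dg).
exact: differentiable_comp.
Qed.

Lemma derive_linear_comp U V W (f : U -> V) (L : {linear V -> W}) x u :
  continuous L -> differentiable f x -> 'D_u (L \o f) x = L ('D_u f x).
Proof.
move=> cL df; rewrite derive_comp//; last exact: linear_differentiable.
by rewrite deriveE ?diff_lin//; exact: linear_differentiable.
Qed.

Lemma Ck_linear_comp U V W (A : set U) k (f : U -> V) (L : {linear V -> W}) :
  open A -> continuous L -> Ck A k f -> Ck A k (L \o f).
Proof.
move=> oA cL; elim: k f => [|k IH] f.
  by move=> cf x Ax; apply: continuous_comp; [exact: cf|exact: cL].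
move=> [df cf]; split=> [x Ax|v].
  by apply: (differentiable_comp (df x Ax)); exact: linear_differentiable.
apply: Ck_eq oA _ (IH _ (cf v)) => x Ax /=.
by rewrite (derive_linear_comp _ cL (df x Ax)).
Qed.

Lemma Ck_comp U V W (A : set U) (B : set V) k (f : U -> V) (g : V -> W) :
  findim V -> open A -> (forall x, A x -> B (f x)) ->
  Ck A k f -> Ck B k g -> Ck A k (g \o f).
Proof.
move=> [I [e [l [lc lE]]]] oA AB; elim: k f g AB => [|k IH] f g AB.
  move=> cf cg x Ax; apply: continuous_comp; first exact: cf.
  by apply: cg; exact: AB.
move=> /[dup] Cf [df cf] /[dup] Cg [dg cg]; split=> [x Ax|v].
  by apply: (differentiable_comp (df x Ax)); apply: dg; exact: AB.
apply: (@Ck_eq _ _ _ _ _ 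
  (fun x => \sum_i l i ('D_v f x) *: ('D_(e i) g \o f) x)) => //.
  move=> x Ax /=; rewrite (derive_comp _ (df x Ax) (dg _ (AB x Ax))).
  by rewrite (derive_frame _ lE)//; apply: dg; exact: AB.
apply: Ck_sum => // i _; apply: CkZ => //.
  exact: Ck_linear_comp oA (lc i) (cf v).
exact: IH AB (Ck_le Cf) (cg _).
Qed.

Lemma Ck_pair U V W (A : set U) k (f : U -> V) (g : U -> W) : open A ->
  Ck A k f -> Ck A k g -> Ck A k (fun x => (f x, g x)).
Proof.
move=> oA; elim: k f g => [|k IH] f g.
  by move=> cf cg x Ax; apply: cvg_pair; [exact: cf|exact: cg].
move=> [df cf] [dg cg]; split=> [x Ax|v].
  exact: (differentiable_pair (df x Ax) (dg x Ax)).
apply: Ck_eq oA _ (IH _ _ (cf v) (cg v)) => x Ax /=.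
have dp := differentiable_pair (df x Ax) (dg x Ax).
rewrite (deriveE v dp) (diff_pair (df x Ax) (dg x Ax)).
by rewrite (deriveE v (df x Ax)) (deriveE v (dg x Ax)).
Qed.

Lemma derive_pair U V W (f : U -> V) (g : U -> W) x v :
  differentiable f x -> differentiable g x ->
  'D_v (fun x => (f x, g x)) x = ('D_v f x, 'D_v g x).
Proof.
move=> df dg; have dp := differentiable_pair df dg.
by rewrite (deriveE v dp) (diff_pair df dg) (deriveE v df) (deriveE v dg).
Qed.

End FiniteDim.

Existing Class findim.
#[export] Existing Instance findimR.
#[export] Existing Instance findim_mx.
#[export] Existing Instance findim_prod.

Section SmoothAlgebra.
Context {R : realType}.
Implicit Types U V W : normedModType R.

Lemma smooth_cst V W (U : set V) (w : W) : smooth_on U (fun _ : V => w).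
Proof. by move=> k; exact: Ck_cst. Qed.

Lemma smooth_linear V W (U : set V) (f : {linear V -> W}) :
  continuous f -> smooth_on U f.
Proof. by move=> cf k; exact: Ck_linear. Qed.

Lemma smooth_id V (U : set V) : smooth_on U (@id V).
Proof.
by apply: (@smooth_linear _ _ _ (idfun : {linear V -> V})) => x; exact: cvg_id.
Qed.

Lemma smooth_fst V W (U : set (V * W)%type) : smooth_on U fst.
Proof.
apply: (@smooth_linear _ _ _ (fst : {linear (V * W)%type -> V})).
exact: fst_continuous.
Qed.

Lemma smooth_snd V W (U : set (V * W)%type) : smooth_on U snd.
Proof.
apply: (@smooth_linear _ _ _ (snd : {linear (V * W)%type -> W})).
exact: snd_continuous.
Qed.

Section Closure.
Context {V : normedModType R} (U : set V) (oU : open U).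

Lemma smoothD W (f g : V -> W) :
  smooth_on U f -> smooth_on U g -> smooth_on U (fun x => f x + g x).
Proof. by move=> sf sg k; exact: CkD. Qed.

Lemma smooth_sum W (I : Type) (s : seq I) (P : pred I) (f : I -> V -> W) :
  (forall i, P i -> smooth_on U (f i)) ->
  smooth_on U (fun x => \sum_(i <- s | P i) f i x).
Proof. by move=> sf k; apply: Ck_sum => // i Pi; exact: sf. Qed.

Lemma smoothZ W (a : V -> R) (f : V -> W) :
  smooth_on U a -> smooth_on U f -> smooth_on U (fun x => a x *: f x).
Proof. by move=> sa sf k; exact: CkZ. Qed.

Lemma smoothN W (f : V -> W) : smooth_on U f -> smooth_on U (fun x => - f x).
Proof.
move=> sf; apply: smooth_eq oU _ (smoothZ (smooth_cst U (-1 : R)) sf) => x _.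
by rewrite scaleN1r.
Qed.

Lemma smoothM (a b : V -> R) :
  smooth_on U a -> smooth_on U b -> smooth_on U (fun x => a x * b x).
Proof. exact: smoothZ. Qed.

Lemma smooth_pair W W' (f : V -> W) (g : V -> W') :
  smooth_on U f -> smooth_on U g -> smooth_on U (fun x => (f x, g x)).
Proof. by move=> sf sg k; exact: Ck_pair. Qed.

Lemma smooth_linear_comp W W' (f : V -> W) (L : {linear W -> W'}) :
  continuous L -> smooth_on U f -> smooth_on U (L \o f).
Proof. by move=> cL sf k; exact: Ck_linear_comp. Qed.

Lemma smooth_comp W W' {fW : findim W} (B : set W) (f : V -> W) (g : W -> W') :
  (forall x, U x -> B (f x)) -> smooth_on U f -> smooth_on B g ->
  smooth_on U (g \o f).
Proof. by move=> UB sf sg k; exact: (Ck_comp fW oU UB). Qed.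

Lemma smooth_entry m n (f : V -> 'M[R]_(m, n)) i j :
  smooth_on U f -> smooth_on U (fun x => f x i j).
Proof.
move=> sf; apply: (@smooth_linear_comp _ _ f 
  (mx_entry (i, j) : {linear 'M[R]_(m, n) -> R})) sf.
exact: mx_entry_continuous.
Qed.

Lemma smooth_mx m n (f : V -> 'M[R]_(m, n)) :
  (forall i j, smooth_on U (fun x => f x i j)) -> smooth_on U f.
Proof.
move=> sf; apply: (smooth_eq oU (f := fun x => \sum_i \sum_j f x i j *: delta_mx i j)).
  by move=> x _; rewrite [RHS]matrix_sum_delta.
apply: smooth_sum => i _; apply: smooth_sum => j _.
by apply: smoothZ => //; exact: smooth_cst.
Qed.

End Closure.

Lemma open_fst_preimage V W (U : set V) :
  open U -> open [set z : V * W | U z.1].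
Proof.
by move=> oU; apply: (open_comp (f := fst)) => // x _; exact: fst_continuous.
Qed.

(** The total differential, jointly in the point and in the direction. It makes
    second order prolongations derivatives of a smooth map again. *)
Lemma smooth_derive_joint V W {fV : findim V} (U : set V) (f : V -> W) :
  open U -> smooth_on U f ->
  smooth_on [set z : V * V | U z.1] (fun z => 'D_(z.2) f z.1).
Proof.
move=> oU sf; have [I [e [l [lc lE]]]] := fV.
have oU' := @open_fst_preimage V V _ oU.
apply: (smooth_eq oU' (f := fun z => \sum_i l i z.2 *: 'D_(e i) f z.1)).
  by move=> z Uz /=; rewrite -(derive_frame _ lE)//; exact: smooth_differentiable sf Uz.
apply: smooth_sum => // i _; apply: smoothZ => //.
  by apply: (smooth_linear_comp oU' (lc i)); exact: smooth_snd.
apply: (smooth_comp oU' (B := U) (g := 'D_(e i) f)) => //; first exact: smooth_fst.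
exact: smooth_derive.
Qed.

End SmoothAlgebra.

(** * Symmetry of second derivatives *)

Section Schwarz.
Context {R : realType}.
Implicit Types V W : normedModType R.

Lemma is_derive_line V W (f : V -> W) (p u : V) (s : R) :
  differentiable f (p + s *: u) ->
  is_derive s 1 (fun s => f (p + s *: u)) ('D_u f (p + s *: u)).
Proof.
move=> df.
have dl : is_diff s (fun s : R => p + s *: u) (fun t : R => t *: u).
  apply: is_diff_eq; rewrite add0r.
by apply/funext => t /=.
have [dd de] := dl.
apply: DeriveDef; first exact/diff_derivable/(differentiable_comp dd df).
rewrite -[LHS]/('D_(1 : R) (f \o (fun s => p + s *: u)) s).
by rewrite (derive_comp (1 : R) dd df) (deriveE (1 : R) dd) de scale1r.
Qed.

(** Two applications of the mean value theorem, to the second difference of f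
    over a parallelogram. *)
Lemma mixed_difference V (f : V -> R) (U : set V) (x u v : V) (d : R) :
  smooth_on U f -> 0 <= d ->
  (forall s t, 0 <= s <= d -> 0 <= t <= d -> U (x + s *: u + t *: v)) ->
  exists s t, [/\ 0 <= s <= d, 0 <= t <= d &
    f (x + d *: u + d *: v) - f (x + d *: u) - (f (x + d *: v) - f x) =
    'D_v ('D_u f) (x + s *: u + t *: v) * d * d].
Proof.
move=> sf d0 H.
have df y : U y -> differentiable f y by exact: smooth_differentiable.
have ddf y : U y -> differentiable ('D_u f) y.
  by apply: smooth_differentiable; exact: smooth_derive.
have H0 s : 0 <= s <= d -> U (x + s *: u).
  by move=> sd; have := H s 0 sd; rewrite scale0r addr0; apply; rewrite lexx.
have Hd s : 0 <= s <= d -> U (x + d *: v + s *: u).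
  by move=> sd; rewrite addrAC; apply: H => //; rewrite d0 lexx.
pose g s := f (x + d *: v + s *: u) - f (x + s *: u).
pose dg s := 'D_u f (x + d *: v + s *: u) - 'D_u f (x + s *: u).
have gd s : 0 <= s <= d -> is_derive s 1 g (dg s).
  move=> sd; apply: is_deriveB; apply: is_derive_line.
    exact/df/Hd.
  exact/df/H0.
have [s] : exists2 s, s \in `[0, d] & g d - g 0 = dg s * (d - 0).
  apply: (MVT_segment d0).
    move=> s; rewrite in_itv /= => /andP[s0 sd]; apply: gd; by rewrite !ltW.
  apply: derivable_within_continuous => s; rewrite in_itv /= => sd.
  by case: (gd s sd).
rewrite in_itv /= subr0 => sd gE.
pose k t := 'D_u f (x + s *: u + t *: v).
have kd t : 0 <= t <= d -> is_derive t 1 k ('D_v ('D_u f) (x + s *: u + t *: v)).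
  by move=> td; apply: is_derive_line; apply: ddf; exact: H.
have [t] : exists2 t, t \in `[0, d] &
    k d - k 0 = 'D_v ('D_u f) (x + s *: u + t *: v) * (d - 0).
  apply: (@MVT_segment _ k (fun t => 'D_v ('D_u f) (x + s *: u + t *: v)) _ _ d0).
    move=> t; rewrite in_itv /= => /andP[s0 td]; apply: kd; by rewrite !ltW.
  apply: derivable_within_continuous => t; rewrite in_itv /= => td.
  by case: (kd t td).
rewrite in_itv /= subr0 => td kE.
exists s, t; split => //; rewrite -kE.
move: gE; rewrite /g /dg /k !scale0r !addr0.
rewrite ![x + d *: v + _]addrAC => <-; ring.
Qed.

Lemma small_parallelogram V (x u v : V) (P : V -> Prop) :
  (\forall y \near x, P y) -> exists d : R, 0 < d /\
  forall s t : R, 0 <= s <= d -> 0 <= t <= d -> P (x + s *: u + t *: v).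
Proof.
move=> N.
have cl : (fun p : R * R => x + p.1 *: u + p.2 *: v) @ (0 : R, 0 : R) --> x.
  have -> : nbhs x = nbhs (x + 0 *: u + 0 *: v) by rewrite !scale0r !addr0.
  apply: cvgD; first apply: cvgD; first exact: cvg_cst.
  - by apply: cvgZr_tmp; exact: cvg_fst.
  - by apply: cvgZr_tmp; exact: cvg_snd.
have /nbhs_ballP[d d0 H] := cl _ N.
exists (d / 2); split => [|s t /andP[s0 sd] /andP[t0 td]]; first by rewrite divr_gt0.
have dd : d / 2 < d by rewrite ltr_pdivrMr// ltr_pMr// ltr1n.
apply: (H (s, t)); split; rewrite /ball /= sub0r normrN ger0_norm//.
  exact: le_lt_trans dd.
exact: le_lt_trans dd.
Qed.

(** The second difference is symmetric in u and v, and by mixed_difference it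
    equals either mixed derivative at some point of a small parallelogram;
    continuity at x concludes. *)
Lemma derive_comm V (f : V -> R) (U : set V) (x u v : V) :
  open U -> smooth_on U f -> U x -> 'D_v ('D_u f) x = 'D_u ('D_v f) x.
Proof.
move=> oU sf Ux; apply/eqP; rewrite -subr_eq0 -normr_le0; apply/ler_addgt0Pl => e e0.
rewrite addr0.
(* Only the continuity of the two mixed derivatives matters below. *)
have [a aE] : exists a : V -> R, forall y, 'D_v ('D_u f) y = a y.
  by exists ('D_v ('D_u f)).
have [b bE] : exists b : V -> R, forall y, 'D_u ('D_v f) y = b y.
  by exists ('D_u ('D_v f)).
rewrite aE bE.
have ca : {for x, continuous a}.
  have <- : 'D_v ('D_u f) = a by exact: funext.
  apply: smooth_continuous Ux; exact: smooth_derive (smooth_derive _ sf).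
have cb : {for x, continuous b}.
  have <- : 'D_u ('D_v f) = b by exact: funext.
  apply: smooth_continuous Ux; exact: smooth_derive (smooth_derive _ sf).
have e2 : 0 < e / 2 by rewrite divr_gt0.
have N : \forall y \near x, [/\ U y, `|a x - a y| < e / 2 & `|b x - b y| < e / 2].
  have Na : \forall y \near x, `|a x - a y| < e / 2 by move/cvgrPdist_lt: ca; apply.
  have Nb : \forall y \near x, `|b x - b y| < e / 2 by move/cvgrPdist_lt: cb; apply.
  by apply: filterS3 (open_nbhs_nbhs (conj oU Ux)) Na Nb => y ? ? ?; split.
have [d [d0 H]] := small_parallelogram u v N.
have HU s t : 0 <= s <= d -> 0 <= t <= d -> U (x + s *: u + t *: v).
  by move=> hs ht; case: (H s t hs ht).
have [s1 [t1 [hs1 ht1 E1]]] := @mixed_difference _ f U x u v d sf (ltW d0) HU.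
have HU' s t : 0 <= s <= d -> 0 <= t <= d -> U (x + s *: v + t *: u).
  by move=> hs ht; rewrite addrAC; case: (H t s ht hs).
have [t2 [s2 [ht2 hs2 E2]]] := @mixed_difference _ f U x v u d sf (ltW d0) HU'.
rewrite aE in E1; rewrite bE in E2.
have E : a (x + s1 *: u + t1 *: v) = b (x + t2 *: v + s2 *: u).
  have n0 : d * d != 0 :> R by rewrite mulf_neq0// gt_eqF.
  apply: (mulIf n0); rewrite !mulrA; apply: (etrans (esym E1)).
  apply: etrans E2; rewrite [x + d *: v + _]addrAC.
  by rewrite !opprD !addrA [f (x + d *: u + d *: v) - _ - _]addrAC.
have [_ h1 _] := H s1 t1 hs1 ht1; have [_ _ h2] := H s2 t2 hs2 ht2.
rewrite [x + s2 *: u + _]addrAC in h2.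
rewrite -(subrK (a (x + s1 *: u + t1 *: v)) (a x)) -addrA.
rewrite (le_trans (ler_normD _ _))// (splitr e) lerD ?ltW//.
by rewrite E distrC.
Qed.

End Schwarz.

(** * A smooth step on the line *)

Section OneVariable.
Context {R : realType}.
Implicit Types W : normedModType R.

(** On the line one derivative function suffices, since D_v f = v f'. *)
Lemma CkS_is_derive W (U : set R) k (f g : R -> W) :
  open U -> (forall x, U x -> is_derive x 1 f (g x)) -> Ck U k g ->
  Ck U k.+1 f.
Proof.
move=> oU fg cg.
have df x : U x -> differentiable f x.
  by move=> /fg[d _]; exact/derivable1_diffP.
split=> [//|v]; apply: (Ck_eq oU _ (CkZ oU (Ck_cst U k (v : R)) cg)) => x Ux.
have [d <-] := fg x Ux.
rewrite (deriveE v (df x Ux)) (deriveE (1 : R) (df x Ux)) -linearZ /=.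
by congr ('d f x _); exact: mulr1.
Qed.

Lemma smooth_sin_cos (U : set R) :
  open U -> smooth_on U (sin : R -> R) /\ smooth_on U (cos : R -> R).
Proof.
move=> oU; suff H k : Ck U k (sin : R -> R) /\ Ck U k (cos : R -> R).
  by split=> k; have [] := H k.
elim: k => [|k [IHs IHc]].
  by split=> x _; [exact: continuous_sin|exact: continuous_cos].
split; first exact: (CkS_is_derive oU _ IHc).
apply: (CkS_is_derive oU (g := fun x => - sin x)) => //.
apply: Ck_eq oU _ (CkZ oU (Ck_cst U k (-1 : R)) IHs) => x _.
by rewrite scaleN1r.
Qed.

Lemma is_derive_inv (x : R) :
  x != 0 -> is_derive x 1 (fun x : R => x^-1) (- (x^-1 * x^-1)).
Proof.
move=> x0; apply: is_derive_eq (is_deriveV (f := id) x0 (is_derive_id x 1)) _.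
by rewrite -[LHS]/(_ * _) mulr1 -exprVn expr2.
Qed.

Lemma smooth_inv : smooth_on [set x : R | x != 0] (fun x => x^-1).
Proof.
have oU : open [set x : R | x != 0].
  rewrite (_ : [set x : R | x != 0] = ~` [set 0]); last first.
    by apply/seteqP; split=> x /=; [move/eqP|move/eqP].
  exact/closed_openC/closed_eq.
elim=> [|k IH]; first by move=> x /= x0; exact: inv_continuous.
apply: (CkS_is_derive oU (g := fun x => - (x^-1 * x^-1))).
  by move=> x /= x0; exact: is_derive_inv.
apply: Ck_eq oU _ (CkZ oU (Ck_cst _ k (-1 : R)) (CkZ oU IH IH)) => x _.
by rewrite scaleN1r.
Qed.

(** The whole family is needed, because the derivative of each member is a
    combination of the two following ones. *)
Definition flat (m : nat) (x : R) : R :=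
  if 0 < x then x^-1 ^+ m * expR (- x^-1) else 0.

(** From the term of order m + 1 of the exponential series of 1/x. At order m +
    1 the bound also says that the difference quotient of flat m at 0 tends to
    0. *)
Lemma flat_bound m x : `|flat m x| <= (m.+1)`!%:R * `|x|.
Proof.
rewrite /flat; case: ifPn => [x0|_]; last by rewrite normr0 mulr_ge0.
have y0 : 0 < x^-1 by rewrite invr_gt0.
rewrite (gtr0_norm x0) ger0_norm; last by rewrite mulr_ge0 ?expR_ge0 ?exprn_ge0 ?ltW.
have := expR_ge1Dxn m (ltW y0); rewrite expRN => h.
rewrite ler_pdivrMr ?expR_gt0// -(ler_pM2r y0).
rewrite -exprSr mulrAC -(mulrA _ x) mulfV ?gt_eqF// mulr1 mulrC.
rewrite -ler_pdivrMr; last by rewrite ltr0n fact_gt0.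
by apply: le_trans h; rewrite lerDr.
Qed.

Lemma flat_is_derive m (x : R) :
  is_derive x 1 (flat m) (- m%:R * flat m.+1 x + flat m.+2 x).
Proof.
have [x0|x0|->] := ltgtP x 0.
- rewrite /flat !ifN ?mulr0 ?addr0 -?leNgt ?(ltW x0)//.
  apply: (near_eq_is_derive (f := cst (0 : R))).
  apply: open_near (@open_lt R 0) x0 _ => y /= y0.
  by rewrite ifN// -leNgt ltW.
- rewrite /flat !ifT//.
  apply: (@near_eq_is_derive _ _ _ (fun x : R => x^-1 ^+ m * expR (- x^-1))).
    by apply: open_near (@open_gt R 0) x0 _ => y /= y0; rewrite ifT.
  have xn0 : x != 0 by rewrite gt_eqF.
  have di : is_derive x 1 (fun x : R => x^-1) (- (x^-1 * x^-1)).
    exact: is_derive_inv.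
  have de : is_derive x 1 (fun x : R => expR (- x^-1))
      (expR (- x^-1) * (x^-1 * x^-1)).
    apply: (@is_derive1_comp _ expR (fun x : R => - x^-1)).
    by rewrite -[X in is_derive _ _ _ X]opprK; exact: is_deriveN.
  have dX : is_derive x 1 (fun x : R => x^-1 ^+ m)
      ((m%:R * x^-1 ^+ m.-1) *: - (x^-1 * x^-1)).
    have -> : (fun x : R => x^-1 ^+ m) = (fun x : R => x^-1) ^+ m.
      by apply/funext => y; rewrite exprfctE.
    exact: is_deriveX.
  apply: is_derive_eq (is_deriveM dX de) _.
  rewrite -![_ *: _]/(_ * _); case: m {dX} => [|m] /=.
    by rewrite !exprS !expr0; ring.
  by rewrite !exprS; ring.
- rewrite {2 3}/flat ltxx mulr0 addr0.
  have lim0 : h^-1 *: (flat m (h *: 1 + 0) - flat m 0) @[h --> 0^'] --> (0 : R).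
    apply: (@cvg_to_0_linear _ _ (m.+2)`!%:R 1) => // h /andP[h0 _].
    rewrite addr0 [h *: 1]mulr1 {2}/flat ltxx subr0.
    apply: le_trans (flat_bound m.+1 h).
    rewrite /flat; case: ifPn => hp; last by rewrite scaler0 normr0.
    by rewrite [h^-1 *: _]mulrA exprS.
  apply: DeriveDef; first by apply/cvg_ex; exists 0.
  by apply: cvg_lim => //; exact: lim0.
Qed.

Lemma smooth_flat : smooth_on setT (flat 0).
Proof.
suff H k : forall m, Ck setT k (flat m) by move=> k; exact: H.
elim: k => [|k IH] m.
  move=> x _; apply: differentiable_continuous; apply/derivable1_diffP.
  by case: (flat_is_derive m x).
apply: (CkS_is_derive openT); first by move=> x _; exact: flat_is_derive.
apply: CkD; [exact: openT| |exact: IH].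
apply: (CkZ openT (Ck_cst _ k (- m%:R : R))); exact: IH.
Qed.

Lemma flat_gt0 x : (0 < flat 0 x) = (0 < x).
Proof.
rewrite /flat; case: ifPn => [x0|_]; last by rewrite ltxx.
by rewrite expr0 mul1r expR_gt0.
Qed.

Lemma flat_ge0 x : 0 <= flat 0 x.
Proof. by rewrite /flat; case: ifPn => // _; rewrite expr0 mul1r expR_ge0. Qed.

Definition smoothstep (x : R) : R := flat 0 x / (flat 0 x + flat 0 (1 - x)).

Lemma smoothstep0 x : x <= 0 -> smoothstep x = 0.
Proof. by move=> x0; rewrite /smoothstep {1}/flat ifN ?mul0r// -leNgt. Qed.

Lemma smoothstep1 x : 1 <= x -> smoothstep x = 1.
Proof.
move=> x1; have x0 : 0 < x by rewrite (lt_le_trans _ x1).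
rewrite /smoothstep [flat 0 (1 - x)]/flat ifN ?addr0.
  by rewrite mulfV// gt_eqF// flat_gt0.
by rewrite -leNgt subr_le0.
Qed.

Lemma smooth_smoothstep : smooth_on setT smoothstep.
Proof.
have s1 : smooth_on setT (fun x : R => flat 0 (1 - x)).
  apply: (smooth_comp openT (B := setT) (f := fun x : R => 1 - x) (g := flat 0)) => //.
    apply: (smoothD openT); first exact: smooth_cst.
    by apply: (smoothN openT); exact: smooth_id.
  exact: smooth_flat.
apply: (smoothM openT smooth_flat).
apply: (smooth_comp openT (B := [set x : R | x != 0])
  (f := fun x => flat 0 x + flat 0 (1 - x)) (g := fun x => x^-1)) => //.
- move=> x _ /=; have [x0|x0] := ltP 0 x.
    by rewrite gt_eqF// ltr_pwDl ?flat_gt0 ?flat_ge0.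
  rewrite gt_eqF// ltr_wpDl ?flat_ge0// flat_gt0 subr_gt0.
  exact: le_lt_trans x0 ltr01.
- by apply: (smoothD openT) => //; exact: smooth_flat.
- exact: smooth_inv.
Qed.

End OneVariable.

(** * Smooth maps read in charts *)

Section Charts.
Context {R : realType}.

Lemma in_chartE (V W : normedModType R) (T : Type) (c : chart V T) (f : T -> W) p :
  {in dom c &, injective (coord c)} -> dom c p ->
  in_chart c f (coord c p) = f p.
Proof.
move=> ci cp; rewrite /in_chart.
have /xgetPex : (f @` [set q | dom c q /\ coord c q = coord c p]) !=set0.
  by exists (f p), p.
move=> /(_ 0)[q [cq qp] <-].
by rewrite (ci q p) ?inE.
Qed.

(** What calculus in charts requires. Smoothness of the identity is the
    smoothness of all changes of charts, and makes their domains open. *)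
Record regular_atlas (N : atlased R) : Prop := RegularAtlas {
  atlas_cover : forall p : N, exists2 c, charts N c & dom c p;
  atlas_inj : forall c, charts N c -> {in dom c &, injective (coord c)};
  atlas_id : smooth_map (@id N);
  atlas_findim : findim (model N) }.

(** Smoothness at a point, in a form that does not name the domain; composites
    then need no bookkeeping of preimages. *)
Definition smooth_near (V W : normedModType R) (f : V -> W) (v : V) :=
  exists A, [/\ open A, A v & smooth_on A f].

Lemma smooth_near_comp (U V W : normedModType R) (f : U -> V) (g : V -> W) u :
  findim V -> smooth_near f u -> smooth_near g (f u) -> smooth_near (g \o f) u.
Proof.
move=> fV [A [oA Au sA]] [B [oB Bf sB]].
have oC : open (A `&` f @^-1` B).
  by apply: open_preimage_within => // x Ax; exact: smooth_continuous sA Ax.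
exists (A `&` f @^-1` B); split => //.
by apply: (smooth_comp oC (B := B)) => //; [move=> x []|apply: smooth_subset sA => x []].
Qed.

Lemma smooth_near_eq (V W : normedModType R) (f g : V -> W) v :
  (\forall x \near v, f x = g x) -> smooth_near f v -> smooth_near g v.
Proof.
move=> N; have := N : nbhs v [set x | f x = g x].
rewrite nbhsE => -[B [oB Bv] fg] [A [oA Av sA]].
exists (A `&` B); split => //; first exact: openI.
apply: (smooth_eq (f := f)); first exact: openI.
- by move=> x [_ Bx]; exact: fg.
- by apply: smooth_subset sA => x [].
Qed.

(** The pointwise content of smoothness in a given pair of charts. *)
Definition smooth_in (V W : normedModType R) (S T : Type) (c : chart V S)
    (d : chart W T) (f : S -> T) (p : S) :=
  nbhs (coord c p) (chart_image c (f @^-1` dom d)) /\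
  smooth_near (in_chart c (coord d \o f)) (coord c p).

Lemma smooth_mapP (S T : atlased R) (f : S -> T) :
  smooth_map f <-> forall c d, charts S c -> charts T d ->
    forall p, dom c p -> dom d (f p) -> smooth_in c d f p.
Proof.
split=> [sf c d cc dd p cp dp|H c d cc dd /=].
  have [oU sU] := sf c d cc dd.
  have Up : chart_image c (f @^-1` dom d) (coord c p) by exists p.
  split; first exact: open_nbhs_nbhs.
  by exists (chart_image c (f @^-1` dom d)).
split.
  rewrite openE => _ [p [cp dp] <-].
  by have [] := H c d cc dd p cp dp.
apply: smooth_local => _ [p [cp dp] <-].
have [_ [A [oA Ap sA]]] := H c d cc dd p cp dp.
by exists A.
Qed.

Lemma smooth_in_comp (V W X : normedModType R) (S T U : Type) (c : chart V S)
    (d : chart W T) (e : chart X U) (f : S -> T) (g : T -> U) p :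
  findim W ->
  {in dom c &, injective (coord c)} -> {in dom d &, injective (coord d)} ->
  dom c p -> dom d (f p) ->
  smooth_in c d f p -> smooth_in d e g (f p) -> smooth_in c e (g \o f) p.
Proof.
move=> fW ci di cp dp [nf sf] [ng sg].
have Fp : in_chart c (coord d \o f) (coord c p) = coord d (f p) by rewrite in_chartE.
have cf : {for coord c p, continuous (in_chart c (coord d \o f))}.
  by case: sf => A [oA Ap sA]; exact: smooth_continuous sA Ap.
have ng' : \forall w \near coord c p,
    chart_image d (g @^-1` dom e) (in_chart c (coord d \o f) w).
  by apply: cf; rewrite Fp.
split.
  apply: filterS2 nf ng' => _ [q [cq dq] <-].
  rewrite in_chartE// => -[r [dr er] /di rE].
  by exists q => //; split => //=; rewrite /= -rE ?inE.
rewrite -Fp in sg; apply: smooth_near_eq (smooth_near_comp fW sf sg).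
apply: filterS nf => _ [q [cq dq] <-] /=.
by rewrite [in_chart c _ _]in_chartE// !in_chartE.
Qed.

Lemma smooth_map_comp (S T U : atlased R) (f : S -> T) (g : T -> U) :
  regular_atlas S -> regular_atlas T ->
  smooth_map f -> smooth_map g -> smooth_map (g \o f).
Proof.
move=> rS rT /smooth_mapP sf /smooth_mapP sg; apply/smooth_mapP => c e cc ee p cp ep.
have [d dd dp] := atlas_cover rT (f p).
apply: (smooth_in_comp (d := d)) => //.
- exact: atlas_findim.
- exact: atlas_inj.
- exact: atlas_inj.
- exact: sf.
- exact: sg.
Qed.

(** Smoothness at each point needs testing in one pair of charts only: the
    changes of charts, being smooth, give all other pairs. *)
Lemma smooth_map_local (S T : atlased R) (f : S -> T) :
  regular_atlas S -> regular_atlas T ->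
  (forall p, exists c d, [/\ charts S c, charts T d, dom c p, dom d (f p) &
     smooth_in c d f p]) -> smooth_map f.
Proof.
move=> rS rT H; apply/smooth_mapP => c' d' cc' dd' p cp' dp'.
have [c [d [cc dd cp dp sf]]] := H p.
have ci := atlas_inj rS cc; have ci' := atlas_inj rS cc'; have di := atlas_inj rT dd.
have /smooth_mapP/(_ c' c cc' cc p cp' cp) s1 := atlas_id rS.
have /smooth_mapP/(_ d d' dd dd' (f p) dp dp') s2 := atlas_id rT.
have s3 := smooth_in_comp (atlas_findim rT) ci di cp dp sf s2.
exact: (smooth_in_comp (atlas_findim rS) ci' ci cp' cp s1 s3).
Qed.

Lemma chart_imageT (V : normedModType R) (T : Type) (c : chart V T) (A : set T) p :
  {in dom c &, injective (coord c)} -> dom c p ->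
  chart_image c A (coord c p) <-> A p.
Proof.
move=> ci cp; split; last by exists p.
by move=> [q [cq Aq] /ci qp]; rewrite -qp ?inE.
Qed.

Lemma open_chart (N : atlased R) c : regular_atlas N -> charts N c ->
  open (chart_image c setT).
Proof.
move=> rN cc; have [+ _] := atlas_id rN cc cc.
congr open; apply/seteqP; split => _ [p [cp ?] <-]; exists p => //.
Qed.

End Charts.

Section RealLine.
Context {R : realType}.

Definition id_chart : chart R R := Chart setT id.

Lemma in_id_chart (W : normedModType R) (f : R -> W) : in_chart id_chart f = f.
Proof. by apply/funext => t; rewrite -[in LHS](erefl : coord id_chart t = t) in_chartE. Qed.

Lemma regular_real_line : regular_atlas (real_line R).
Proof.
split.
- by move=> t; exists id_chart.
- by move=> c -> x y.
- move=> c d -> -> /=; rewrite in_id_chart /=.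
  split; last exact: smooth_id.
  rewrite (_ : chart_image _ _ = setT); first exact: openT.
  by apply/seteqP; split => // x _; exists x.
- exact: findimR.
Qed.

Context (N : atlased R).

Lemma smooth_funP (h : N -> R) : regular_atlas N ->
  smooth_fun h <->
  forall c, charts N c -> smooth_on (chart_image c setT) (in_chart c h).
Proof.
move=> rN; split=> [sh c cc|H c d cc -> /=]; first by have [] := sh c id_chart cc erefl.
split; first exact: open_chart.
exact: H.
Qed.

Lemma smooth_curveP (g : R -> N) :
  smooth_curve g <->
  forall d, charts N d -> open (g @^-1` dom d) /\
    smooth_on (g @^-1` dom d) (coord d \o g).
Proof.
have E (A : set R) : chart_image id_chart A = A.
  by apply/seteqP; split=> [_ [x [_ Ax] <-]//|x Ax]; exists x.
split=> [sg d dd|H c d -> dd].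
  by have := sg id_chart d erefl dd; rewrite in_id_chart E.
by rewrite in_id_chart E; exact: H.
Qed.

End RealLine.

(** * The atlases of M and of R x M *)

Section ManifoldAtlas.
Context {R : realType} {n : nat} (M : manifold R n).

Lemma mchart_homeo c : mcharts M c -> homeo_chart c.
Proof. by case: M c => T C H1 H2 Hh Hc Ht Hm c; exact: Hh. Qed.

Lemma mchart_inj c : mcharts M c -> {in dom c &, injective (coord c)}.
Proof. by move=> /mchart_homeo[]. Qed.

Lemma mchart_compatible c d : mcharts M c -> mcharts M d -> compatible c d.
Proof. by case: M c d => T C H1 H2 Hh Hc Ht Hm c d; exact: Ht. Qed.

Lemma regular_manifold : regular_atlas M.
Proof.
split.
- by case: M => T C H1 H2 Hh Hc Ht Hm p; exact: Hc.
- exact: mchart_inj.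
- move=> c d cc dd /=; split.
    by have [_ _ _] := mchart_homeo cc; apply; have [] := mchart_homeo dd.
  by have [] := mchart_compatible cc dd.
- exact: findim_mx.
Qed.

Definition evol_chart (c : chart 'rV[R]_n (mspace M)) :
    chart (R * 'rV[R]_n)%type (R * mspace M)%type :=
  Chart (fun z => dom c z.2) (fun z => (z.1, coord c z.2)).

Lemma evol_charts c : mcharts M c -> charts (evolution M) (evol_chart c).
Proof. by move=> cc; exists c. Qed.

Lemma evol_chart_inj c : mcharts M c ->
  {in dom (evol_chart c) &, injective (coord (evol_chart c))}.
Proof.
move=> cc [t x] [s y]; rewrite !inE /= => cx cy [-> /(mchart_inj cc)->//]; by rewrite inE.
Qed.

Lemma evol_image c (A : set M) :
  chart_image (evol_chart c) (snd @^-1` A) = snd @^-1` (chart_image c A).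
Proof.
apply/seteqP; split => [_ [[t x] [/= cx Ax] <-]|[t v] [x [cx Ax] /= xv]].
  by exists x.
by exists (t, x); rewrite //= xv.
Qed.

Lemma regular_evolution : regular_atlas (evolution M).
Proof.
have rM := regular_manifold.
split.
- move=> [t x]; have [c cc cx] := atlas_cover rM x.
  by exists (evol_chart c); first exact: evol_charts.
- by move=> _ [c cc <-]; exact: evol_chart_inj.
- move=> _ _ [c cc <-] [d dd <-] /=.
  have [oU sU] := atlas_id rM cc dd.
  rewrite -[chart_image _ _]/(chart_image (evol_chart c) (snd @^-1` dom d)) evol_image.
  have oV : open (snd @^-1` (chart_image c (dom d)) : set (R * 'rV[R]_n)%type).
    by apply: open_comp => // x _; exact: snd_continuous.
  split => //.
  apply: (smooth_eq (f := fun w => (w.1, in_chart c (coord d) w.2))) => //.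
    move=> [t v] [x [cx dx] /= <-]; rewrite in_chartE//; last exact: mchart_inj.
    exact/esym/(in_chartE _ (evol_chart_inj cc) (p := (t, x))).
  apply: (smooth_pair oV); first exact: smooth_fst.
  by apply: (smooth_comp oV (B := chart_image c (dom d)) (f := snd)) => //; exact: smooth_snd.
- exact: findim_prod.
Qed.

(** The projection on M, used as the vertical map of the identity. Its
    prolongation is the identity of the jets, so that statements on prolonged
    maps specialize to changes of induced charts. *)
Lemma smooth_evol_snd : smooth_map (snd : evolution M -> M).
Proof.
move=> _ d [c cc <-] dd /=.
have [oU sU] := atlas_id regular_evolution (evol_charts cc) (evol_charts dd).
split => //.
apply: (smooth_eq (f := snd \o in_chart (evol_chart c) (coord (evol_chart d)))) => //.
  by move=> _ [x [cx dx] <-] /=; rewrite !in_chartE//; exact: evol_chart_inj.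
apply: (@smooth_linear_comp _ _ _ oU _ _ _ (snd : {linear (R * 'rV[R]_n)%type -> 'rV[R]_n})) => //.
exact: snd_continuous.
Qed.

Lemma smooth_evol_pair (g : R -> M) :
  @smooth_curve R M g -> @smooth_curve R (evolution M) (fun s => (s, g s)).
Proof.
move=> /smooth_curveP sg; apply/smooth_curveP => _ [d dd <-].
have [oU sU] := sg d dd; split => //=.
by apply: (smooth_pair oU) => //; exact: smooth_id.
Qed.

Lemma smooth_evol_curve (phi : evolution M -> M) (g : R -> M) :
  smooth_map phi -> @smooth_curve R M g ->
  @smooth_curve R M (fun s => phi (s, g s)).
Proof.
move=> sphi sg.
have sp := smooth_evol_pair sg.
exact (smooth_map_comp (@regular_real_line R) regular_evolution sp sphi).
Qed.

End ManifoldAtlas.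

Section ChartCurves.
Context {R : realType} (N : atlased R).

Definition chart_inv (c : chart (model N) N) (p : N) (v : model N) : N :=
  xget p [set q | dom c q /\ coord c q = v].

Lemma chart_invE c p v : chart_image c setT v ->
  dom c (chart_inv c p v) /\ coord c (chart_inv c p v) = v.
Proof. by move=> [q [cq _] qv]; apply: (@xgetPex _ p [set q | dom c q /\ coord c q = v]); exists q. Qed.

(** A curve in the image of a chart defines a curve in the manifold; the point p
    is a default value for coordinates out of the image. *)
Lemma chart_curve c p (u : R -> model N) : regular_atlas N -> charts N c ->
  smooth_on setT u -> (forall s, chart_image c setT (u s)) ->
  smooth_curve (chart_inv c p \o u).
Proof.
move=> rN cc su cu; apply: smooth_map_local => //; first exact: regular_real_line.
move=> s; have [ds us] := chart_invE p (cu s).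
exists (id_chart), c; split => //; split.
  apply: filterS filterT => t _ /=; exists t => //; split => //.
  by have [] := chart_invE p (cu t).
exists setT; split => //; first exact: openT.
rewrite in_id_chart; apply: smooth_eq openT _ su => t _ /=.
by have [] := chart_invE p (cu t).
Qed.

End ChartCurves.

(** * Prolongation in coordinates *)

Section Prolongation.
Context {R : realType}.

Section Der.
Context {V W : normedModType R} {fV : findim V}.

(** The k-th total derivative of F along a curve with derivatives x 0, x 1, x 2.
    The second one differentiates the total differential (z, y) |-> D_y F(z) in
    the direction (1, x 1) for z and (0, x 2) for y, the velocity of (1, x 1). *)
Definition der (k : nat) (F : R * V -> W) (t : R) (x : nat -> V) : W :=
  match k with
  | 0 => F (t, x 0%N)
  | 1 => 'D_((1 : R, x 1%N)) F (t, x 0%N)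
  | _ => 'D_((1 : R, x 1%N), (0 : R, x 2%N))
           (fun z => 'D_(z.2) F z.1) ((t, x 0%N), (1 : R, x 1%N))
  end.

Lemma der_ext k F t x y : (k <= 2)%N -> (forall l, (l <= k)%N -> x l = y l) ->
  der k F t x = der k F t y.
Proof.
case: k => [|[|[|k]]] k2 xy; last discriminate k2.
- by rewrite /der xy.
- have [x0 x1] : x 0%N = y 0%N /\ x 1%N = y 1%N by split; exact: xy.
  rewrite /der x0 x1; reflexivity.
- have [x0 x1 x2] : [/\ x 0%N = y 0%N, x 1%N = y 1%N & x 2%N = y 2%N].
    by split; exact: xy.
  rewrite /der x0 x1 x2; reflexivity.
Qed.

Lemma derive1_smooth (A : set R) (u : R -> V) : smooth_on A u -> smooth_on A u^`()%classic.
Proof.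
rewrite (_ : u^`()%classic = 'D_(1 : R) u); first exact: smooth_derive.
by apply/funext => s; rewrite derive1E.
Qed.

Lemma derive1_along (A : set R) (B : set (R * V)%type) (u : R -> V)
    (F : R * V -> W) s :
  A s -> B (s, u s) -> smooth_on A u -> smooth_on B F ->
  (fun s => F (s, u s))^`()%classic s = 'D_((1 : R, u^`()%classic s)) F (s, u s).
Proof.
move=> As Bs sA sB.
have du := smooth_differentiable sA As.
have di : differentiable (@id R) s by exact: smooth_differentiable (smooth_id setT) _.
have dp := differentiable_pair di du.
rewrite derive1E -[LHS]/('D_(1 : R) (F \o (fun s => (s, u s))) s).
rewrite (derive_comp _ dp (smooth_differentiable sB Bs)).
by rewrite (derive_pair _ di du) derive_id -derive1E.
Qed.

Lemma derive1n_along (u : R -> V) (F : R * V -> W) t k :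
  (k <= 2)%N -> smooth_near u t -> smooth_near F (t, u t) ->
  derive1n k (fun s => F (s, u s)) t = der k F t (fun l => derive1n l u t).
Proof.
move=> k2 [A [oA At sA]] [B [oB Bt sB]].
case: k k2 => [|[|[|k]]] k2; last discriminate k2.
- exact: erefl.
- exact: (derive1_along At Bt sA sB).
have oC : open (A `&` (fun s => (s, u s)) @^-1` B).
  apply: open_preimage_within => // s As.
  exact: smooth_continuous (smooth_pair oA (@smooth_id _ _ A) sA) As.
set C := _ `&` _ in oC.
have D1 s : C s -> (fun s => F (s, u s))^`()%classic s =
    'D_((1 : R, u^`()%classic s)) F (s, u s).
  by move=> [As Bs]; exact: (derive1_along As Bs sA sB).
rewrite derive1nS derive1n1 derive1E.
rewrite (near_eq_derive (g := (fun z : (R * V) * (R * V) => 'D_(z.2) F z.1) \o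
  (fun s => ((s, u s), (1 : R, u^`()%classic s)))) (1 : R)); last first.
  by apply: (open_near oC) => [|s Cs]; [split|exact: D1].
have du := smooth_differentiable sA At.
have du' := smooth_differentiable (derive1_smooth sA) At.
have di : differentiable (@id R) t by exact: smooth_differentiable (smooth_id setT) _.
have dc : differentiable (fun _ : R => 1 : R) t by exact: differentiable_cst.
have dp := differentiable_pair di du.
have dp' := differentiable_pair dc du'.
have dpp := differentiable_pair dp dp'.
have sT := @smooth_derive_joint _ _ _ (findim_prod (@findimR R) fV) _ _ oB sB.
have dT := @smooth_differentiable _ _ _ _ _ ((t, u t), (1 : R, u^`()%classic t)) sT Bt.
rewrite (derive_comp _ dpp dT).
rewrite (derive_pair _ dp dp') (derive_pair _ di du) (derive_pair _ dc du').
rewrite derive_id derive_cst -!derive1E; reflexivity.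
Qed.

End Der.

Lemma row_smooth (V : normedModType R) (U : set V) m n (i : 'I_m) (f : V -> 'M[R]_(m, n)) :
  open U -> smooth_on U f -> smooth_on U (fun x => row i (f x)).
Proof.
move=> oU sf; apply: smooth_mx => // a b.
apply: (smooth_eq oU (f := fun x => f x i b)); last exact: smooth_entry.
by move=> x _; rewrite mxE.
Qed.

Section Lift.
Context {n m r : nat}.

(** The prolongation of F to r-jets, in induced coordinates. *)
Definition lift (F : R * 'rV[R]_n -> 'rV[R]_m) (w : R * 'M[R]_(r.+1, n)) :
    R * 'M[R]_(r.+1, m) :=
  (w.1, \matrix_(k < r.+1, i < m)
          der k F w.1 (fun l => row (inord l) w.2) 0 i).

Definition jet_over (U : set (R * 'rV[R]_n)) : set (R * 'M[R]_(r.+1, n))%type :=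
  [set w | U (w.1, row ord0 w.2)].

Lemma open_jet_over U : open U -> open (jet_over U).
Proof.
move=> oU; rewrite -[jet_over U]/((fun w => (w.1, row ord0 w.2)) @^-1` U).
apply: open_comp => // w _.
have sT : smooth_on setT (fun w : R * 'M[R]_(r.+1, n) => (w.1, row ord0 w.2)).
  apply: (smooth_pair openT); first exact: smooth_fst.
  by apply: (row_smooth _ openT); exact: smooth_snd.
exact: smooth_continuous sT _.
Qed.

Lemma smooth_lift U F : open U -> smooth_on U F -> smooth_on (jet_over U) (lift F).
Proof.
move=> oU sF; have oJ := open_jet_over oU.
have s1 : smooth_on (jet_over U) fst by exact: smooth_fst.
have sr l : smooth_on (jet_over U) (fun w => row (inord l) w.2).
  by apply: (row_smooth _ oJ); exact: smooth_snd.
have r0 : inord 0 = ord0 :> 'I_r.+1 by apply/val_inj; rewrite /= inordK.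
apply: (smooth_pair oJ s1); apply: (smooth_mx oJ) => k i.
suff sk : smooth_on (jet_over U) (fun w => der k F w.1 (fun l => row (inord l) w.2)).
  apply: (smooth_eq oJ (f := fun w => der k F w.1 (fun l => row (inord l) w.2) 0 i)).
    by move=> w _; rewrite mxE.
  exact: (smooth_entry oJ).
have sp : smooth_on (jet_over U) (fun w => (w.1, row (inord 0) w.2)).
  exact: (smooth_pair oJ s1 (sr 0%N)).
have sv : smooth_on (jet_over U) (fun w => (1 : R, row (inord 1) w.2)).
  by apply: (smooth_pair oJ _ (sr 1%N)); exact: smooth_cst.
have oU2 := @open_fst_preimage _ _ (R * 'rV[R]_n)%type _ oU.
have sT := @smooth_derive_joint _ _ _ (findim_prod (@findimR R) (@findim_mx R 1 n)) _ _ oU sF.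
case: (nat_of_ord k) => [|[|q]] /=.
- by apply: (smooth_comp oJ (B := U) (g := F)) => // w; rewrite r0.
- apply: (smooth_comp oJ (B := [set z : (R * 'rV[R]_n) * (R * 'rV[R]_n) | U z.1])
    (f := fun w => ((w.1, row (inord 0) w.2), (1 : R, row (inord 1) w.2)))
    (g := fun z => 'D_(z.2) F z.1)) => //.
    by move=> w; rewrite /= r0.
  exact: (smooth_pair oJ).
- have fE := findim_prod (@findimR R) (@findim_mx R 1 n).
  have sTT := @smooth_derive_joint _ _ _ (findim_prod fE fE) _ _ oU2 sT.
  apply: (smooth_comp oJ (B := [set z | U z.1.1])
   (f := fun w => (((w.1, row (inord 0) w.2), (1 : R, row (inord 1) w.2)),
      ((1 : R, row (inord 1) w.2), (0 : R, row (inord 2) w.2))))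
   (g := fun z => 'D_(z.2) (fun z => 'D_(z.2) F z.1) z.1)) => //.
    by move=> w; rewrite /= r0.
  apply: (smooth_pair oJ); apply: (smooth_pair oJ) => //.
  by apply: (smooth_pair oJ _ (sr 2%N)); exact: smooth_cst.
Qed.

End Lift.

Lemma is_derive_scale_cst (V : normedModType R) (f : R -> R) (s df : R) (y : V) :
  is_derive s 1 f df -> is_derive s 1 (fun s => f s *: y) (df *: y).
Proof.
move=> [d <-]; have /derivable1_diffP df' := d.
have dc : differentiable (fun _ : R => y) s by exact: differentiable_cst.
have [dd _] := is_diff_scale df' dc.
apply: DeriveDef; first exact: diff_derivable.
by rewrite (derive_scale _ df' dc) derive_cst scaler0 addr0.
Qed.

(** A polynomial with the prescribed derivatives would leave U. With the
    variable w = (s - t)/e, the curve x + e sin(w) v + e^2 (1 - cos(w)) a has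
    the prescribed derivatives at t, and for small e it stays in a small ball
    around x for all times. *)
Lemma bounded_curve (V : normedModType R) (U : set V) (t : R) (x v a : V) :
  open U -> U x -> exists u : R -> V,
  [/\ smooth_on setT u, forall s, U (u s), u t = x, u^`()%classic t = v &
      u^`()%classic^`()%classic t = a].
Proof.
move=> oU Ux.
have /nbhs_ballP[d d0 dU] := open_nbhs_nbhs (conj oU Ux).
(* For e <= 1 the curve stays at distance at most e (|v| + 2 |a|) < e b from
   x; e b <= d keeps it in the ball of radius d. *)
pose b := `|v| + 2 * `|a| + 1.
have b0 : 0 < b by rewrite ltr_wpDl// addr_ge0// mulr_ge0.
pose e := Num.min 1 (d / b).
have e0 : 0 < e by rewrite lt_min ltr01 divr_gt0.
have e1 : e <= 1 by rewrite ge_min lexx.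
have en0 : e != 0 by rewrite gt_eqF.
pose w s := (s - t) / e.
pose u s := x + (e * sin (w s)) *: v + (e * (e * (1 - cos (w s)))) *: a.
pose u1 s := cos (w s) *: v + (e * sin (w s)) *: a.
pose u2 s := (- (e^-1 * sin (w s))) *: v + cos (w s) *: a.
have dw (s : R) : is_derive s 1 w e^-1.
  have -> : w = (fun s => e^-1 *: (s + - t)) by apply/funext => y; rewrite /w mulrC.
  apply: is_derive_eq (is_deriveZ e^-1 (is_deriveD (is_derive_id s (1 : R)) (is_derive_cst (- t) s (1 : R)))) _.
  by rewrite addr0 -[LHS]/(_ * _) mulr1.
have dsin (s : R) : is_derive s 1 (fun s => sin (w s)) (cos (w s) * e^-1).
  exact: (@is_derive1_comp _ sin w).
have dcos (s : R) : is_derive s 1 (fun s => cos (w s)) (- sin (w s) * e^-1).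
  exact: (@is_derive1_comp _ cos w).
have [ss sc] := @smooth_sin_cos R setT openT.
have sw : smooth_on setT w.
  apply: (smoothM openT); last exact: smooth_cst.
  by apply: (smoothD openT); [exact: smooth_id|exact: smooth_cst].
have ssw : smooth_on setT (fun s => sin (w s)).
  exact: (smooth_comp openT (B := setT) (f := w) (g := sin)).
have scw : smooth_on setT (fun s => cos (w s)).
  exact: (smooth_comp openT (B := setT) (f := w) (g := cos)).
have du (s : R) : is_derive s 1 u (u1 s).
  have d1 : is_derive s 1 (fun s => (e * sin (w s)) *: v) (cos (w s) *: v).
    apply: is_derive_scale_cst; apply: is_derive_eq (is_deriveZ e (dsin s)) _.
    by rewrite -[LHS]/(_ * _) mulrCA mulfV// mulr1.
  have d2 : is_derive s 1 (fun s => (e * (e * (1 - cos (w s)))) *: a)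
      ((e * sin (w s)) *: a).
    apply: is_derive_scale_cst.
    apply: is_derive_eq (is_deriveZ e (is_deriveZ e (is_deriveB
       (is_derive_cst (1 : R) s (1 : R)) (dcos s)))) _.
    rewrite -[LHS]/(e * (e * (0 - - sin (w s) * e^-1))) sub0r mulNr opprK.
    by rewrite [e * (sin _ / e)]mulrCA mulfV// mulr1.
  apply: is_derive_eq (is_deriveD (is_deriveD (is_derive_cst x s (1 : R)) d1) d2) _.
  by rewrite add0r.
have du1 (s : R) : is_derive s 1 u1 (u2 s).
  have d1 : is_derive s 1 (fun s => cos (w s) *: v) (- (e^-1 * sin (w s)) *: v).
    apply: is_derive_scale_cst; apply: is_derive_eq (dcos s) _.
    by rewrite mulNr mulrC.
  have d2 : is_derive s 1 (fun s => (e * sin (w s)) *: a) (cos (w s) *: a).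
    apply: is_derive_scale_cst; apply: is_derive_eq (is_deriveZ e (dsin s)) _.
    by rewrite -[LHS]/(_ * _) mulrCA mulfV// mulr1.
  exact: is_derive_eq (is_deriveD d1 d2) _.
have wt : w t = 0 by rewrite /w subrr mul0r.
have u'E : u^`()%classic = u1.
  by apply/funext => s; rewrite derive1E; case: (du s).
exists u; split.
- apply: (smoothD openT); first apply: (smoothD openT).
  + exact: smooth_cst.
  + apply: (smoothZ openT); last exact: smooth_cst.
    by apply: (smoothM openT) => //; exact: smooth_cst.
  + apply: (smoothZ openT); last exact: smooth_cst.
    do 2!(apply: (smoothM openT); first exact: smooth_cst).
    apply: (smoothD openT); first exact: smooth_cst.
    exact: (smoothN openT).
- move=> s; apply: dU; rewrite -ball_normE /ball_ /= /u -addrA opprD addNKr normrN.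
  have bd : e * b <= d by rewrite -ler_pdivlMr// ge_min lexx orbT.
  apply: lt_le_trans bd; apply: le_lt_trans (ler_normD _ _) _.
  have h1 : `|(e * sin (w s)) *: v| <= e * `|v|.
    rewrite normrZ normrM (gtr0_norm e0) ler_wpM2r// ger_pMr//.
    by rewrite ler_norml sin_geN1 sin_le1.
  have h2 : `|(e * (e * (1 - cos (w s)))) *: a| <= e * (2 * `|a|).
    rewrite normrZ 2!normrM (gtr0_norm e0) -!mulrA ler_wpM2l ?(ltW e0)//.
    rewrite mulrA ler_wpM2r//.
    apply: le_trans (_ : 1 * 2 <= 2); last by rewrite mul1r.
    apply: ler_pM => //; first exact: ltW.
    apply: le_trans (ler_normB _ _) _; rewrite normr1 -[2]/(1 + 1) lerD2l.
    by rewrite ler_norml cos_geN1 cos_le1.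
  apply: le_lt_trans (lerD h1 h2) _.
  by rewrite -mulrDr ltr_pM2l// ltrDl.
- by rewrite /u wt sin0 cos0 mulr0 subrr !mulr0 !scale0r !addr0.
- by rewrite u'E /u1 wt sin0 cos0 mulr0 scale0r addr0 scale1r.
- rewrite u'E derive1E; have [_ ->] := du1 t.
  by rewrite /u2 wt sin0 cos0 mulr0 oppr0 scale0r add0r scale1r.
Qed.

End Prolongation.

(** * The atlases of the jet manifolds *)

Lemma derive1n_near (R : realType) (V : normedModType R) (f g : R -> V) t k :
  (\forall s \near t, f s = g s) -> derive1n k f t = derive1n k g t.
Proof.
move=> fg; suff H : \forall s \near t, derive1n k f s = derive1n k g s.
  exact: nbhs_singleton H.
elim: k => [|k IH]; first exact: fg.
apply: filterS (near_join IH) => s Hs.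
by rewrite !derive1nS !derive1E; exact: near_eq_derive.
Qed.

Section JetAtlas.
Context {R : realType} {n : nat} {M : manifold R n}.
Implicit Types (c d : chart 'rV[R]_n (mspace M)) (g : @curves R n M) (t : R) (phi psi : evolution M -> M).

Lemma curve_smooth g : @smooth_curve R M (\val g).
Proof. by have := valP g; rewrite inE. Qed.

Lemma curve_coord_near c g t : mcharts M c -> dom c (\val g t) ->
  smooth_near (coord c \o \val g) t /\ \forall s \near t, dom c (\val g s).
Proof.
move=> cc ct; have /smooth_curveP/(_ c cc)[oU sU] := curve_smooth g.
split; first by exists (\val g @^-1` dom c).
exact: (open_near oU).
Qed.

Section Order.
Context {r : nat}.

Lemma mk_jetP t g t' g' :
  mk_jet r t g = mk_jet r t' g' <-> same_jet r (t, g) (t', g').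
Proof. by split=> [/eqquotP|h]; [|apply/eqquotP]. Qed.

Lemma mk_jetK (j : jet M r) : mk_jet r (jet_time j) (jet_curve j) = j.
Proof.
rewrite -[RHS]reprK /mk_jet /jet_time /jet_curve; congr (\pi_(jet M r)%qT _).
by case: (repr j).
Qed.

Lemma repr_jet t g : same_jet r (repr (mk_jet r t g)) (t, g).
Proof. by apply/(eqmodP (same_jet_equiv M r)); rewrite /mk_jet reprK. Qed.

Lemma jet_time_mk t g : jet_time (mk_jet r t g) = t.
Proof. by have /asboolP[] := repr_jet t g. Qed.

Lemma jet_base_mk t g : jet_base (mk_jet r t g) = \val g t.
Proof. by have /asboolP[] := repr_jet t g. Qed.

Lemma jet_coord_mk c t g : mcharts M c -> dom c (\val g t) ->
  coord (jet_chart r c) (mk_jet r t g) =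
  (t, \matrix_(k < r.+1, i < n) derive1n k (coord c \o \val g) t 0 i).
Proof.
move=> cc ct; rewrite /jet_chart /= jet_time_mk; congr (_, _).
have /asboolP[/= tE pE dE] := repr_jet t g.
apply/matrixP => k i; rewrite !mxE -[in RHS]dE//.
- by rewrite tE.
- by rewrite pE.
- by rewrite -ltnS.
Qed.

Lemma jet_row_mk c t g (l : nat) : mcharts M c -> dom c (\val g t) -> (l <= r)%N ->
  row (inord l) (coord (jet_chart r c) (mk_jet r t g)).2 =
  derive1n l (coord c \o \val g) t.
Proof.
move=> cc ct lr; rewrite jet_coord_mk//=; apply/rowP => i.
by rewrite !mxE inordK.
Qed.

Lemma inord0 : inord 0 = ord0 :> 'I_r.+1.
Proof. by apply/val_inj; rewrite /= inordK. Qed.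

Lemma jet_row0 c (j : jet M r) : mcharts M c -> dom c (jet_base j) ->
  row ord0 (coord (jet_chart r c) j).2 = coord c (jet_base j).
Proof.
move=> cc; rewrite -(mk_jetK j); move: (jet_time j) (jet_curve j) => t g.
by rewrite jet_base_mk => ct; rewrite -inord0 jet_row_mk.
Qed.

Definition expr c d (phi : evolution M -> M) : R * 'rV[R]_n -> 'rV[R]_n :=
  in_chart (evol_chart c) (coord d \o phi).

Lemma exprE c d phi t x : mcharts M c -> dom c x ->
  expr c d phi (t, coord c x) = coord d (phi (t, x)).
Proof. by move=> cc cx; exact: (in_chartE _ (evol_chart_inj cc) (p := (t, x))). Qed.

Lemma expr_smooth c d phi : smooth_map phi -> mcharts M c -> mcharts M d ->
  open (chart_image (evol_chart c) (phi @^-1` dom d)) /\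
  smooth_on (chart_image (evol_chart c) (phi @^-1` dom d)) (expr c d phi).
Proof. by move=> sphi cc dd; exact: (sphi _ _ (evol_charts cc) dd). Qed.

(** The chain rule up to order 2: along the image curve, the derivatives of the
    coordinates are total derivatives of the coordinate expression of phi. *)
Lemma jet_coord_lift c d phi t g g' : (r <= 2)%N -> smooth_map phi ->
  mcharts M c -> mcharts M d -> (forall s, \val g' s = phi (s, \val g s)) ->
  dom c (\val g t) -> dom d (\val g' t) ->
  coord (jet_chart r d) (mk_jet r t g') =
  lift (expr c d phi) (coord (jet_chart r c) (mk_jet r t g)).
Proof.
move=> r2 sphi cc dd g'E ct dt; have [oU sU] := expr_smooth sphi cc dd.
have [sg ng] := curve_coord_near cc ct.
rewrite jet_coord_mk// /lift; congr (_, _); first by rewrite jet_coord_mk.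
apply/matrixP => k i; rewrite !mxE.
have kr : (k <= r)%N by rewrite -ltnS.
congr (fun_of_matrix _ 0 i).
rewrite [in RHS](_ : (coord _ _).1 = t); last by rewrite jet_coord_mk.
rewrite (@der_ext _ _ _ _ _ _ _ (fun l => derive1n l (coord c \o \val g) t)); first last.
- by move=> l lk; rewrite jet_row_mk// (leq_trans lk).
- exact: leq_trans kr r2.
rewrite -derive1n_along//; first last.
- exists (chart_image (evol_chart c) (phi @^-1` dom d)); split => //.
  by exists (t, \val g t) => //; split => //=; rewrite -g'E.
- exact: leq_trans kr r2.
apply: derive1n_near; apply: filterS ng => s cs.
by rewrite exprE//= g'E.
Qed.

(** Jets are defined by the agreement of derivatives in all charts. One chart is
    enough: in another chart d, the derivatives are the lift of those in c by
    the change of charts. *)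
Lemma mk_jet_eq c t g g' : (r <= 2)%N -> mcharts M c ->
  dom c (\val g t) -> dom c (\val g' t) ->
  coord (jet_chart r c) (mk_jet r t g) = coord (jet_chart r c) (mk_jet r t g') ->
  mk_jet r t g = mk_jet r t g'.
Proof.
move=> r2 cc ct ct' E.
have gt : \val g t = \val g' t.
  apply: (mchart_inj cc); rewrite ?inE//.
  have := congr1 (fun w : R * 'M[R]_(r.+1, n) => row (inord 0) w.2) E.
  by rewrite !jet_row_mk.
apply/mk_jetP/asboolP; split => //= d dd dt k kr.
have dt' : dom d (\val g' t) by rewrite -gt.
have sp := @smooth_evol_snd _ _ M.
rewrite -(@jet_row_mk d t g k)// -(@jet_row_mk d t g' k)//.
rewrite (jet_coord_lift r2 sp cc dd (fun _ => erefl) ct dt).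
rewrite (jet_coord_lift r2 sp cc dd (fun _ => erefl) ct' dt').
rewrite E; reflexivity.
Qed.

Lemma image_jet_eq phi t g1 g2 g1' g2' : (r <= 2)%N -> smooth_map phi ->
  (forall s, \val g1' s = phi (s, \val g1 s)) ->
  (forall s, \val g2' s = phi (s, \val g2 s)) ->
  mk_jet r t g1 = mk_jet r t g2 -> mk_jet r t g1' = mk_jet r t g2'.
Proof.
move=> r2 sphi E1 E2 E.
have gt : \val g1 t = \val g2 t by rewrite -(jet_base_mk t g1) E jet_base_mk.
have [c cc ct] := atlas_cover (regular_manifold M) (\val g1 t).
have [d dd dt] := atlas_cover (regular_manifold M) (\val g1' t).
have ct2 : dom c (\val g2 t) by rewrite -gt.
have dt2 : dom d (\val g2' t) by rewrite E2 -gt -E1.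
apply: (mk_jet_eq r2 dd dt dt2).
rewrite (jet_coord_lift r2 sphi cc dd E1 ct dt).
rewrite (jet_coord_lift r2 sphi cc dd E2 ct2 dt2) E; reflexivity.
Qed.

(** The curve given by bounded_curve, transported by the chart, has any
    prescribed derivatives. It makes the images of the induced charts open. *)
Lemma jet_exists c p (w : R * 'M[R]_(r.+1, n)) : (r <= 2)%N -> mcharts M c ->
  dom c p -> row ord0 w.2 = coord c p ->
  exists g, \val g w.1 = p /\ coord (jet_chart r c) (mk_jet r w.1 g) = w.
Proof.
case: w => t m r2 cc cp; rewrite -[(t, m).2]/m -[(t, m).1]/t => mE.
have rM := regular_manifold M.
have oI := open_chart rM cc.
have Ip : chart_image c setT (coord c p) by exists p.
have [u [su Iu u0 u1 u2]] := bounded_curve t (row (inord 1) m) (row (inord 2) m) oI Ip.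
have sg := chart_curve (p : M) rM cc su Iu.
pose g : @curves R n M := exist _ (chart_inv (c : chart (model M) M) (p : M) \o u) (mem_set sg).
have gE s : dom c (\val g s) /\ coord c (\val g s) = u s.
  exact: (chart_invE (c := c : chart (model M) M) (p : M) (Iu s)).
have gt : \val g t = p.
  have [dg cg] := gE t; apply: (mchart_inj cc); rewrite ?inE//.
  by rewrite cg u0.
exists g; split => //; rewrite jet_coord_mk ?gt//; congr (_, _).
have -> : coord c \o \val g = u by apply/funext => s; have [_ <-] := gE s.
apply/matrixP => -[k kr] i; rewrite !mxE /=.
have k2 : (k <= 2)%N by rewrite -ltnS; exact: leq_trans kr _.
have rE l (lr : (l < r.+1)%N) : inord l = Ordinal lr by apply/val_inj; rewrite /= inordK.
case: k kr k2 => [|[|[|k]]] kr k2; last discriminate k2.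
- rewrite derive1n0 u0 -mE mxE; congr (m _ i); exact/val_inj.
- by rewrite derive1n1 u1 mxE rE.
- by rewrite derive1nS derive1n1 u2 mxE rE.
Qed.

Lemma jet_chart_inj c : (r <= 2)%N -> mcharts M c ->
  {in dom (jet_chart r c) &, injective (coord (jet_chart r c))}.
Proof.
move=> r2 cc j k; rewrite !inE -(mk_jetK j) -(mk_jetK k).
move: (jet_time j) (jet_curve j) (jet_time k) (jet_curve k) => t g t' g'.
rewrite /= !jet_base_mk => ct ct' E.
have tt' : t = t' by move: E => [+ _]; rewrite !jet_time_mk.
rewrite -{t'}tt' in ct' E *.
exact: mk_jet_eq E.
Qed.

Lemma jet_chart_image c (A : set M) : (r <= 2)%N -> mcharts M c ->
  chart_image (jet_chart r c) ((@jet_base R n M r) @^-1` A) =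
  [set w | chart_image c A (row ord0 w.2)].
Proof.
move=> r2 cc; apply/seteqP; split => [_ [j [cj Aj] <-]|w [p [cp Ap] pw]].
  exists (jet_base j); first by split.
  by rewrite jet_row0.
have [g [gp gw]] := jet_exists r2 cc cp (esym pw).
by exists (mk_jet r w.1 g) => //; split => //=; rewrite jet_base_mk gp.
Qed.

(** The type of curves carries the proof of smoothness, so that the image of a
    curve under a vertical map is packaged once; prolong_mk reduces
    prolongations to it. *)
Definition image_curve phi g (sphi : smooth_map phi) : @curves R n M :=
  exist _ (fun s => phi (s, \val g s)) (mem_set (smooth_evol_curve sphi (curve_smooth g))).

Lemma prolong_mk (Phi : evolution M -> evolution M) phi (sphi : smooth_map phi) t g :
  (r <= 2)%N -> (forall t x, Phi (t, x) = (t, phi (t, x))) ->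
  prolong r Phi (mk_jet r t g) = mk_jet r t (image_curve g sphi).
Proof.
move=> r2 PE; set j := mk_jet r t g.
have E : mk_jet r t (jet_curve j) = mk_jet r t g.
  by rewrite -{1}(jet_time_mk t g) mk_jetK.
rewrite /prolong jet_time_mk -/j.
apply: (image_jet_eq (phi := phi) r2 sphi _ _ E) => // s.
rewrite val_insubd ifT ?PE //.
rewrite (_ : (fun _ => _) = \val (image_curve (jet_curve j) sphi)); first exact: valP.
by apply/funext => s'; rewrite PE.
Qed.

Lemma prolong_chart (Phi : evolution M -> evolution M) phi c d (j : jet M r) :
  (r <= 2)%N -> smooth_map phi -> (forall t x, Phi (t, x) = (t, phi (t, x))) ->
  mcharts M c -> mcharts M d ->
  dom (jet_chart r c) j -> dom (jet_chart r d) (prolong r Phi j) ->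
  coord (jet_chart r d) (prolong r Phi j) =
  lift (expr c d phi) (coord (jet_chart r c) j).
Proof.
move=> r2 sphi PE cc dd; rewrite -(mk_jetK j).
move: (jet_time j) (jet_curve j) => t g; rewrite (prolong_mk sphi t g r2 PE).
rewrite /dom /= !jet_base_mk => ct dt.
exact: jet_coord_lift.
Qed.

Lemma prolong_base (Phi : evolution M -> evolution M) phi (j : jet M r) :
  (r <= 2)%N -> smooth_map phi -> (forall t x, Phi (t, x) = (t, phi (t, x))) ->
  jet_base (prolong r Phi j) = phi (jet_time j, jet_base j) /\
  jet_time (prolong r Phi j) = jet_time j.
Proof.
move=> r2 sphi PE; rewrite -(mk_jetK j).
move: (jet_time j) (jet_curve j) => t g; rewrite (prolong_mk sphi t g r2 PE).
by rewrite !jet_base_mk !jet_time_mk.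
Qed.

(** One inclusion is jet_exists: every coordinate value over the domain of the
    expression of phi comes from a jet. In this form the domain is visibly open. *)
Lemma prolong_domain (Phi : evolution M -> evolution M) phi c d :
  (r <= 2)%N -> smooth_map phi -> (forall t x, Phi (t, x) = (t, phi (t, x))) ->
  mcharts M c -> mcharts M d ->
  chart_image (jet_chart r c)
    ((prolong r Phi : jets M r -> jets M r) @^-1` dom (jet_chart r d)) =
  jet_over (chart_image (evol_chart c) (phi @^-1` dom d)).
Proof.
move=> r2 sphi PE cc dd.
apply/seteqP; split => [_ [j [cj dj] <-]|[t m] [[t' x] [cx dx] [tt' xm]]].
  have [bE tE] := prolong_base j r2 sphi PE.
  exists (jet_time j, jet_base j); first by split => //=; rewrite -bE.
  by rewrite /= jet_row0.
have [g [gp gw]] := @jet_exists c x (t, m) r2 cc cx (esym xm).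
exists (mk_jet r t g); last exact: gw.
split; first by rewrite /= jet_base_mk gp.
have [bE tE] := prolong_base (mk_jet r t g) r2 sphi PE.
rewrite /= bE jet_time_mk jet_base_mk gp -tt'; exact: dx.
Qed.

Lemma smooth_prolong (Phi : evolution M -> evolution M) phi :
  (r <= 2)%N -> smooth_map phi -> (forall t x, Phi (t, x) = (t, phi (t, x))) ->
  smooth_map (prolong r Phi : jets M r -> jets M r).
Proof.
move=> r2 sphi PE _ _ [c cc <-] [d dd <-].
have [oU sU] := expr_smooth sphi cc dd.
have PD := prolong_domain r2 sphi PE cc dd.
split; first by rewrite PD; exact: open_jet_over.
rewrite PD; apply: (smooth_eq (open_jet_over oU)); last exact: smooth_lift oU sU.
move=> w; rewrite -PD => -[j [cj dj] <-].
rewrite in_chartE//; last exact: jet_chart_inj.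
apply: esym; exact: (prolong_chart r2 sphi PE cc dd cj).
Qed.

(** The identity of R x M is the vertical map given by the projection on M. With
    smooth_prolong it yields the smooth changes of induced charts. *)
Lemma prolong_id (j : jet M r) : (r <= 2)%N -> prolong r (@id (evolution M)) j = j.
Proof.
move=> r2; rewrite -{2}(mk_jetK j) -{1}(mk_jetK j).
move: (jet_time j) (jet_curve j) => t g.
have sp := @smooth_evol_snd _ _ M.
rewrite (@prolong_mk id snd sp)//; congr (mk_jet r t _).
exact/val_inj.
Qed.

Lemma regular_jets : (r <= 2)%N -> regular_atlas (jets M r).
Proof.
move=> r2; split.
- move=> j; have [c cc cj] := atlas_cover (regular_manifold M) (jet_base j).
  by exists (jet_chart r c) => //; exists c.
- by move=> _ [c cc <-]; exact: jet_chart_inj.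
- have := @smooth_prolong id snd r2 (@smooth_evol_snd _ _ M) (fun _ _ => erefl).
  by rewrite (_ : prolong r id = id)//; apply/funext => j; exact: prolong_id.
- exact: findim_prod.
Qed.

Lemma prolong_comp (Phi Psi : evolution M -> evolution M) phi psi (j : jet M r) :
  (r <= 2)%N -> smooth_map phi -> (forall t x, Phi (t, x) = (t, phi (t, x))) ->
  smooth_map psi -> (forall t x, Psi (t, x) = (t, psi (t, x))) ->
  cancel Phi Psi -> prolong r Psi (prolong r Phi j) = j.
Proof.
move=> r2 sphi PE spsi QE PQ; rewrite -{2}(mk_jetK j) -{1}(mk_jetK j).
move: (jet_time j) (jet_curve j) => t g.
rewrite (prolong_mk sphi t g r2 PE) (prolong_mk spsi t _ r2 QE).
congr (mk_jet r t _); apply/val_inj/funext => s /=.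
by have := PQ (s, \val g s); rewrite PE QE => -[].
Qed.

End Order.
End JetAtlas.

(** * Smooth functions and tangent vectors *)

Section SmoothFunctions.
Context {R : realType} (N : atlased R).
Hypothesis rN : regular_atlas N.

Lemma smooth_fun_chart (h : N -> R) c : charts N c -> smooth_fun h ->
  smooth_on (chart_image c setT) (in_chart c h).
Proof. by move=> cc /(smooth_funP _ rN); apply. Qed.

Lemma in_chart_diff (h : N -> R) c p : charts N c -> dom c p -> smooth_fun h ->
  differentiable (in_chart c h) (coord c p).
Proof.
move=> cc cp sh; apply: smooth_differentiable (smooth_fun_chart cc sh) _.
by exists p.
Qed.

Lemma smooth_fun_op (op : R -> R -> R) (f g : N -> R) :
  smooth_on setT (fun z : R * R => op z.1 z.2) ->
  smooth_fun f -> smooth_fun g -> smooth_fun (fun p => op (f p) (g p)).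
Proof.
move=> sop sf sg; apply/(smooth_funP _ rN) => c cc.
have oc := open_chart rN cc; have ci := atlas_inj rN cc.
have sp := smooth_pair oc (smooth_fun_chart cc sf) (smooth_fun_chart cc sg).
apply: (smooth_eq oc (f := (fun z => op z.1 z.2) \o
   (fun v => (in_chart c f v, in_chart c g v)))).
  by move=> _ [p [cp _] <-] /=; rewrite !in_chartE.
exact: (smooth_comp oc (B := setT)).
Qed.

Lemma smooth_funD (f g : N -> R) :
  smooth_fun f -> smooth_fun g -> smooth_fun (fun p => f p + g p).
Proof.
apply: smooth_fun_op; apply: (smoothD openT); [exact: smooth_fst|exact: smooth_snd].
Qed.

Lemma smooth_funM (f g : N -> R) :
  smooth_fun f -> smooth_fun g -> smooth_fun (fun p => f p * g p).
Proof.
apply: smooth_fun_op; apply: (smoothM openT); [exact: smooth_fst|exact: smooth_snd].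
Qed.

Lemma smooth_fun_cst (a : R) : smooth_fun (fun _ : N => a).
Proof.
apply/(smooth_funP _ rN) => c cc; have oc := open_chart rN cc.
apply: (smooth_eq oc (f := fun _ => a)); last exact: smooth_cst.
by move=> _ [p [cp _] <-] /=; rewrite in_chartE//; exact: atlas_inj.
Qed.

End SmoothFunctions.

Section Tangent.
Context {R : realType} (N : atlased R).
Hypothesis rN : regular_atlas N.
Implicit Types (p q : N) (h f : N -> R).

(** Like tangent vectors, it vanishes on functions that are not smooth, so that
    the two can be equal. *)
Definition chart_vector (c : chart (model N) N) p (w : model N) : (N -> R) -> R :=
  fun h => if `[< smooth_fun h >] then 'D_w (in_chart c h) (coord c p) else 0.

Lemma chart_vectorE c p w h : smooth_fun h ->
  chart_vector c p w h = 'D_w (in_chart c h) (coord c p).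
Proof. by rewrite /chart_vector => /asboolT ->. Qed.

Lemma velocity_chart c (g : R -> N) : charts N c -> smooth_curve g ->
  dom c (g 0) -> velocity g = chart_vector c (g 0) ((coord c \o g)^`()%classic 0).
Proof.
move=> cc sg cg; apply/funext => h; rewrite /velocity /chart_vector.
case: ifPn => [/asboolP sh|//].
have /smooth_curveP/(_ c cc)[oU sU] := sg.
have dg : differentiable (coord c \o g) (0 : R) by exact: smooth_differentiable sU cg.
rewrite !derive1E; apply: etrans (derive_comp (1 : R) dg (in_chart_diff rN cc cg sh)).
apply: near_eq_derive; apply: (open_near oU cg) => s cs /=.
by rewrite in_chartE//; exact: atlas_inj.
Qed.

(** The velocity of the curve which in the chart is given by bounded_curve. *)
Lemma tangent_chart_vector c p w : charts N c -> dom c p ->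
  tangent p (chart_vector c p w).
Proof.
move=> cc cp; have oc := open_chart rN cc; have ci := atlas_inj rN cc.
have Ip : chart_image c setT (coord c p) by exists p.
have [u [su Iu u0 u1 _]] := bounded_curve 0 w 0 oc Ip.
have sg := chart_curve p rN cc su Iu.
have gE s : dom c ((chart_inv c p \o u) s) /\ coord c ((chart_inv c p \o u) s) = u s.
  exact: chart_invE.
have g0 : (chart_inv c p \o u) 0 = p.
  by have [dg cg] := gE 0; apply: ci; rewrite ?inE// cg u0.
exists (chart_inv c p \o u); first by split.
rewrite (@velocity_chart c)//; last by rewrite g0.
rewrite g0; congr (chart_vector c p _); rewrite -u1; congr (_^`()%classic _).
by apply/funext => s; have [_ <-] := gE s.
Qed.

Lemma tangentE c p X : charts N c -> dom c p -> tangent p X ->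
  exists w, X = chart_vector c p w.
Proof.
move=> cc cp [g [sg g0] <-]; exists ((coord c \o g)^`()%classic 0).
by rewrite (velocity_chart cc)// g0.
Qed.

(** Vector fields are compared as operators on all functions, but only their
    values on smooth functions carry information. *)
Lemma tangent_eq p X Y : tangent p X -> tangent p Y ->
  (forall h, smooth_fun h -> X h = Y h) -> X = Y.
Proof.
move=> [g _ <-] [k _ <-] H; apply/funext => h.
have [/H//|nh] := pselect (smooth_fun h).
by rewrite /velocity !ifF//; apply/asboolP.
Qed.

Lemma tangentD p X Y : tangent p X -> tangent p Y -> tangent p (X + Y).
Proof.
have [c cc cp] := atlas_cover rN p.
move=> /(tangentE cc cp)[w ->] /(tangentE cc cp)[w' ->].
rewrite (_ : _ + _ = chart_vector c p (w + w')); first exact: tangent_chart_vector.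
apply/funext => h; rewrite -[LHS]/(chart_vector c p w h + chart_vector c p w' h).
rewrite /chart_vector; case: ifPn => [/asboolP sh|_]; last by rewrite addr0.
have dh := in_chart_diff rN cc cp sh.
by rewrite !(deriveE _ dh) linearD.
Qed.

Lemma tangentZ p (a : R) X : tangent p X -> tangent p (a *: X).
Proof.
have [c cc cp] := atlas_cover rN p.
move=> /(tangentE cc cp)[w ->].
rewrite (_ : _ *: _ = chart_vector c p (a *: w)); first exact: tangent_chart_vector.
apply/funext => h; rewrite -[LHS]/(a * chart_vector c p w h).
rewrite /chart_vector; case: ifPn => [/asboolP sh|_]; last by rewrite mulr0.
have dh := in_chart_diff rN cc cp sh.
by rewrite !(deriveE _ dh) linearZ.
Qed.

Lemma vector_fieldD (X Y : pre_field N) :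
  vector_field X -> vector_field Y -> vector_field (X + Y).
Proof.
move=> [tX sX] [tY sY]; split=> [p|h sh]; first exact: tangentD.
by apply: (smooth_funD rN); [exact: sX|exact: sY].
Qed.

Lemma vector_fieldZ f (X : pre_field N) : smooth_fun f -> vector_field X ->
  vector_field (fun p => f p *: X p).
Proof.
move=> sf [tX sX]; split=> [p|h sh]; first exact: tangentZ.
by apply: (smooth_funM rN sf); exact: sX.
Qed.

Lemma vector_field0 : vector_field (0 : pre_field N).
Proof.
split=> [p|h sh]; last exact: (smooth_fun_cst rN).
have [c cc cp] := atlas_cover rN p.
rewrite (_ : _ p = chart_vector c p 0); first exact: tangent_chart_vector.
by apply/funext => h; rewrite /chart_vector derive0; case: ifP.
Qed.

Lemma vector_field_sum (I : Type) (s : seq I) (X : I -> pre_field N) :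
  (forall i, vector_field (X i)) -> vector_field (\sum_(i <- s) X i).
Proof.
move=> vX; apply: (big_ind (fun X => vector_field X)) => //.
  exact: vector_field0.
exact: vector_fieldD.
Qed.

End Tangent.

(** * Bump functions *)

Section BumpFunction.
Context {R : realType}.

(** The function smoothstep(2 - rho / d) for the quadratic form rho given by the
    coordinates around v0. Being finite dimensional, the space has small
    sublevel sets of rho inside any neighbourhood of v0. *)
Lemma bump_function (V : normedModType R) {fV : findim V} (O : set V) (v0 : V) :
  open O -> O v0 -> exists (b : V -> R) (A K : set V),
  [/\ smooth_on setT b, open A /\ A v0, A `<=` O, closed K /\ K `<=` O &
     (forall v, A v -> b v = 1) /\ (forall v, ~ K v -> b v = 0)].
Proof.
move=> oO Ov; have [I [e [l [lc lE]]]] := fV.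
have /nbhs_ballP[r /= r0 rO] := open_nbhs_nbhs (conj oO Ov).
pose B := \sum_i `|e i| + 1.
have B0 : 0 < B by rewrite ltr_wpDl// sumr_ge0.
pose d := (r / B) ^+ 2 / 4.
have rB : 0 < r / B by exact: divr_gt0.
have d0 : 0 < d by rewrite divr_gt0// exprn_gt0.
pose rho v := \sum_i l i (v - v0) * l i (v - v0).
have srho : smooth_on setT rho.
  have sl i : smooth_on setT (fun v => l i (v - v0)).
    apply: (smooth_linear_comp (f := fun v => v - v0) openT (lc i)).
    by apply: (smoothD openT); [exact: smooth_id|exact: smooth_cst].
  apply: (smooth_sum openT) => i _; exact: (smoothM openT).
have crho : continuous rho by move=> v; exact: smooth_continuous srho _.
pose b v := smoothstep (2 - rho v / d).
exists b, [set v | rho v < d], [set v | rho v <= 2 * d].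
have KO : [set v | rho v <= 2 * d] `<=` O.
  move=> v /= rv; apply: rO; rewrite -ball_normE /ball_ /= distrC.
  have li i : `|l i (v - v0)| < r / B.
    have : l i (v - v0) * l i (v - v0) <= 2 * d.
      apply: le_trans rv; rewrite /rho (bigD1 i)//= lerDl sumr_ge0// => j _.
      by rewrite -expr2 sqr_ge0.
    rewrite -expr2 -real_normK ?num_real// => h.
    have : `|l i (v - v0)| ^+ 2 < (r / B) ^+ 2.
      apply: le_lt_trans h _; rewrite /d mulrA mulrC ltr_pdivrMl//.
      by rewrite ltr_pM2r ?exprn_gt0// ltr_nat.
    by rewrite ltr_pXn2r// ?nnegrE// ltW.
  rewrite {1}(lE (v - v0)); apply: le_lt_trans (ler_norm_sum _ _ _) _.
  apply: (@le_lt_trans _ _ (r / B * \sum_i `|e i|)).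
    rewrite mulr_sumr; apply: ler_sum => i _; rewrite normrZ ler_wpM2r//.
    exact: ltW.
  by rewrite mulrAC ltr_pdivrMr// ltr_pM2l// ltrDl.
have dE v : (rho v / d <= 1) = (rho v <= d) by rewrite ler_pdivrMr// mul1r.
split.
- apply: (smooth_comp openT (B := setT) (f := fun v => 2 - rho v / d) (g := smoothstep)) => //.
    apply: (smoothD openT); first exact: smooth_cst.
    apply: (smoothN openT); apply: (smoothM openT) => //; exact: smooth_cst.
  exact: smooth_smoothstep.
- split.
    by apply: (@open_comp _ _ rho [set x | x < d]) => [v _|]; [exact: crho|exact: open_lt].
  by rewrite /= /rho big1// => i _; rewrite subrr linear0 mulr0.
- move=> v /= rv; apply: KO => /=.
  by rewrite (le_trans (ltW rv))// ler_peMl ?(ltW d0)// ler1n.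
- split=> //.
  by apply: (@closed_comp _ _ rho [set x | x <= 2 * d]) => [v _|]; [exact: crho|exact: closed_le].
- split=> v /=.
    move=> /ltW; rewrite -dE => rv; apply: smoothstep1.
    by rewrite lerBrDr -lerBrDl (le_trans rv)// lerBrDl -natr1 lerD.
  move=> /negP; rewrite -ltNge => rv; apply: smoothstep0.
  by rewrite subr_le0 ler_pdivlMr// ltW.
Qed.

End BumpFunction.

Section Bumps.
Context {R : realType} (N : atlased R).
Hypothesis rN : regular_atlas N.
Implicit Types (p q : N) (c d : chart (model N) N).

Lemma open_in_mem (A : set N) c p : charts N c -> dom c p -> open_in A -> A p ->
  nbhs (coord c p) (chart_image c A).
Proof. by move=> cc cp oA Ap; apply: open_nbhs_nbhs; split; [exact: oA|exists p]. Qed.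

Lemma open_inI (A B : set N) : open_in A -> open_in B -> open_in (A `&` B).
Proof.
move=> oA oB c cc; have ci := atlas_inj rN cc.
rewrite (_ : chart_image c _ = chart_image c A `&` chart_image c B).
  by apply: openI; [exact: oA|exact: oB].
apply/seteqP; split=> [_ [p [cp [Ap Bp]] <-]|v]; first by split; exists p.
by move=> [[p [cp Ap] <-] /(chart_imageT _ ci cp) Bp]; exists p.
Qed.

Lemma open_in_chart c (O : set (model N)) : charts N c -> open O ->
  open_in (dom c `&` coord c @^-1` O).
Proof.
move=> cc oO d dd; have di := atlas_inj rN dd.
have [oU sU] := atlas_id rN dd cc.
rewrite (_ : chart_image d _ = chart_image d (dom c) `&` in_chart d (coord c) @^-1` O).
  by apply: open_preimage_within => // v Uv; exact: smooth_continuous sU Uv.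
apply/seteqP; split=> [_ [p [dp [cp Op]] <-]|_ [[p [dp cp] <-]]].
  by split; [exists p|rewrite /= in_chartE].
by rewrite /= in_chartE// => Op; exists p.
Qed.

Lemma open_in_preimage (S : atlased R) (f : S -> N) (A : set N) :
  regular_atlas S -> smooth_map f -> open_in A -> open_in (f @^-1` A).
Proof.
move=> rS /smooth_mapP sf oA c cc; have ci := atlas_inj rS cc.
rewrite openE => _ [p [cp Ap] <-].
have [d dd dp] := atlas_cover rN (f p); have di := atlas_inj rN dd.
have [nf [B [oB Bp sB]]] := sf c d cc dd p cp dp.
have cf : {for coord c p, continuous (in_chart c (coord d \o f))}.
  exact: smooth_continuous sB Bp.
have nA : \forall w \near coord c p, chart_image d A (in_chart c (coord d \o f) w).
  by apply: cf; rewrite in_chartE//; exact: open_in_mem.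
apply: filterS2 nf nA => _ [q [cq dq] <-]; rewrite in_chartE//=.
by move=> /(chart_imageT _ di dq); exists q.
Qed.

(** The candidate for a global extension of F near a point: its product with a
    bump, continued by 0. *)
Definition cut c (b F : model N -> R) : N -> R :=
  fun q => if `[< dom c q >] then b (coord c q) * F (coord c q) else 0.

(** The points of the chart with coordinates in K form a closed set of the
    manifold. This is stated through open_in, since the jets carry an atlas but
    no topology. *)
Definition closed_in_chart c (K : set (model N)) :=
  forall q, ~ dom c q -> exists2 A, open_in A /\ A q &
    forall q', A q' -> dom c q' -> ~ K (coord c q').

(** The property that a Hausdorff manifold has, and a space with a double point
    lacks: the points with coordinates in a small enough neighbourhood do not
    accumulate outside the chart. *)
Definition has_bumps := forall p c, charts N c -> dom c p ->
  exists2 K, nbhs (coord c p) K & closed_in_chart c K.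

(** Near a point outside the chart the function vanishes, because K is closed in
    the manifold. *)
Lemma smooth_cut c (b F : model N -> R) (O K : set (model N)) :
  charts N c -> open O -> closed K -> K `<=` O -> closed_in_chart c K ->
  smooth_on setT b -> (forall v, ~ K v -> b v = 0) -> smooth_on O F ->
  smooth_fun (cut c b F).
Proof.
move=> cc oO cK KO clK sb b0 sF; have ci := atlas_inj rN cc.
have oc := open_chart rN cc.
apply: (smooth_map_local rN (@regular_real_line R)) => q.
have [cq|ncq] := pselect (dom c q).
  exists c, (@id_chart R); split => //; split.
    apply: filterS (open_nbhs_nbhs (conj oc _)); last by exists q.
    by move=> _ [q' [cq' _] <-]; exists q'.
  apply: (@smooth_near_eq _ _ _ (fun v => b v * F v)).
    apply: (open_near oc); first by exists q.
    move=> _ [q' [cq' _] <-]; rewrite in_chartE//=.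
    by rewrite /cut; case: ifPn => // /asboolP.
  have [Oq|nOq] := pselect (O (coord c q)).
    exists O; split=> //; apply: (smoothM oO) => //.
    by apply: smooth_subset sb.
  exists (~` K); split; [exact: closed_openC|by move=> /KO|].
  have oK : open (~` K) by exact: closed_openC.
  apply: (smooth_eq oK (f := fun _ => 0)); last exact: smooth_cst.
  by move=> v Kv; rewrite b0// mul0r.
have [d dd dq] := atlas_cover rN q; have di := atlas_inj rN dd.
have [A [oA Aq] AK] := clK q ncq.
exists d, (@id_chart R); split => //; split.
  apply: filterS (open_nbhs_nbhs (conj (open_chart rN dd) _)); last by exists q.
  by move=> _ [q' [cq' _] <-]; exists q'.
apply: (@smooth_near_eq _ _ _ (fun v => 0)).
  apply: filterS (open_in_mem dd dq oA Aq) => _ [q' [dq' Aq'] <-].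
  rewrite in_chartE//= /cut; case: ifPn => // /asboolP cq'.
  by rewrite b0 ?mul0r//; exact: AK.
by exists setT; split=> //; [exact: openT|exact: smooth_cst].
Qed.

Lemma closed_in_chart_sub c K K' : closed_in_chart c K -> K' `<=` K ->
  closed_in_chart c K'.
Proof.
move=> cK KK q /cK[A oA AK]; exists A => // q' Aq' cq' /KK; exact: AK.
Qed.

Hypothesis bN : has_bumps.

(** The common source of all extensions below: one bump b with which every
    coordinate function that is smooth near p can be cut off. *)
Lemma bump_chart p (A : set N) (O : set (model N)) c :
  charts N c -> dom c p ->
  open_in A -> A p -> open O -> O (coord c p) ->
  exists (b : model N -> R) (B : set N),
  [/\ open_in B, B p, forall q, B q -> [/\ dom c q, A q, O (coord c q) & b (coord c q) = 1],
   forall F, smooth_on O F -> smooth_fun (cut c b F) &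
   forall q, dom c q -> b (coord c q) != 0 -> A q].
Proof.
move=> cc cp oA Ap oO Op; have ci := atlas_inj rN cc.
have [K nK clK] := bN cc cp.
pose O' := O `&` (K^° `&` chart_image c A).
have oO' : open O'.
  by apply: openI => //; apply: openI; [exact: open_interior|exact: oA].
have O'p : O' (coord c p) by split => //; split => //; exists p.
have fN := atlas_findim rN.
have [b [B [K' [sb [oB Bp] BO [cK' KO] [b1 b0]]]]] := bump_function oO' O'p.
exists b, (dom c `&` coord c @^-1` B); split.
- exact: open_in_chart.
- by split.
- move=> q [cq Bq]; have [Oq [_ /(chart_imageT _ ci cq) Aq]] := BO _ Bq.
  by split => //; exact: b1.
- move=> F sF; apply: (smooth_cut cc oO cK' _ _ sb b0 sF).
    by move=> v /KO[].
  apply: closed_in_chart_sub clK _ => v /KO[_ [Kv _]]; exact: interior_subset.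
- move=> q cq bq; have : K' (coord c q).
    by apply: contrapT => /b0 bq0; rewrite bq0 eqxx in bq.
  by move=> /KO[_ [_ /(chart_imageT _ ci cq)]].
Qed.

End Bumps.

(** * Locality of connections *)

Section Localization.
Context {R : realType} (N : atlased R).
Hypotheses (rN : regular_atlas N) (bN : has_bumps N).
Implicit Types (p q : N) (c : chart (model N) N) (f h : N -> R) (X Y : pre_field N).

(** For a whole family at once, so that a single neighbourhood serves all
    members, even infinitely many. *)
Lemma extend_fun p c (A : set N) (O : set (model N)) (I : Type) (F : I -> model N -> R) :
  charts N c -> dom c p -> open_in A -> A p -> open O -> O (coord c p) ->
  (forall i, smooth_on O (F i)) ->
  exists (f : I -> N -> R) B, [/\ forall i, smooth_fun (f i), open_in B, B p &
    forall q, B q -> [/\ dom c q, A q, O (coord c q) & forall i, f i q = F i (coord c q)]].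
Proof.
move=> cc cp oA Ap oO Op sF.
have [b [B [oB Bp Bq sc _]]] := bump_chart rN bN cc cp oA Ap oO Op.
exists (fun i => cut c b (F i)), B; split => //; first by move=> i; exact: sc.
move=> q /Bq[cq Aq Oq b1]; split => // i.
by rewrite /cut b1 mul1r; case: ifPn => // /asboolP.
Qed.

Lemma cutoff p (A : set N) : open_in A -> A p ->
  exists f, [/\ smooth_fun f, f p = 1 & forall q, f q != 0 -> A q].
Proof.
move=> oA Ap; have [c cc cp] := atlas_cover rN p.
have [b [B [oB Bp Bq sc bA]]] := bump_chart rN bN cc cp oA Ap openT I.
exists (cut c b (fun _ => 1)); split.
- by apply: sc; exact: smooth_cst.
- have [_ _ _ b1] := Bq p Bp; rewrite /cut b1 mulr1.
  by case: ifPn => // /asboolP.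
- move=> q; rewrite /cut; case: ifPn => [/asboolP cq|]; last by rewrite eqxx.
  by rewrite mulr1; exact: bA.
Qed.

(** The components are multiplied by a bump and the field is continued by 0. Its
    action on functions is then a cut derivative, so that it is smooth. *)
Lemma extend_field p c (A : set N) (O : set (model N)) (I : Type)
    (xi : I -> model N -> model N) :
  charts N c -> dom c p -> open_in A -> A p -> open O -> O (coord c p) ->
  (forall i, smooth_on O (xi i)) ->
  exists (X : I -> pre_field N) B, [/\ forall i, vector_field (X i), open_in B, B p &
    forall q, B q -> [/\ dom c q, A q, O (coord c q) &
       forall i, X i q = chart_vector c q (xi i (coord c q))]].
Proof.
move=> cc cp oA Ap oO Op sxi.
have oc := open_chart rN cc; have ci := atlas_inj rN cc; have fN := atlas_findim rN.
have oO' : open (O `&` chart_image c setT) by exact: openI.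
have O'p : (O `&` chart_image c setT) (coord c p) by split => //; exists p.
have [b [B [oB Bp Bq sc _]]] := bump_chart rN bN cc cp oA Ap oO' O'p.
pose X i : pre_field N := fun q => if `[< dom c q >] then
  chart_vector c q (b (coord c q) *: xi i (coord c q)) else 0.
exists X, B; split => //.
  move=> i; split=> [q|h sh].
    rewrite /X; case: ifPn => [/asboolP cq|_]; first exact: tangent_chart_vector.
    by have [t0 _] := vector_field0 rN; exact: t0.
  rewrite (_ : (fun q => X i q h) = cut c b (fun v => 'D_(xi i v) (in_chart c h) v)).
    apply: sc; have sT := @smooth_derive_joint _ _ _ fN _ _ oc (smooth_fun_chart rN cc sh).
    apply: (smooth_comp oO' (B := [set z | chart_image c setT z.1])
      (f := fun v => (v, xi i v)) (g := fun z => 'D_(z.2) (in_chart c h) z.1)) => //.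
      by move=> v [].
    apply: (smooth_pair oO'); first exact: smooth_id.
    by apply: smooth_subset (sxi i) => v [].
  apply/funext => q; rewrite /X /cut; case: ifPn => // /asboolP cq.
  rewrite chart_vectorE//.
  have dh := in_chart_diff rN cc cq sh.
  by rewrite !(deriveE _ dh) linearZ.
move=> q /Bq[cq Aq [Oq _] b1]; split => // i.
by rewrite /X b1 scale1r; case: ifPn => // /asboolP.
Qed.

Section Connection.
Variable D : pre_field N -> pre_field N -> pre_field N.
Hypothesis cD : linear_connection D.

(** Multiplying both arguments by a cut-off function f equal to 1 at p does not
    change D X Y at p; the extra term (X f) Y of the Leibniz rule takes the same
    value at p for Y and Y'. *)
Lemma conn_local p (A : set N) X X' Y Y' :
  vector_field X -> vector_field X' -> vector_field Y -> vector_field Y' ->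
  open_in A -> A p -> (forall q, A q -> X q = X' q /\ Y q = Y' q) ->
  D X Y p = D X' Y' p.
Proof.
move=> vX vX' vY vY' oA Ap E.
have [f [sf fp fA]] := cutoff oA Ap.
have fE (Z Z' : pre_field N) : (forall q, A q -> Z q = Z' q) ->
    (fun q => f q *: Z q) = (fun q => f q *: Z' q) :> pre_field N.
  move=> ZZ; apply/funext => q; have [->|fq] := eqVneq (f q) 0.
    by rewrite !scale0r.
  by rewrite ZZ//; exact: fA.
have DX : D X Y p = D X' Y p.
  have := congr1 (fun Z => D Z Y p) (fE X X' (fun q Aq => proj1 (E q Aq))).
  by rewrite !(conn_scalel cD)//= fp !scale1r.
rewrite DX; have := congr1 (fun Z => D X' Z p) (fE Y Y' (fun q Aq => proj2 (E q Aq))).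
rewrite !(conn_leibniz cD)//= fp !scale1r (proj2 (E p Ap)).
by move/addrI.
Qed.

Lemma conn0l Y : vector_field Y -> D 0 Y = 0.
Proof.
move=> vY; have v0 := vector_field0 rN.
have := conn_scalel cD (smooth_fun_cst rN 0) v0 vY.
rewrite (_ : (fun p => 0 *: (0 : pre_field N) p) = 0); last first.
  by apply/funext => p; rewrite scale0r.
by move=> ->; apply/funext => p; rewrite scale0r.
Qed.

Lemma conn0r X : vector_field X -> D X 0 = 0.
Proof.
move=> vX; have v0 := vector_field0 rN.
by have /eqP := conn_addr cD vX v0 v0; rewrite addr0 -subr_eq subrr => /eqP.
Qed.

Lemma conn_suml (I : finType) (a : I -> N -> R) (E : I -> pre_field N) Y p :
  (forall i, smooth_fun (a i)) -> (forall i, vector_field (E i)) -> vector_field Y ->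
  D (\sum_i (fun q => a i q *: E i q)) Y p = \sum_i a i p *: D (E i) Y p.
Proof.
move=> sa vE vY.
have vaE i : vector_field (fun q => a i q *: E i q) by exact: vector_fieldZ.
rewrite (_ : D _ Y = \sum_i D (fun q => a i q *: E i q) Y).
  by rewrite fct_sumE; apply: eq_bigr => i _; rewrite (conn_scalel cD).
elim: (index_enum I) => [|i s IH]; first by rewrite !big_nil conn0l.
by rewrite !big_cons (conn_addl cD)// ?IH//; exact: vector_field_sum.
Qed.

Lemma conn_sumr (I : finType) (a : I -> N -> R) (E : I -> pre_field N) X p :
  (forall i, smooth_fun (a i)) -> (forall i, vector_field (E i)) -> vector_field X ->
  D X (\sum_i (fun q => a i q *: E i q)) p =
  \sum_i (X p (a i) *: E i p + a i p *: D X (E i) p).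
Proof.
move=> sa vE vX.
have vaE i : vector_field (fun q => a i q *: E i q) by exact: vector_fieldZ.
rewrite (_ : D X _ = \sum_i D X (fun q => a i q *: E i q)).
  by rewrite fct_sumE; apply: eq_bigr => i _; rewrite (conn_leibniz cD).
elim: (index_enum I) => [|i s IH]; first by rewrite !big_nil conn0r.
by rewrite !big_cons (conn_addr cD)// ?IH//; exact: vector_field_sum.
Qed.

End Connection.

(** Near p the fields are combinations of the frame, so that by locality and the
    Leibniz rule D X Y p is computed from the values of D on the frame at p. *)
Lemma conn_unique (D1 D2 : pre_field N -> pre_field N -> pre_field N) p
    (I : finType) (E : I -> pre_field N) :
  linear_connection D1 -> linear_connection D2 ->
  (forall i, vector_field (E i)) ->
  (forall X, vector_field X -> exists (a : I -> N -> R) (A : set N),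
    [/\ forall i, smooth_fun (a i), open_in A, A p &
       forall q, A q -> X q = \sum_i a i q *: E i q]) ->
  (forall i j, D1 (E i) (E j) p = D2 (E i) (E j) p) ->
  forall X Y, vector_field X -> vector_field Y -> D1 X Y p = D2 X Y p.
Proof.
move=> c1 c2 vE span DE X Y vX vY.
have [a [A [sa oA Ap XE]]] := span X vX.
have [b [B [sb oB Bp YE]]] := span Y vY.
have vaE (f : I -> N -> R) : (forall i, smooth_fun (f i)) ->
    vector_field (\sum_i (fun q => f i q *: E i q)).
  by move=> sf; apply: vector_field_sum => // i; exact: vector_fieldZ.
have vXE := vaE a sa; have vYE := vaE b sb.
have AE q : (A `&` B) q -> X q = (\sum_i (fun q => a i q *: E i q)) q /\
    Y q = (\sum_i (fun q => b i q *: E i q)) q.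
  by move=> [Aq Bq]; rewrite XE// YE// !fct_sumE.
have H D : linear_connection D -> D X Y p =
    \sum_i a i p *: \sum_j (E i p (b j) *: E j p + b j p *: D (E i) (E j) p).
  move=> cD; rewrite (conn_local cD vX vXE vY vYE (open_inI rN oA oB) (conj Ap Bp) AE).
  rewrite (conn_suml cD)//; apply: eq_bigr => i _; congr (_ *: _).
  by rewrite (conn_sumr cD).
rewrite (H D1 c1) (H D2 c2); apply: eq_bigr => i _; congr (_ *: _).
by apply: eq_bigr => j _; rewrite DE.
Qed.

End Localization.

(** * Bump functions on jet manifolds *)

Section JetBumps.
Context {R : realType} {n : nat} {M : manifold R n} {r : nat}.
Hypothesis r2 : (r <= 2)%N.

Lemma row0_continuous m : continuous (fun w : R * 'M[R]_(m.+1, n) => row ord0 w.2).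
Proof.
move=> w; have s : smooth_on setT (fun w : R * 'M[R]_(m.+1, n) => row ord0 w.2).
  by apply: (row_smooth _ openT); exact: smooth_snd.
exact: smooth_continuous s _.
Qed.

Lemma open_in_jet_base (A : set (mspace M)) : open A ->
  open_in ((@jet_base R n M r : jets M r -> mspace M) @^-1` A).
Proof.
move=> oA _ [c cc <-]; rewrite jet_chart_image//.
have [_ _ _ /(_ _ oA) oc] := mchart_homeo cc.
by apply: (open_comp (f := fun w : R * 'M[R]_(r.+1, n) => row ord0 w.2)) => // w _; exact: row0_continuous.
Qed.

(** The set is the image of a compact ball under the inverse of the chart, hence
    compact, hence closed in the Hausdorff space M. *)
Lemma closed_chart_ball (c : chart 'rV[R]_n (mspace M)) (v0 : 'rV[R]_n) (e : R) p :
  mcharts M c -> (forall v, `|v0 - v| <= e -> chart_image c setT v) ->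
  dom c p ->
  closed [set x | dom c x /\ `|v0 - coord c x| <= e].
Proof.
move=> cc eI cp; have [oc ci cont oimg] := mchart_homeo cc.
pose B := [set v : 'rV[R]_n | `|v0 - v| <= e].
have BE : B = closed_ball_ (fun x : 'rV[R]_n => `|x|) v0 e by [].
have cB : compact B.
  apply: bounded_closed_compact.
    exists (`|v0| + e); split; first exact: num_real.
    move=> M0 hM v Bv; apply: le_trans (ltW hM).
    rewrite -[v](subKr v0) (le_trans (ler_normB _ _))// lerD2l; exact: Bv.
  by rewrite BE; exact: closed_closed_ball_.
pose i (v : 'rV[R]_n) : mspace M := xget p [set q | dom c q /\ coord c q = v].
have iE v : chart_image c setT v -> dom c (i v) /\ coord c (i v) = v.
  by move=> [q [cq _] qv]; apply: (@xgetPex _ p [set q | dom c q /\ coord c q = v]); exists q.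
have ci' v : B v -> {for v, continuous i}.
  move=> /eI /iE[di ciE] A; rewrite nbhsE => -[A' [oA' A'i] AA'].
  have N : nbhs v (chart_image c A').
    by apply: open_nbhs_nbhs; split; [exact: oimg|exists (i v)].
  apply: filterS N => _ [q [cq A'q] <-]; apply: AA'.
  have [dq cq'] := iE (coord c q) (ex_intro2 _ _ q (conj cq Logic.I) erefl).
  by have -> : i (coord c q) = q by apply: ci; rewrite ?inE.
have -> : [set x | dom c x /\ `|v0 - coord c x| <= e] = i @` B.
  apply/seteqP; split=> [x [cx xe]|_ [v Bv <-]].
    exists (coord c x) => //.
    have [dq cq'] := iE (coord c x) (ex_intro2 _ _ x (conj cx Logic.I) erefl).
    by apply: ci; rewrite ?inE.
  by have [d1 d2] := iE v (eI v Bv); split => //; rewrite d2.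
apply: compact_closed; first by case: (M).
apply: continuous_compact => //.
apply: continuous_in_subspaceT => v; rewrite inE => Bv; exact: ci'.
Qed.

(** A condition on the base point alone suffices: the jets over a closed
    coordinate ball of M have a closed projection. *)
Lemma jets_have_bumps : has_bumps (jets M r).
Proof.
move=> j _ [c cc <-] cj.
have rM := regular_manifold M.
pose x0 := coord c (jet_base j).
have Ix : chart_image c setT x0 by exists (jet_base j).
have /nbhs_ballP[d /= d0 dI] := open_nbhs_nbhs (conj (open_chart rM cc) Ix).
pose e := d / 2.
have e0 : 0 < e by rewrite divr_gt0.
have eI v : `|x0 - v| <= e -> chart_image c setT v.
  move=> xv; apply: dI; rewrite -ball_normE /ball_ /=.
  by rewrite (le_lt_trans xv)// /e ltr_pdivrMr// ltr_pMr// ltr1n.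
exists [set w | `|x0 - row ord0 w.2| <= e].
  have /(_ _ _) N := @row0_continuous r (coord (jet_chart r c) j).
  apply: (N [set v | `|x0 - v| <= e]); rewrite jet_row0//.
  have := nbhsx_ballx x0 e e0; apply: filterS => v.
  by rewrite -ball_normE /ball_ /= => /ltW.
move=> q nq; have cK := closed_chart_ball cc eI cj.
exists ((@jet_base R n M r : jets M r -> mspace M) @^-1` (~` [set x | dom c x /\ `|x0 - coord c x| <= e])).
  split; first by apply: open_in_jet_base; exact: closed_openC.
  by move=> [cq _]; exact: nq.
move=> q' Aq' cq' Kq'; apply: Aq'; split => //.
by move: Kq'; rewrite /= jet_row0.
Qed.

End JetBumps.

(** * Base point and velocity in the induced coordinates *)

(** Derivatives at 0 of both sides of an identity along a line. It is used when
    the dependence on t is known in closed form, as a polynomial of degree 2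
    plus terms with constant weights; no third derivative of the maps involved
    then has to be considered. *)
Lemma derive_unique_line (R : realType) (V : normedModType R) (I : finType)
    (g : V -> R) (f : I -> V -> R) (gam : I -> R) (w u : V) (a b c : R) :
  differentiable g w -> (forall i, differentiable (f i) w) ->
  (\forall t \near (0 : R), g (w + t *: u) =
     a + t * b + t * t * c + \sum_i f i (w + t *: u) * gam i) ->
  'D_u g w = b + \sum_i 'D_u (f i) w * gam i.
Proof.
move=> dg df E.
have line (h : V -> R) : differentiable h w ->
    is_derive (0 : R) 1 (fun t => h (w + t *: u)) ('D_u h w).
  move=> dh; have := @is_derive_line _ _ _ h w u 0.
  by rewrite scale0r addr0 => /(_ dh).
pose P (t : R) := a + t * b + t * t * c.
have dP : is_derive (0 : R) 1 P b.
  have di := is_derive_id (0 : R) (1 : R).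
  have d1 := is_deriveM di (is_derive_cst b (0 : R) (1 : R)).
  have d2 := is_deriveM (is_deriveM di di) (is_derive_cst c (0 : R) (1 : R)).
  apply: is_derive_eq (is_deriveD (is_deriveD (is_derive_cst a (0 : R) (1 : R)) d1) d2) _.
  rewrite -![_ *: _]/(_ * _) /= -![id 0]/(0 : R).
  rewrite -[X in _ + X + _]/(0 * 0 + b * 1) -[(id * id : R -> R) 0]/(0 * 0 : R).
  ring.
have dS : is_derive (0 : R) 1 (fun t => \sum_i f i (w + t *: u) * gam i)
    (\sum_i 'D_u (f i) w * gam i).
  elim: (index_enum I) => [|i s IH].
    rewrite big_nil (_ : (fun t => _) = cst 0); first exact: is_derive_cst.
    by apply/funext => t; rewrite big_nil.
  rewrite big_cons (_ : (fun t => _) = (fun t => f i (w + t *: u) *: gam i) +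
     (fun t => \sum_(j <- s) f j (w + t *: u) * gam j)); last first.
    by apply/funext => t; rewrite big_cons.
  by apply: is_deriveD => //; apply: (@is_derive_scale_cst _ R); exact: line.
have dPS : is_derive (0 : R) 1 (fun t => P t + \sum_i f i (w + t *: u) * gam i)
   (b + \sum_i 'D_u (f i) w * gam i) by exact: is_deriveD dP dS.
have [_ <-] := near_eq_is_derive (f := fun t => P t + \sum_i f i (w + t *: u) * gam i)
  (g := fun t => g (w + t *: u)) (filterS (fun t h => esym h) E) dPS.
by have [_ <-] := line g dg.
Qed.

Section Coordinates.
Context {R : realType} {n : nat}.
Local Notation E0 := (R * 'rV[R]_n)%type.
Local Notation E1 := (R * 'M[R]_(2, n))%type.

Definition pt (w : E1) : E0 := (w.1, row ord0 w.2).
Definition vel (w : E1) : 'rV[R]_n := row ord_max w.2.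

Fact pt_linear : linear pt.
Proof.
move=> a [t m] [s k]; rewrite /pt /=; congr (_, _).
by rewrite raddfD /= linearZ.
Qed.
HB.instance Definition _ := GRing.isLinear.Build R E1 E0 _ pt pt_linear.

Fact vel_linear : linear vel.
Proof. by move=> a [t m] [s k]; rewrite /vel /= raddfD /= linearZ. Qed.
HB.instance Definition _ := GRing.isLinear.Build R E1 'rV[R]_n _ vel vel_linear.

Lemma smooth_pt (W : set E1) : open W -> smooth_on W pt.
Proof.
move=> oW; apply: (smooth_pair oW); first exact: smooth_fst.
by apply: row_smooth => //; exact: smooth_snd.
Qed.

Lemma smooth_vel (W : set E1) : open W -> smooth_on W vel.
Proof. by move=> oW; apply: row_smooth => //; exact: smooth_snd. Qed.

Lemma derive_of_linear (V W : normedModType R) (f : {linear V -> W}) (x u : V) :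
  continuous f -> 'D_u f x = f u.
Proof.
move=> cf; have df : differentiable f x by exact: linear_differentiable.
by rewrite (deriveE _ df) diff_lin.
Qed.

Lemma pt_continuous : continuous pt.
Proof. by move=> w; exact: smooth_continuous (smooth_pt openT) _. Qed.

Lemma vel_continuous : continuous vel.
Proof. by move=> w; exact: smooth_continuous (smooth_vel openT) _. Qed.

Lemma ptD u w : pt (u + w) = pt u + pt w. Proof. exact: linearD. Qed.
Lemma ptZ (a : R) w : pt (a *: w) = a *: pt w. Proof. exact: linearZ. Qed.
Lemma velD u w : vel (u + w) = vel u + vel w. Proof. exact: linearD. Qed.
Lemma velZ (a : R) w : vel (a *: w) = a *: vel w. Proof. exact: linearZ. Qed.

Lemma pt_diff w : differentiable pt w.
Proof. exact: smooth_differentiable (smooth_pt openT) _. Qed.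

Lemma vel_diff w : differentiable vel w.
Proof. exact: smooth_differentiable (smooth_vel openT) _. Qed.

Lemma derive_pt u w : 'D_u pt w = pt u.
Proof. exact: (@derive_of_linear E1 E0 (pt : {linear E1 -> E0}) w u pt_continuous). Qed.

Lemma derive_vel u w : 'D_u vel w = vel u.
Proof. exact: (@derive_of_linear E1 'rV[R]_n (vel : {linear E1 -> 'rV[R]_n}) w u vel_continuous). Qed.

Definition stack (a b : 'rV[R]_n) : 'M[R]_(2, n) :=
  \matrix_(k, i) (if k == ord0 then a 0 i else b 0 i).

Lemma pt_stack t a b : pt (t, stack a b) = (t, a).
Proof. by congr (_, _); apply/rowP => i; rewrite !mxE. Qed.

Lemma vel_stack t a b : vel (t, stack a b) = b.
Proof. by apply/rowP => i; rewrite !mxE. Qed.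

Lemma stackD a b a' b' : stack a b + stack a' b' = stack (a + a') (b + b').
Proof. by apply/matrixP => k i; rewrite !mxE; case: ifP. Qed.

Lemma stackZ l a b : l *: stack a b = stack (l *: a) (l *: b).
Proof. by apply/matrixP => k i; rewrite !mxE; case: ifP. Qed.

Definition basis_row (i : 'I_n) : 'rV[R]_n := delta_mx 0 i.

Lemma delta_stack0 i : delta_mx ord0 i = stack (basis_row i) 0 :> 'M[R]_(2, n).
Proof.
by apply/matrixP => k j; rewrite !mxE; case: (k == ord0); rewrite ?mxE.
Qed.

Lemma delta_stack1 i : delta_mx ord_max i = stack 0 (basis_row i) :> 'M[R]_(2, n).
Proof.
apply/matrixP => k j; rewrite !mxE.
have -> : (k == ord_max) = ~~ (k == ord0) by case: k => [[|[|k]] hk].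
by case: (k == ord0) => //=; rewrite ?mxE.
Qed.

Lemma derive_addl (V W : normedModType R) (F : V -> W) (x u v : V) :
  differentiable F x -> 'D_(u + v) F x = 'D_u F x + 'D_v F x.
Proof. by move=> dF; rewrite (deriveE u dF) (deriveE v dF) (deriveE _ dF) linearD. Qed.

Lemma derive_scalel (V W : normedModType R) (F : V -> W) (x u : V) (a : R) :
  differentiable F x -> 'D_(a *: u) F x = a *: 'D_u F x.
Proof. by move=> dF; rewrite (deriveE u dF) (deriveE _ dF) linearZ. Qed.

Lemma derive_suml (V W : normedModType R) (I : Type) (s : seq I) (F : V -> W) x (u : I -> V) :
  differentiable F x -> 'D_(\sum_(i <- s) u i) F x = \sum_(i <- s) 'D_(u i) F x.
Proof.
move=> dF; elim: s => [|i s IH]; first by rewrite !big_nil derive0.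
by rewrite !big_cons derive_addl// IH.
Qed.

(** The total differential (z, y) |-> D_y F(z) is linear in y. *)
Lemma derive_total (V W : normedModType R) {fV : findim V} (U : set V) (F : V -> W)
    (z y a b : V) : open U -> smooth_on U F -> U z ->
  'D_((a, b)) (fun z => 'D_(z.2) F z.1) (z, y) = 'D_a ('D_y F) z + 'D_b F z.
Proof.
move=> oU sF Uz; pose T := fun z : V * V => 'D_(z.2) F z.1.
have sT := @smooth_derive_joint _ _ _ fV _ _ oU sF.
have dT : differentiable T (z, y).
  exact: (@smooth_differentiable _ _ _ _ _ (z, y) sT Uz).
have E1 : 'D_((a, 0)) T (z, y) = 'D_a ('D_y F) z.
  have did : differentiable (@id V) z by exact: smooth_differentiable (smooth_id setT) _.
  have dc : differentiable (fun _ : V => y) z by exact: differentiable_cst.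
  have dz := differentiable_pair did dc.
  have := derive_comp a dz dT.
  by rewrite (derive_pair _ did dc) derive_id derive_cst => <-.
have E2 : 'D_((0, b)) T (z, y) = 'D_b F z.
  have did : differentiable (@id V) y by exact: smooth_differentiable (smooth_id setT) _.
  have dc : differentiable (fun _ : V => z) y by exact: differentiable_cst.
  have dz := differentiable_pair dc did.
  have := derive_comp b dz dT.
  rewrite (derive_pair _ dc did) derive_id derive_cst => <-.
  have dF := smooth_differentiable sF Uz.
  rewrite (_ : T \o _ = 'd F z); last by apply/funext => y'; rewrite /T /= deriveE.
  rewrite (@derive_of_linear _ _ ('d F z) y b (diff_continuous dF)).
  exact: esym (deriveE b dF).
have E : (a, b) = (a, 0) + (0, b) :> V * V.
  by rewrite -[RHS]/(a + 0, 0 + b) addr0 add0r.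
have E3 := @derive_addl _ _ T (z, y) (a, 0) (0, b) dT.
rewrite -E in E3; exact (etrans E3 (congr2 +%R E1 E2)).
Qed.

End Coordinates.

(** * The force under a prolonged map *)

Lemma near_line (R : realType) (V : normedModType R) (W : set V) (w u : V) :
  open W -> W w -> \forall t \near (0 : R), W (w + t *: u).
Proof.
move=> oW Ww; have cl : (fun t : R => w + t *: u) @ (0 : R) --> w.
  have -> : nbhs w = nbhs (w + 0 *: u) by rewrite scale0r addr0.
  by apply: cvgD; [exact: cvg_cst|apply: cvgZr_tmp; exact: cvg_id].
by apply: (cl W); exact: open_nbhs_nbhs.
Qed.

Section Transformation.
Context {R : realType} {n : nat}.
Local Notation E0 := (R * 'rV[R]_n)%type.
Local Notation E1 := (R * 'M[R]_(2, n))%type.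
Variables (F : E0 -> 'rV[R]_n) (U : set E0).
Hypotheses (oU : open U) (sF : smooth_on U F).

Definition dx (i : 'I_n) : E1 := (0, delta_mx ord0 i).
Definition dv (i : 'I_n) : E1 := (0, delta_mx ord_max i).
Definition ey (i : 'I_n) : E0 := (0, basis_row i).
(** The direction (1, v) of the total time derivative. *)
Definition tdir (w : E1) : E0 := (1, vel w).

Lemma pt_dv i : pt (dv i) = 0.
Proof. by rewrite /dv delta_stack1 pt_stack. Qed.

Lemma vel_dv i : vel (dv i) = basis_row i.
Proof. by rewrite /dv delta_stack1 vel_stack. Qed.

Lemma pt_dx i : pt (dx i) = ey i.
Proof. by rewrite /dx delta_stack0 pt_stack. Qed.

Lemma vel_dx i : vel (dx i) = 0.
Proof. by rewrite /dx delta_stack0 vel_stack. Qed.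

Lemma pt_line w i (t : R) : pt (w + t *: dv i) = pt w.
Proof. by rewrite ptD ptZ pt_dv scaler0 addr0. Qed.

Lemma tdir_line w i (t : R) : tdir (w + t *: dv i) = tdir w + t *: ey i.
Proof.
rewrite /tdir velD velZ vel_dv.
by rewrite -[RHS]/(1 + t * 0, vel w + t *: basis_row i) mulr0 addr0.
Qed.

Lemma pt_vel_inj (w w' : E1) : pt w = pt w' -> vel w = vel w' -> w = w'.
Proof.
case: w w' => [t m] [t' m'] [-> e0] e1; congr (_, _).
apply/matrixP => k i.
have [->|k1] : k = ord0 \/ k = ord_max.
  by case: k => [[|[|k]] hk]//; [left|right]; exact/val_inj.
  by have := congr1 (fun r : 'rV_n => r 0 i) e0; rewrite !mxE.
by have := congr1 (fun r : 'rV_n => r 0 i) e1; rewrite k1 !mxE.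
Qed.

Definition component (k : 'I_n) (z : E0) : R := F z 0 k.
(** Read as a function on 1-jets, since the fields of the frame differentiate
    it; i is the index of the derivative and k that of the component. *)
Definition jac (i k : 'I_n) (w : E1) : R := 'D_(ey i) (component k) (pt w).
Local Notation L := (@lift R n n 1 F).

Lemma smooth_component k : smooth_on U (component k).
Proof. exact: smooth_entry. Qed.

Lemma entryD k u z : U z -> ('D_u F z) 0 k = 'D_u (component k) z.
Proof.
move=> Uz; have dF := smooth_differentiable sF Uz.
exact: esym (derive_linear_comp u (@mx_entry_continuous R 1 n (0, k)) dF).
Qed.

Lemma entryD2 k u v z : U z -> ('D_u ('D_v F) z) 0 k = 'D_u ('D_v (component k)) z.
Proof.
move=> Uz; have dF := smooth_differentiable (smooth_derive v sF) Uz.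
rewrite -[LHS](derive_linear_comp u (@mx_entry_continuous R 1 n (0, k)) dF).
by apply: near_eq_derive; apply: (open_near oU Uz) => z' Uz'; exact: entryD.
Qed.

Lemma lift_pt w : pt (L w) = (w.1, F (pt w)).
Proof.
congr (_, _); apply/rowP => i; rewrite !mxE /=.
by rewrite (_ : inord 0 = ord0)//; apply/val_inj; rewrite /= inordK.
Qed.

Lemma lift_vel w : vel (L w) = 'D_(tdir w) F (pt w).
Proof.
apply/rowP => i; rewrite !mxE /=.
rewrite (_ : inord 0 = ord0); last by apply/val_inj; rewrite /= inordK.
by rewrite (_ : inord 1 = ord_max)//; apply/val_inj; rewrite /= inordK.
Qed.

Let J : set E1 := jet_over U.
Let oJ : open J. Proof. exact: open_jet_over. Qed.
Let sL : smooth_on J L. Proof. exact: smooth_lift. Qed.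

Lemma lift_diff w : J w -> differentiable L w.
Proof. exact: smooth_differentiable. Qed.

Lemma derive_lift_pt w u : J w -> pt ('D_u L w) = (u.1, 'D_(pt u) F (pt w)).
Proof.
move=> Jw; have := derive_comp u (lift_diff Jw) (pt_diff (L w)); rewrite derive_pt => <-.
have -> : pt \o L = (fun w => (w.1, (F \o pt) w)) by apply/funext => w'; exact: lift_pt.
have dp := @pt_diff R n w.
have dF : differentiable F (pt w) by exact: smooth_differentiable sF Jw.
have d1 : differentiable (fst : E1 -> R) w.
  by apply: linear_differentiable; exact: fst_continuous.
have d2 := differentiable_comp dp dF.
rewrite (derive_pair u d1 d2) (derive_comp u dp dF).
rewrite derive_pt.
by rewrite (@derive_of_linear _ E1 R fst w u (@fst_continuous _ _ _)).
Qed.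

Lemma derive_lift_vel w u : J w ->
  vel ('D_u L w) = 'D_(pt u) ('D_(tdir w) F) (pt w) + 'D_((0, vel u)) F (pt w).
Proof.
move=> Jw; have := derive_comp u (lift_diff Jw) (vel_diff (L w)); rewrite derive_vel => <-.
pose T := fun z : E0 * E0 => 'D_(z.2) F z.1.
have -> : vel \o L = T \o (fun w => (pt w, tdir w)).
  by apply/funext => w'; exact: lift_vel.
have fE := findim_prod (@findimR R) (@findim_mx R 1 n).
have sT := @smooth_derive_joint _ _ _ fE _ _ oU sF.
have dp := @pt_diff R n w.
have dv' := @vel_diff R n w.
have d1 : differentiable (fun _ : E1 => 1 : R) w by exact: differentiable_cst.
have dy := differentiable_pair d1 dv'.
have dpy := differentiable_pair dp dy.
have dT : differentiable T (pt w, tdir w).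
  exact: (@smooth_differentiable _ _ _ _ _ (pt w, tdir w) sT Jw).
rewrite (derive_comp u dpy dT) (derive_pair u dp dy) (derive_pair u d1 dv').
rewrite derive_cst derive_pt.
rewrite derive_vel.
exact: (@derive_total _ _ _ fE _ _ _ _ _ _ oU sF Jw).
Qed.

Lemma row_basis (r : 'rV[R]_n) : r = \sum_k r 0 k *: basis_row k.
Proof. by rewrite {1}[r]row_sum_delta. Qed.

(** The lift is affine on the fibres, with linear part the Jacobian matrix. *)
Lemma lift_dv w i : J w -> 'D_(dv i) L w = \sum_k jac i k w *: dv k.
Proof.
move=> Jw; apply: pt_vel_inj.
  rewrite derive_lift_pt// pt_dv derive0 raddf_sum /= big1// => k _.
  by rewrite ptZ pt_dv scaler0.
rewrite derive_lift_vel// pt_dv derive0 add0r vel_dv raddf_sum /=.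
rewrite [LHS]row_basis; apply: eq_bigr => k _.
by rewrite velZ vel_dv; congr (_ *: _); exact: entryD.
Qed.

Lemma derive_comp_lift_dv (h : E1 -> R) w i : J w -> differentiable h (L w) ->
  'D_(dv i) (h \o L) w = \sum_k jac i k w * 'D_(dv k) h (L w).
Proof.
move=> Jw dh; rewrite (derive_comp _ (lift_diff Jw) dh) lift_dv// derive_suml//.
by apply: eq_bigr => k _; rewrite derive_scalel.
Qed.

Lemma derive_jac w u i k : J w -> 'D_u (jac i k) w = 'D_(pt u) ('D_(ey i) (component k)) (pt w).
Proof.
move=> Jw; have dp := @pt_diff R n w.
have dG := smooth_differentiable (smooth_derive (ey i) (smooth_component k)) Jw.
have := derive_comp u dp dG.
by rewrite derive_pt.
Qed.

Lemma smooth_jac i k : smooth_on J (jac i k).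
Proof.
apply: (smooth_comp oJ (B := U) (f := pt) (g := 'D_(ey i) (component k))) => //.
  exact: smooth_pt.
exact: smooth_derive (smooth_component k).
Qed.

Lemma derive2_dir k z (y e u : E0) (t : R) : U z ->
  'D_u ('D_(y + t *: e) (component k)) z = 'D_u ('D_y (component k)) z + t * 'D_u ('D_e (component k)) z.
Proof.
move=> Uz.
have dG x : U x -> differentiable (component k) x by exact: smooth_differentiable (smooth_component k).
have dD v : differentiable ('D_v (component k)) z.
  exact: smooth_differentiable (smooth_derive v (smooth_component k)) Uz.
have de : derivable ('D_e (component k)) z u by exact: diff_derivable.
have dy : derivable ('D_y (component k)) z u by exact: diff_derivable.
have dZ := derivableZ (k := t) de.
rewrite -[t * _]/(t *: _) -(deriveZ t de) -(deriveD dy dZ).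
apply: near_eq_derive; apply: (open_near oU Uz) => x Ux.
have := derive_addl y (t *: e) (dG x Ux).
by rewrite (derive_scalel e t (dG x Ux)).
Qed.

Lemma derive_sym k z (u v : E0) : U z -> 'D_u ('D_v (component k)) z = 'D_v ('D_u (component k)) z.
Proof. exact: derive_comm oU (smooth_component k). Qed.

(** The term D^2 F(y, y) is quadratic in y; the factor 2 of the linear
    coefficient comes from the symmetry of second derivatives. *)
Lemma derive2_line k z (y e : E0) (t : R) : U z ->
  'D_(y + t *: e) ('D_(y + t *: e) (component k)) z =
  'D_y ('D_y (component k)) z + t * (2 * 'D_e ('D_y (component k)) z) + t * t * 'D_e ('D_e (component k)) z.
Proof.
move=> Uz.
have dyt : differentiable ('D_(y + t *: e) (component k)) z.
  exact: smooth_differentiable (smooth_derive _ (smooth_component k)) Uz.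
have alg (X A C D a b b' c : R) : X = A + C -> C = t *: D -> A = a + t * b ->
    D = b' + t * c -> b = b' -> X = a + t * (2 * b') + t * t * c.
  by move=> -> -> -> -> ->; rewrite -[t *: _]/(t * _); ring.
exact (alg _ _ _ _ _ _ _ _ (derive_addl y (t *: e) dyt) (derive_scalel e t dyt)
  (derive2_dir k y e y t Uz) (derive2_dir k y e e t Uz) (derive_sym k y e Uz)).
Qed.

Section Sodes.
Variables (f f' : 'I_n -> E1 -> R) (W W' : set E1).
Hypotheses (oW : open W) (oW' : open W').
Hypotheses (sf : forall k, smooth_on W (f k)) (sf' : forall k, smooth_on W' (f' k)).
Hypothesis WL : forall w, W' w -> J w /\ W (L w).
Hypothesis force_law : forall w k, W' w -> f k (L w) =
  ('D_((tdir w, (0, \row_l f' l w))) (fun z => 'D_(z.2) F z.1) (pt w, tdir w)) 0 k.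

(** The components of X^s and of X_i^s, for a sode s with force g. *)
Definition xi0 (g : 'I_n -> E1 -> R) (w : E1) : E1 := (1, stack (vel w) (\row_l g l w)).
Definition xiH (g : 'I_n -> E1 -> R) (i : 'I_n) (w : E1) : E1 :=
  (0, stack (basis_row i) (2^-1 *: \row_l 'D_(dv i) (g l) w)).

Lemma force_law_total w : W' w -> (\row_k f k (L w)) =
  'D_(tdir w) ('D_(tdir w) F) (pt w) + 'D_((0, \row_l f' l w)) F (pt w).
Proof.
move=> Ww; have [Jw _] := WL Ww.
apply/rowP => k; rewrite mxE force_law//.
by rewrite (@derive_total _ _ _ (findim_prod (@findimR R) (@findim_mx R 1 n)) _ _ _ _ _ _ oU sF Jw).
Qed.

Lemma vertical_sum (a : 'I_n -> R) z : U z ->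
  'D_((0, \row_l a l)) F z = \sum_l a l *: 'D_(ey l) F z.
Proof.
move=> Uz; have dF := smooth_differentiable sF Uz.
have -> : (0, \row_l a l) = \sum_l a l *: ey l :> E0.
  rewrite [\row_l a l]row_basis -[LHS]/(0, _).
  apply: injective_projections; rewrite raddf_sum /=.
    by rewrite big1// => l _; rewrite scaler0.
  by apply: eq_bigr => l _; rewrite mxE.
by rewrite derive_suml//; apply: eq_bigr => l _; rewrite derive_scalel.
Qed.

Lemma force_law_entry w k : W' w -> f k (L w) =
  'D_(tdir w) ('D_(tdir w) (component k)) (pt w) + \sum_l f' l w * jac l k w.
Proof.
move=> Ww; have [Jw _] := WL Ww.
have := congr1 (fun r : 'rV_n => r 0 k) (force_law_total Ww); rewrite !mxE => ->.
rewrite entryD2// vertical_sum// summxE; congr (_ + _).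
by apply: eq_bigr => l _; rewrite mxE entryD.
Qed.

(** The field X^s is the direction in which the sode moves its solutions, so
    that the tangent map of the lift preserves it by the very relation between
    the two sodes. *)
Lemma lift_xi0 w : W' w -> 'D_(xi0 f' w) L w = xi0 f (L w).
Proof.
move=> Ww; have [Jw _] := WL Ww; apply: pt_vel_inj.
  by rewrite derive_lift_pt// !pt_stack lift_vel.
by rewrite derive_lift_vel// pt_stack !vel_stack force_law_total.
Qed.

(** The fibre derivative of force_law_entry along d/dv^i. On the left the lift
    contributes the Jacobian matrix; on the right the first term is quadratic in
    the velocity, and the Jacobian matrix is constant on the fibres. *)
Lemma force_transform w i k : W' w ->
  \sum_j jac i j w * 'D_(dv j) (f k) (L w) =
  2 * 'D_(ey i) ('D_(tdir w) (component k)) (pt w) + \sum_l 'D_(dv i) (f' l) w * jac l k w.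
Proof.
move=> Ww; have [Jw WLw] := WL Ww.
have dfk : differentiable (f k) (L w) by exact: smooth_differentiable (sf k) WLw.
rewrite -(derive_comp_lift_dv i Jw dfk).
apply: (@derive_unique_line _ _ _ (f k \o L) f' (fun l => jac l k w) w (dv i)
  ('D_(tdir w) ('D_(tdir w) (component k)) (pt w)) _ ('D_(ey i) ('D_(ey i) (component k)) (pt w))).
- exact: differentiable_comp (lift_diff Jw) dfk.
- by move=> l; exact: smooth_differentiable (sf' l) Ww.
apply: filterS (near_line (dv i) oW' Ww) => t Wt; rewrite /= force_law_entry// tdir_line pt_line.
apply: (congr2 +%R (derive2_line k (tdir w) (ey i) t Jw)).
by apply: eq_bigr => l _; rewrite /jac pt_line.
Qed.

(** The velocity part of the image of X_i^s' is D^2 F(e_i, (1, v)) plus half of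
    the fibre derivative of f', transformed by the Jacobian matrix. By
    force_transform this is half of the transformed fibre derivative of f. *)
Lemma lift_xiH w i : W' w -> 'D_(xiH f' i w) L w = \sum_k jac i k w *: xiH f k (L w).
Proof.
move=> Ww; have [Jw WLw] := WL Ww; apply: pt_vel_inj.
  rewrite derive_lift_pt// pt_stack raddf_sum /=.
  under eq_bigr do rewrite ptZ pt_stack.
  apply: injective_projections; rewrite raddf_sum /=.
    by rewrite big1// => k _; rewrite scaler0.
  by rewrite [LHS]row_basis; apply: eq_bigr => k _; rewrite entryD.
rewrite derive_lift_vel// pt_stack vel_stack raddf_sum /=.
under eq_bigr do rewrite velZ vel_stack.
apply/rowP => k.
rewrite mxE summxE entryD2//.
have -> : 2^-1 *: (\row_l 'D_(dv i) (f' l) w) = \row_l (2^-1 * 'D_(dv i) (f' l) w).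
  by apply/rowP => l; rewrite !mxE.
rewrite vertical_sum// summxE.
under eq_bigr do rewrite mxE entryD//.
under [RHS]eq_bigr do rewrite !mxE.
have := force_transform i k Ww => H.
have -> : \sum_j jac i j w * (2^-1 * 'D_(dv j) (f k) (L w)) =
    2^-1 * \sum_j jac i j w * 'D_(dv j) (f k) (L w).
  by rewrite mulr_sumr; apply: eq_bigr => j _; rewrite mulrCA.
rewrite H mulrDr mulrA mulVf// mul1r; congr (_ + _).
by rewrite mulr_sumr; apply: eq_bigr => l _; rewrite mulrA.
Qed.

(** By symmetry, the derivative of B_i^k along X^s' is D^2 F^k(e_i, (1, v)),
    which force_transform expresses by the forces. *)
Lemma derive_jac_xi0 w i k : W' w ->
  'D_(xi0 f' w) (jac i k) w - 2^-1 * (\sum_j jac i j w * 'D_(dv j) (f k) (L w)) =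
  - 2^-1 * \sum_l 'D_(dv i) (f' l) w * jac l k w.
Proof.
move=> Ww; have [Jw WLw] := WL Ww.
rewrite derive_jac// pt_stack -/(tdir w) (derive_sym k (tdir w) (ey i) Jw).
rewrite force_transform// mulrDr mulrA mulVf// mul1r opprD addrA subrr add0r.
by rewrite mulNr.
Qed.

(** The derivative of B_i^k along X_l^s' is D^2 F^k(e_l, e_i). It occurs in the
    fibre derivative along d/dv^i of force_transform for the index l, whose
    first term is affine in the velocity. *)
Lemma derive_jac_xiH w i l k : W' w ->
  'D_(xiH f' l w) (jac i k) w -
    2^-1 * (\sum_j jac l j w * \sum_m jac i m w * 'D_(dv m) ('D_(dv j) (f k)) (L w)) =
  - 2^-1 * \sum_r 'D_(dv i) ('D_(dv l) (f' r)) w * jac r k w.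
Proof.
move=> Ww; have [Jw WLw] := WL Ww.
rewrite derive_jac// pt_stack -/(ey l).
pose h j := 'D_(dv j) (f k).
have dh j : differentiable (h j) (L w).
  exact: smooth_differentiable (smooth_derive (dv j) (sf k)) WLw.
(* The left side of force_transform for the index l with the Jacobian matrix
   frozen at w: it is the same function on the fibre through w, and its
   derivative along the fibre is g1 by composition and g2 by force_transform. *)
pose g w' := \sum_j (h j \o L) w' * jac l j w.
have dhL j : differentiable (h j \o L) w := differentiable_comp (lift_diff Jw) (dh j).
have sg : smooth_on W' g.
  apply: (smooth_sum oW') => j _; apply: (smoothM oW'); last exact: smooth_cst.
  apply: (smooth_comp oW' (B := W) (f := L) (g := h j)).
  - by move=> w' /WL[].
  - by apply: smooth_subset sL => w' /WL[].
  - exact: smooth_derive (sf k).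
have dg := smooth_differentiable sg Ww.
have g1 : 'D_(dv i) g w = 0 + \sum_j 'D_(dv i) (h j \o L) w * jac l j w.
  apply: (@derive_unique_line _ _ _ g (fun j => h j \o L) (fun j => jac l j w) w (dv i) 0 0 0 dg dhL).
  by apply: filterS filterT => t _; rewrite !mulr0 !addr0 add0r.
have g2 : 'D_(dv i) g w = 2 * 'D_(ey l) ('D_(ey i) (component k)) (pt w) +
    \sum_r 'D_(dv i) ('D_(dv l) (f' r)) w * jac r k w.
  have df' r : differentiable ('D_(dv l) (f' r)) w.
    exact: smooth_differentiable (smooth_derive (dv l) (sf' r)) Ww.
  apply: (@derive_unique_line _ _ _ g (fun r => 'D_(dv l) (f' r)) (fun r => jac r k w) w (dv i)
    (2 * 'D_(ey l) ('D_(tdir w) (component k)) (pt w)) _ 0 dg df').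
  apply: filterS (near_line (dv i) oW' Ww) => t Wt.
  have FT := force_transform l k Wt.
  rewrite tdir_line pt_line (derive2_dir k (tdir w) (ey i) (ey l) t Jw) in FT.
  have Bl r r' : jac r r' (w + t *: dv i) = jac r r' w by rewrite /jac pt_line.
  have -> : g (w + t *: dv i) = \sum_j jac l j (w + t *: dv i) * 'D_(dv j) (f k) (L (w + t *: dv i)).
    by apply: eq_bigr => j _; rewrite Bl mulrC.
  apply: (etrans FT); rewrite mulr0 addr0 mulrDr [2 * (t * _)]mulrCA.
  by congr (_ + _); apply: eq_bigr => r _; rewrite Bl.
have gS : \sum_j jac l j w * (\sum_m jac i m w * 'D_(dv m) (h j) (L w)) = 'D_(dv i) g w.
  rewrite g1 add0r; apply: eq_bigr => j _; rewrite mulrC; congr (_ * _).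
  by rewrite derive_comp_lift_dv.
have alg (X S Y D : R) : S = D -> D = 2 * X + Y -> X - 2^-1 * S = - 2^-1 * Y.
  by move=> -> ->; rewrite mulrDr mulrA mulVf// mul1r opprD addrA subrr add0r mulNr.
exact: alg gS g2.
Qed.

Lemma derive_jac_dv w i l k : J w -> 'D_(dv l) (jac i k) w = 0.
Proof. by move=> Jw; rewrite derive_jac// pt_dv derive0. Qed.

End Sodes.

End Transformation.

(** * Sodes in induced coordinates *)

Section SodeCoordinates.
Context {R : realType} {n : nat} {M : manifold R n}.
Local Notation E1 := (R * 'M[R]_(2, n))%type.
Local Notation J1 := (jets M 1).
Implicit Types (c d : chart 'rV[R]_n (mspace M)) (j : jets M 1).

Lemma jet1_charts c : mcharts M c -> charts J1 (jet_chart 1 c).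
Proof. by move=> cc; exists c. Qed.

Lemma jet1_inj c : mcharts M c ->
  {in dom (jet_chart 1 c) &, injective (coord (jet_chart 1 c))}.
Proof. exact: jet_chart_inj. Qed.

Lemma regular_jets1 : regular_atlas J1.
Proof. exact: regular_jets. Qed.

Variable s : J1 -> jets M 2.
Hypothesis hs : sode s.

Lemma sode_base j : jet_base (s j) = jet_base j.
Proof. by rewrite -[in RHS](hs.2 j) /jet_proj jet_base_mk. Qed.

Lemma sode_dom c j : dom (jet_chart 2 c) (s j) = dom (jet_chart 1 c) j.
Proof. by rewrite /dom /= sode_base. Qed.

Definition force_chart c (k : 'I_n) : E1 -> R := in_chart (jet_chart 1 c) (force s c k).

Lemma force_chartE c k j : mcharts M c -> dom (jet_chart 1 c) j ->
  force_chart c k (coord (jet_chart 1 c) j) = force s c k j.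
Proof. by move=> cc cj; rewrite /force_chart in_chartE//; exact: jet1_inj. Qed.

(** A sode is a section, so that it keeps the time, position and velocity of a
    jet. *)
Lemma sode_coord c j l : mcharts M c -> dom (jet_chart 1 c) j -> (l <= 1)%N ->
  (coord (jet_chart 2 c) (s j)).1 = (coord (jet_chart 1 c) j).1 /\
  row (inord l) (coord (jet_chart 2 c) (s j)).2 = row (inord l) (coord (jet_chart 1 c) j).2.
Proof.
move=> cc cj l1; have cs : dom (jet_chart 2 c) (s j) by rewrite sode_dom.
have := hs.2 j; rewrite /jet_proj => E.
have tE := congr1 (@jet_time _ _ _ _) E; rewrite jet_time_mk in tE.
split; first exact: tE.
rewrite -[in RHS]E -{1}(mk_jetK (s j)) !jet_row_mk//.
by apply: leq_trans l1 _.
Qed.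

Lemma open_jet1 c : mcharts M c -> open (chart_image (jet_chart 1 c) setT : set E1).
Proof. by move=> cc; exact: (open_chart regular_jets1 (jet1_charts cc)). Qed.

Lemma smooth_force_chart c k : mcharts M c ->
  smooth_on (chart_image (jet_chart 1 c) setT) (force_chart c k).
Proof.
move=> cc; have [ss _] := hs.
have c2 : charts (jets M 2) (jet_chart 2 c) by exists c.
have [oU sU] := ss _ _ (jet1_charts cc) c2.
have oW := open_jet1 cc.
have E : chart_image (jet_chart 1 c) setT `<=` chart_image (jet_chart 1 c) (s @^-1` dom (jet_chart 2 c)).
  by move=> _ [j [cj _] <-]; exists j => //; split => //; rewrite /preimage /= sode_base.
have sW := smooth_subset E sU.
apply: (smooth_eq oW (f := fun w => (in_chart (jet_chart 1 c) (coord (jet_chart 2 c) \o s) w).2 ord_max k)).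
  move=> _ [j [cj _] <-]; rewrite force_chartE// in_chartE//; exact: jet1_inj.
apply: (smooth_entry oW).
apply: (smooth_comp oW (B := setT) (g := snd)) => //; exact: smooth_snd.
Qed.

Section Frames.
Variables (c : chart 'rV[R]_n (mspace M)) (j : jets M 1) (h : J1 -> R).
Hypotheses (cc : mcharts M c) (cj : dom (jet_chart 1 c) j) (sh : smooth_fun h).
Let w : E1 := coord (jet_chart 1 c) j.
Let hc : E1 -> R := in_chart (jet_chart 1 c) h.
Let dh : differentiable hc w.
Proof. exact: (in_chart_diff regular_jets1 (jet1_charts cc) cj sh). Qed.

Lemma xiH_chart i : X_hor s c i j h = 'D_(xiH (force_chart c) i w) hc w.
Proof.
have -> : xiH (force_chart c) i w = dx i + 2^-1 *: \sum_k 'D_(dv i) (force_chart c k) w *: dv k.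
  apply: pt_vel_inj.
    rewrite ptD ptZ raddf_sum /= pt_dx pt_stack big1 ?scaler0 ?addr0//.
    by move=> k _; rewrite ptZ pt_dv scaler0.
  rewrite velD velZ raddf_sum /= vel_dx vel_stack add0r; congr (_ *: _).
  rewrite [LHS]row_basis; apply: eq_bigr => k _.
  by rewrite velZ vel_dv mxE.
rewrite (derive_addl _ _ dh) (derive_scalel _ _ dh) (derive_suml _ _ dh).
rewrite /X_hor -[LHS]/(d_x c i j h + 2^-1 * (\sum_k dforce s c k i j *: d_xdot c k j) h).
congr (_ + _); congr (_ * _); rewrite fct_sumE; apply: eq_bigr => k _.
by rewrite (derive_scalel _ _ dh).
Qed.

Lemma xi0_chart : X_sode s c j h = 'D_(xi0 (force_chart c) w) hc w.
Proof.
have -> : xi0 (force_chart c) w = (1, 0) + \sum_i xdot c i j *: dx i + \sum_i force s c i j *: dv i.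
  have r0 (k : 'I_2) : row k (0 : 'M[R]_(2, n)) = 0 by apply/rowP => i; rewrite !mxE.
  have e1 : pt ((1, 0) : E1) = (1, 0) by rewrite /pt /= r0.
  have e2 : vel ((1, 0) : E1) = 0 by rewrite /vel /= r0.
  apply: pt_vel_inj.
    rewrite !ptD !raddf_sum /= pt_stack e1.
    rewrite [X in _ + _ + X]big1 ?addr0 => [|k _]; last first.
      by rewrite ptZ pt_dv scaler0.
    have -> : \sum_k pt (xdot c k j *: dx k) = (0, vel w) :> R * 'rV[R]_n.
      under eq_bigr do rewrite ptZ pt_dx.
      rewrite [vel w]row_basis; apply: injective_projections; rewrite raddf_sum /=.
        by rewrite big1// => k _; rewrite scaler0.
      by apply: eq_bigr => k _; rewrite mxE.
    by rewrite -[RHS]/(1 + 0, 0 + vel w) addr0 add0r.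
  rewrite !velD !raddf_sum /= vel_stack e2 add0r.
  rewrite [X in X + _]big1 ?add0r => [|k _]; last by rewrite velZ vel_dx scaler0.
  rewrite [LHS]row_basis; apply: eq_bigr => k _.
  by rewrite velZ vel_dv mxE force_chartE.
rewrite !(derive_addl _ _ dh) !(derive_suml _ _ dh).
have e1 : (\sum_i xdot c i j *: d_x c i j) h = \sum_i 'D_(xdot c i j *: dx i) hc w.
  rewrite fct_sumE; apply: eq_bigr => k _.
  by rewrite (derive_scalel _ _ dh).
have e2 : (\sum_i force s c i j *: d_xdot c i j) h = \sum_i 'D_(force s c i j *: dv i) hc w.
  rewrite fct_sumE; apply: eq_bigr => k _.
  by rewrite (derive_scalel _ _ dh).
exact (congr2 +%R (congr2 +%R erefl e1) e2).
Qed.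

End Frames.

Lemma d2force_chart c k i l j : mcharts M c -> dom (jet_chart 1 c) j ->
  d2force s c k i l j = 'D_(dv i) ('D_(dv l) (force_chart c k)) (coord (jet_chart 1 c) j).
Proof.
move=> cc cj; apply: near_eq_derive.
apply: (open_near (open_jet1 cc)); first by exists j.
by move=> _ [j' [cj' _] <-]; rewrite in_chartE//; exact: jet1_inj.
Qed.

End SodeCoordinates.

(** * The adapted frame under a prolonged map *)

Section Pushforward.
Context {R : realType} {n : nat} {M : manifold R n}.
Local Notation E1 := (R * 'M[R]_(2, n))%type.
Local Notation J1 := (jets M 1).
Variables (s s' : J1 -> jets M 2).
Hypotheses (hs : sode s) (hs' : sode s').
Variables (Psi : evolution M -> evolution M) (psi : evolution M -> M).
Hypotheses (spsi : smooth_map psi) (PE : forall t x, Psi (t, x) = (t, psi (t, x))).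
Let P : J1 -> J1 := prolong 1 Psi.
Hypothesis ss' : forall j, s (P j) = prolong 2 Psi (s' j).
Variables (c d : chart 'rV[R]_n (mspace M)).
Hypotheses (cc : mcharts M c) (dd : mcharts M d).

Let F := expr c d psi.
Let U := chart_image (evol_chart c) (psi @^-1` dom d).
Let oU : open U. Proof. by have [] := expr_smooth spsi cc dd. Qed.
Let sF : smooth_on U F. Proof. by have [] := expr_smooth spsi cc dd. Qed.
Let J : set E1 := jet_over U.
Let oJ : open J. Proof. exact: open_jet_over. Qed.
Let W : set E1 := chart_image (jet_chart 1 d) setT.

Lemma domainP w : J w -> exists p : J1,
  [/\ dom (jet_chart 1 c) p, dom (jet_chart 1 d) (P p) & coord (jet_chart 1 c) p = w].
Proof.
rewrite /J -(prolong_domain (r := 1) isT spsi PE cc dd) => -[p [cp dp] <-].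
by exists p.
Qed.

Lemma domain_coord p : dom (jet_chart 1 c) p -> dom (jet_chart 1 d) (P p) ->
  J (coord (jet_chart 1 c) p).
Proof.
by move=> cp dp; rewrite /J -(prolong_domain (r := 1) isT spsi PE cc dd); exists p.
Qed.

Lemma lift_coord p : dom (jet_chart 1 c) p -> dom (jet_chart 1 d) (P p) ->
  lift F (coord (jet_chart 1 c) p) = coord (jet_chart 1 d) (P p).
Proof. by move=> cp dp; apply: esym; exact: prolong_chart. Qed.

Lemma domain_lift w : J w -> J w /\ W (lift F w).
Proof.
move=> Jw; split => //; have [p [cp dp <-]] := domainP Jw.
by rewrite lift_coord//; exists (P p).
Qed.

(** The relation Psi^(2) o s' = s o Psi^(1), read in the last row of the
    coordinates of a 2-jet; the other rows hold because s and s' are sections. *)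
Lemma force_rel w k : J w -> force_chart s d k (lift F w) =
  ('D_((tdir w, (0, \row_l force_chart s' c l w))) (fun z => 'D_(z.2) F z.1) (pt w, tdir w)) 0 k.
Proof.
move=> Jw; have [p [cp dp <-]] := domainP Jw.
rewrite lift_coord// force_chartE// /force ss'.
have cs : dom (jet_chart 2 c) (s' p) by rewrite (sode_dom hs').
have ds : dom (jet_chart 2 d) (prolong 2 Psi (s' p)) by rewrite -ss' (sode_dom hs).
rewrite (prolong_chart (r := 2) isT spsi PE cc dd cs ds).
have r0 := sode_coord hs' cc cp (leq0n 1).
have r1 := sode_coord hs' cc cp (leqnn 1).
have i0 : inord 0 = ord0 :> 'I_2 by apply/val_inj; rewrite /= inordK.
have i1 : inord 1 = ord_max :> 'I_2 by apply/val_inj; rewrite /= inordK.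
have i2 : inord 2 = ord_max :> 'I_3 by apply/val_inj; rewrite /= inordK.
have E2 : row (inord 2) (coord (jet_chart 2 c) (s' p)).2 =
    \row_l force_chart s' c l (coord (jet_chart 1 c) p).
  by apply/rowP => l; rewrite [RHS]mxE force_chartE// [LHS]mxE i2.
rewrite [LHS]mxE /der E2 (proj1 r0) (proj2 r0) (proj2 r1) i0 i1; reflexivity.
Qed.

Lemma smooth_force_chart_domain k : smooth_on J (force_chart s' c k).
Proof.
apply: smooth_subset (smooth_force_chart hs' k cc) => w Jw.
by have [p [cp dp <-]] := domainP Jw; exists p.
Qed.

Section AtPoint.
Variable p : J1.
Hypotheses (cp : dom (jet_chart 1 c) p) (dp : dom (jet_chart 1 d) (P p)).
Let w : E1 := coord (jet_chart 1 c) p.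
Let Jw : J w. Proof. exact: domain_coord. Qed.
Let Lw : lift F w = coord (jet_chart 1 d) (P p). Proof. exact: lift_coord. Qed.
Let sfd k : smooth_on W (force_chart s d k). Proof. exact: smooth_force_chart. Qed.
Let sP : smooth_map P. Proof. exact: (smooth_prolong (r := 1) isT spsi PE). Qed.

Lemma smooth_fun_push h : smooth_fun h -> smooth_fun (h \o P).
Proof. exact: (smooth_map_comp regular_jets1 regular_jets1 sP). Qed.

(** The tangent map of the prolongation is the derivative of the lift. *)
Lemma derive_push h u : smooth_fun h ->
  'D_u (in_chart (jet_chart 1 c) (h \o P)) w =
  'D_('D_u (lift F) w) (in_chart (jet_chart 1 d) h) (coord (jet_chart 1 d) (P p)).
Proof.
move=> sh; have dh := in_chart_diff regular_jets1 (jet1_charts dd) dp sh.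
rewrite -Lw in dh *; rewrite -(derive_comp u (lift_diff oU sF Jw) dh).
apply: near_eq_derive; apply: (open_near oJ Jw) => w' Jw'.
have [q [cq dq <-]] := domainP Jw'.
rewrite in_chartE//; last exact: jet1_inj.
apply: (etrans _ (congr1 (in_chart (jet_chart 1 d) h) (esym (lift_coord cq dq)))).
by rewrite in_chartE//; exact: jet1_inj.
Qed.

Definition trans (i k : 'I_n) : R := jac F i k w.

Lemma push_sode h : smooth_fun h -> X_sode s' c p (h \o P) = X_sode s d (P p) h.
Proof.
move=> sh; have shP := smooth_fun_push sh.
apply: (etrans (xi0_chart s' cc cp shP)); apply: (etrans (derive_push _ sh)).
rewrite (lift_xi0 oU sF domain_lift force_rel Jw) Lw.
exact: esym (xi0_chart s dd dp sh).
Qed.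

(** The coefficient 1/2 in X_i is what makes the vertical part vanish; see
    lift_xiH. *)
Lemma push_hor i h : smooth_fun h ->
  X_hor s' c i p (h \o P) = \sum_k trans i k * X_hor s d k (P p) h.
Proof.
move=> sh; have shP := smooth_fun_push sh.
have dh := in_chart_diff regular_jets1 (jet1_charts dd) dp sh.
apply: (etrans (xiH_chart s' cc cp shP i)); apply: (etrans (derive_push _ sh)).
rewrite (lift_xiH oU sF oJ sfd smooth_force_chart_domain domain_lift force_rel i Jw) Lw.
rewrite (derive_suml _ _ dh); apply: eq_bigr => k _.
by rewrite (derive_scalel _ _ dh) (xiH_chart s dd dp sh k).
Qed.

Lemma push_dot i h : smooth_fun h ->
  d_xdot c i p (h \o P) = \sum_k trans i k * d_xdot d k (P p) h.
Proof.
move=> sh; have shP := smooth_fun_push sh.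
have dh := in_chart_diff regular_jets1 (jet1_charts dd) dp sh.
apply: (etrans (derive_push (dv i) sh)); rewrite (lift_dv oU sF i Jw).
rewrite (derive_suml _ _ dh); apply: eq_bigr => k _.
by rewrite (derive_scalel _ _ dh).
Qed.

Section Entry.
Variables (i k : 'I_n) (b : J1 -> R).
Hypotheses (sb : smooth_fun b) (bE : \forall w' \near w, in_chart (jet_chart 1 c) b w' = jac F i k w').

(** Connections differentiate global functions only, so that the entry of the
    Jacobian matrix is represented by a function b on M^1 that agrees with it
    near p. *)
Lemma entry_sode : X_sode s' c p b =
  2^-1 * (\sum_j trans i j * dforce s d k j (P p)) -
  2^-1 * \sum_l dforce s' c l i p * trans l k.
Proof.
apply: (etrans (xi0_chart s' cc cp sb)); apply: (etrans (near_eq_derive _ bE)).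
have := derive_jac_xi0 oU sF oJ sfd smooth_force_chart_domain domain_lift force_rel i k Jw.
by rewrite Lw => /eqP; rewrite subr_eq addrC mulNr => /eqP.
Qed.

Lemma entry_hor l : X_hor s' c l p b =
  2^-1 * (\sum_j trans l j * \sum_m trans i m * d2force s d k m j (P p)) -
  2^-1 * \sum_r d2force s' c r i l p * trans r k.
Proof.
apply: (etrans (xiH_chart s' cc cp sb l)); apply: (etrans (near_eq_derive _ bE)).
have := derive_jac_xiH oU sF oJ sfd smooth_force_chart_domain domain_lift force_rel i l k Jw.
rewrite Lw => /eqP; rewrite subr_eq addrC mulNr => /eqP ->.
apply: (congr2 (fun a b => 2^-1 * a - 2^-1 * b)).
  apply: eq_bigr => j _; congr (_ * _); apply: eq_bigr => m _; congr (_ * _).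
  by rewrite d2force_chart.
by apply: eq_bigr => r _; rewrite d2force_chart.
Qed.

Lemma entry_dot l : d_xdot c l p b = 0.
Proof.
exact: (etrans (near_eq_derive (dv l) bE) (derive_jac_dv oU sF i l k Jw)).
Qed.

End Entry.
End AtPoint.
End Pushforward.

(** * Local frames adapted to a sode *)

Section LocalFrames.
Context {R : realType} {n : nat} {M : manifold R n}.
Local Notation E1 := (R * 'M[R]_(2, n))%type.
Local Notation J1 := (jets M 1).
Implicit Types (c d : chart 'rV[R]_n (mspace M)) (p q j : jets M 1) (h : J1 -> R).

Lemma jets1_bumps : has_bumps J1.
Proof. exact: jets_have_bumps. Qed.

(** The value true selects the horizontal fields and false the vertical ones.
    Both halves of the frame obey the same laws, so that most arguments treat
    them at once. *)
Definition frame (s : J1 -> jets M 2) c (b : bool) (i : 'I_n) : pre_field J1 :=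
  if b then X_hor s c i else d_xdot c i.

Definition frame_xi (f : 'I_n -> E1 -> R) (b : bool) (i : 'I_n) (w : E1) : E1 :=
  if b then xiH f i w else dv i.

Lemma smooth_stack (W : set E1) (t : E1 -> R) (a b : E1 -> 'rV[R]_n) : open W ->
  smooth_on W t -> smooth_on W a -> smooth_on W b ->
  smooth_on W (fun w => (t w, stack (a w) (b w))).
Proof.
move=> oW st sa sb; apply: (smooth_pair oW st); apply: (smooth_mx oW) => k i.
apply: (smooth_eq oW (f := fun w => if k == ord0 then a w 0 i else b w 0 i)).
  by move=> w _; rewrite mxE.
by case: (k == ord0); exact: (smooth_entry oW).
Qed.

Lemma smooth_row (W : set E1) (a : 'I_n -> E1 -> R) : open W ->
  (forall i, smooth_on W (a i)) -> smooth_on W (fun w => \row_i a i w).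
Proof.
move=> oW sa; apply: (smooth_mx oW) => k i.
by apply: (smooth_eq oW _ (sa i)) => w _; rewrite mxE.
Qed.

Section Sode.
Variable s : J1 -> jets M 2.
Hypothesis hs : sode s.

Lemma frame_chart c b i j h : mcharts M c -> dom (jet_chart 1 c) j -> smooth_fun h ->
  frame s c b i j h =
  'D_(frame_xi (force_chart s c) b i (coord (jet_chart 1 c) j)) (in_chart (jet_chart 1 c) h)
     (coord (jet_chart 1 c) j).
Proof.
move=> cc cj sh; rewrite /frame /frame_xi; case: b; first exact: xiH_chart.
exact: erefl.
Qed.

Definition frame_index := (unit + bool * 'I_n)%type.

Definition full_frame c (a : frame_index) : pre_field J1 :=
  if a is inr (b, i) then frame s c b i else X_sode s c.

Definition full_xi c (a : frame_index) (w : E1) : E1 :=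
  if a is inr (b, i) then frame_xi (force_chart s c) b i w else xi0 (force_chart s c) w.

Lemma full_frame_chart c a j h : mcharts M c -> dom (jet_chart 1 c) j -> smooth_fun h ->
  full_frame c a j h = chart_vector (jet_chart 1 c : chart (model J1) J1) j
    (full_xi c a (coord (jet_chart 1 c) j)) h.
Proof.
move=> cc cj sh; rewrite chart_vectorE//.
by case: a => [[]|[b i]]; [exact: xi0_chart|exact: frame_chart].
Qed.

Lemma smooth_full_xi c a : mcharts M c ->
  smooth_on (chart_image (jet_chart 1 c) setT) (full_xi c a).
Proof.
move=> cc; have oW := open_jet1 cc.
have sf k := smooth_force_chart hs k cc.
case: a => [[]|[[] i]] /=; last exact: smooth_cst.
- apply: (smooth_stack oW); [exact: smooth_cst|exact: smooth_vel|].
  exact: (smooth_row oW).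
- apply: (smooth_stack oW); [exact: smooth_cst|exact: smooth_cst|].
  apply: (smoothZ oW); first exact: smooth_cst.
  by apply: (smooth_row oW) => l; exact: smooth_derive.
Qed.

Lemma extend_frame c p (A : set J1) : mcharts M c -> dom (jet_chart 1 c) p ->
  open_in A -> A p ->
  exists (E : frame_index -> pre_field J1) (B : set J1),
  [/\ forall a, vector_field (E a), open_in B, B p &
   forall q, B q -> [/\ dom (jet_chart 1 c) q, A q &
      forall a h, smooth_fun h -> E a q h = full_frame c a q h]].
Proof.
move=> cc cp oA Ap.
have Ip : chart_image (jet_chart 1 c) setT (coord (jet_chart 1 c) p) by exists p.
have [E [B [vE oB Bp EB]]] := extend_field regular_jets1 jets1_bumps (jet1_charts cc) cp oA Ap
  (open_jet1 cc) Ip (fun a => smooth_full_xi a cc).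
exists E, B; split => // q /EB[cq Aq _ Eq]; split => // a h sh.
by rewrite Eq full_frame_chart.
Qed.

(** Solving a triangular system: the time component gives the coefficient of
    X^s, then the position those of X_i^s, then the velocity those of d/dv^i. *)
Lemma frame_decomposition (t : R) (x y v f : 'rV[R]_n) (g : 'I_n -> 'rV[R]_n) :
  (t, stack x y) = t *: (1, stack v f) +
    \sum_i ((x - t *: v) 0 i *: (0, stack (basis_row i) (g i)) +
      (y - t *: f - \sum_l (x - t *: v) 0 l *: g l) 0 i *: dv i) :> E1.
Proof.
rewrite big_split /=; set X := x - t *: v; set Y := y - t *: f - _.
have -> : \sum_i X 0 i *: (0, stack (basis_row i) (g i)) =
    (0, stack X (\sum_l X 0 l *: g l)) :> E1.
  apply: pt_vel_inj; rewrite raddf_sum /=.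
    under eq_bigr do rewrite ptZ pt_stack.
    rewrite pt_stack; apply: injective_projections; rewrite raddf_sum /=.
      by rewrite big1// => i _; rewrite scaler0.
    by rewrite -row_basis.
  by under eq_bigr do rewrite velZ vel_stack; rewrite vel_stack.
have -> : \sum_i Y 0 i *: dv i = (0, stack 0 Y) :> E1.
  apply: pt_vel_inj; rewrite raddf_sum /=.
    by under eq_bigr do rewrite ptZ pt_dv scaler0; rewrite big1// pt_stack.
  by under eq_bigr do rewrite velZ vel_dv; rewrite vel_stack -row_basis.
rewrite -[RHS]/(t * 1 + (0 + 0), t *: stack v f + (stack X (\sum_l X 0 l *: g l) + stack 0 Y)).
rewrite mulr1 !addr0 stackZ !stackD /X /Y addr0; congr (_, stack _ _).
  by rewrite addrC subrK.
by rewrite [\sum_l _ + _]addrC subrK addrC subrK.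
Qed.

Lemma sum_frame_index (V : nmodType) (F : frame_index -> V) :
  \sum_a F a = F (inl tt) + \sum_i (F (inr (true, i)) + F (inr (false, i))).
Proof.
rewrite big_sumType /=; congr (_ + _).
  by rewrite (big_pred1 tt)// => -[].
have -> : \sum_i F (inr i) = \sum_(b : bool) \sum_i F (inr (b, i)).
  by rewrite pair_bigA; apply: eq_bigr => -[].
by rewrite big_bool -big_split.
Qed.

(** The coefficients are explicit in the components of X, which are the values
    of X on extended coordinate functions and therefore smooth. *)
Lemma frame_span c p (E : frame_index -> pre_field J1) (B : set J1) X :
  mcharts M c -> dom (jet_chart 1 c) p -> open_in B -> B p ->
  (forall a, vector_field (E a)) ->
  (forall q, B q -> forall a h, smooth_fun h -> E a q h = full_frame c a q h) ->
  vector_field X ->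
  exists (a : frame_index -> J1 -> R) (A : set J1),
    [/\ forall i, smooth_fun (a i), open_in A, A p &
        forall q, A q -> X q = \sum_i a i q *: E i q].
Proof.
move=> cc cp oB Bp vE EF [tX sX].
have r1 := @regular_jets1 R n M.
pose W : set E1 := chart_image (jet_chart 1 c) setT.
have oW : open W := open_jet1 cc.
have Wp : W (coord (jet_chart 1 c) p) by exists p.
(* One extension operator for all smooth functions of the coordinates, so
   that a single open set serves the coordinates, the force and its
   derivatives. *)
have [ext [A [se oA Ap extE]]] := extend_fun r1 jets1_bumps (jet1_charts cc) cp oB Bp oW Wp
  (fun F : {F : E1 -> R | smooth_on W F} => svalP F).
have {}extE q (Aq : A q) : [/\ dom (jet_chart 1 c) q, B q &
    forall F, ext F q = sval F (coord (jet_chart 1 c) q)].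
  by have [] := extE q Aq.
have st : smooth_on W (fun w : E1 => w.1) by exact: smooth_fst.
have sr k i : smooth_on W (fun w : E1 => w.2 k i).
  by apply: (smooth_entry oW); exact: smooth_snd.
have sf k := smooth_force_chart hs k cc.
have sg l k : smooth_on W (fun w => 2^-1 * 'D_(dv l) (force_chart s c k) w).
  by apply: (smoothM oW); [exact: smooth_cst|exact: smooth_derive].
pose e F (sF : smooth_on W F) := ext (exist _ F sF).
pose tau q := X q (e _ st).
pose x i q := X q (e _ (sr ord0 i)).
pose y i q := X q (e _ (sr ord_max i)).
pose aH i q := x i q + -1 * (tau q * e _ (sr ord_max i) q).
pose aV k q := y k q + -1 * (tau q * e _ (sf k) q) + -1 * \sum_l aH l q * e _ (sg l k) q.
pose a (i : frame_index) := match i with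
  | inl _ => tau | inr (true, i) => aH i | inr (false, i) => aV i end.
have s_cst (u : R) := smooth_fun_cst r1 u.
have stau : smooth_fun tau by apply: sX; exact: se.
have saH i : smooth_fun (aH i).
  apply: (smooth_funD r1); first by apply: sX; exact: se.
  by apply: (smooth_funM r1 (s_cst _)); apply: (smooth_funM r1 stau); exact: se.
have saV k : smooth_fun (aV k).
  apply: (smooth_funD r1); first apply: (smooth_funD r1).
  - by apply: sX; exact: se.
  - by apply: (smooth_funM r1 (s_cst _)); apply: (smooth_funM r1 stau); exact: se.
  apply: (smooth_funM r1 (s_cst _)).
  elim: (index_enum _) => [|l L IH].
    rewrite (_ : (fun p0 => _) = (fun=> 0)); first exact: s_cst.
    by apply/funext => q; rewrite big_nil.
  rewrite (_ : (fun p0 => _) = (fun q => aH l q * e _ (sg l k) q +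
     \sum_(l <- L) aH l q * e _ (sg l k) q)); last first.
    by apply/funext => q; rewrite big_cons.
  apply: (smooth_funD r1) => //; apply: (smooth_funM r1); first exact: saH.
  exact: se.
exists a, A; split => //.
  by move=> [[]|[[] i]] /=; [exact: stau|exact: saH|exact: saV].
move=> q Aq; have [cq Bq eE] := extE q Aq.
set w := coord (jet_chart 1 c) q.
have [z Xz] := tangentE r1 (jet1_charts cc) cq (tX q).
have XF F (sF : smooth_on W F) : X q (e F sF) = 'D_z F w.
  rewrite Xz chart_vectorE; last exact: se.
  apply: near_eq_derive.
  apply: filterS (open_in_mem (jet1_charts cc) cq oA Aq) => _ [q' [cq' Aq'] <-].
  rewrite in_chartE//; last exact: jet1_inj.
  by have [_ _] := extE q' Aq'; exact.
have tz : tau q = z.1.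
  by rewrite /tau XF; exact: (@derive_of_linear _ E1 R fst w z (@fst_continuous _ _ _)).
have entry k i : 'D_z (fun w : E1 => w.2 k i) w = z.2 k i.
  have cL : continuous (mx_entry (k, i) \o snd : E1 -> R).
    move=> v; apply: continuous_comp; first exact: snd_continuous.
    exact: mx_entry_continuous.
  exact: (@derive_of_linear _ E1 R (mx_entry (k, i) \o snd : {linear E1 -> R}) w z cL).
have xz i : x i q = (row ord0 z.2) 0 i by rewrite /x XF entry mxE.
have yz i : y i q = (row ord_max z.2) 0 i by rewrite /y XF entry mxE.
pose f := \row_k force_chart s c k w.
pose g l := 2^-1 *: \row_k 'D_(dv l) (force_chart s c k) w.
have zE : z = (z.1, stack (row ord0 z.2) (row ord_max z.2)).
  by apply: pt_vel_inj; rewrite ?pt_stack ?vel_stack.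
have dec := frame_decomposition z.1 (row ord0 z.2) (row ord_max z.2) (vel w) f g.
rewrite -zE in dec.
have subE (u u' : 'rV[R]_n) (t : R) i : (u - t *: u') 0 i = u 0 i + -1 * (t * u' 0 i).
  by rewrite !mxE mulN1r.
have velE (u : E1) i : vel u 0 i = u.2 ord_max i by rewrite mxE.
have aHE i : aH i q = (row ord0 z.2 - z.1 *: vel w) 0 i.
  rewrite subE velE /aH xz tz /e eE; reflexivity.
have aVE k : aV k q = (row ord_max z.2 - z.1 *: f -
    \sum_l (row ord0 z.2 - z.1 *: vel w) 0 l *: g l) 0 k.
  have -> (u : 'rV[R]_n) : u - \sum_l (row ord0 z.2 - z.1 *: vel w) 0 l *: g l =
      u - 1 *: \sum_l aH l q *: g l.
    by rewrite scale1r; congr (_ - _); apply: eq_bigr => l _; rewrite aHE.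
  rewrite !subE mul1r summxE /aV yz tz /e eE.
  have -> : f 0 k = force_chart s c k w by rewrite mxE.
  congr (_ + _ * _); apply: eq_bigr => l _; rewrite eE.
  have gE : g l 0 k = 2^-1 * 'D_(dv l) (force_chart s c k) w by rewrite 2!mxE.
  have -> : (aH l q *: g l) 0 k = aH l q * g l 0 k by rewrite mxE.
  by rewrite gE.
have vaE : vector_field (\sum_i (fun q => a i q *: E i q)).
  apply: (vector_field_sum r1) => i; apply: (vector_fieldZ r1) => //.
  by case: i => [[]|[[] i]] /=; [exact: stau|exact: saH|exact: saV].
have tS : tangent q (\sum_i a i q *: E i q) by have [/(_ q)] := vaE; rewrite fct_sumE.
apply: (tangent_eq (tX q) tS) => h sh.
have dh := in_chart_diff r1 (jet1_charts cc) cq sh.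
rewrite Xz chart_vectorE// dec fct_sumE.
rewrite (derive_addl _ _ dh) (derive_scalel _ _ dh) (derive_suml _ _ dh).
have aE i : (a i q *: E i q) h = a i q * full_frame c i q h.
  by rewrite -[LHS]/(a i q * E i q h) EF.
under [RHS]eq_bigr do rewrite aE.
rewrite sum_frame_index; apply: (congr2 +%R).
  exact (congr2 *%R (esym tz) (esym (xi0_chart s cc cq sh))).
apply: eq_bigr => i _.
rewrite (derive_addl _ _ dh) (derive_scalel _ _ dh) (derive_scalel _ _ dh).
apply: (congr2 +%R).
  exact (congr2 *%R (esym (aHE i)) (esym (frame_chart true i cc cq sh))).
exact (congr2 *%R (esym (aVE i)) (esym (frame_chart false i cc cq sh))).
Qed.

End Sode.
End LocalFrames.

(** * Uniqueness and transport of connections *)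

Section Diffeomorphism.
Context {R : realType} (N : atlased R).
Hypothesis rN : regular_atlas N.
Variables (f g : N -> N).
Hypotheses (fK : cancel f g) (gK : cancel g f) (sf : smooth_map f) (sg : smooth_map g).

Lemma inverseE : inverse f = g.
Proof.
apply/funext => y; rewrite -[LHS]fK /inverse pinvK//.
by rewrite inE; exists (g y).
Qed.

Lemma pushE X p h : push f X p h = X (g p) (h \o f).
Proof. by rewrite /push inverseE. Qed.

Lemma smooth_fun_compK h : smooth_fun (h \o f) <-> smooth_fun h.
Proof.
split=> [sh|]; last exact: (smooth_map_comp rN rN sf).
have := smooth_map_comp rN rN sg sh; congr (smooth_map _).
by apply/funext => p /=; rewrite gK.
Qed.

(** A diffeomorphism maps curves to curves, hence velocities to velocities; the
    case of functions that are not smooth needs the equivalence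
    smooth_fun_compK. *)
Lemma push_field X : vector_field X -> vector_field (push f X).
Proof.
move=> [tX sX]; split=> [p|h sh].
  have [u [su u0] Xu] := tX (g p).
  exists (f \o u).
    split; last by rewrite /= u0 gK.
    exact (smooth_map_comp (@regular_real_line R) rN su sf).
  apply/funext => h; rewrite pushE -Xu /velocity.
  have -> : `[< smooth_fun (h \o f) >] = `[< smooth_fun h >].
    by apply/asbool_equiv_eq; exact: smooth_fun_compK.
  by case: ifP.
rewrite (_ : (fun p => push f X p h) = (fun p => X p (h \o f)) \o g); last first.
  by apply/funext => p; rewrite pushE.
apply: (smooth_map_comp rN rN sg); apply: sX.
exact/smooth_fun_compK.
Qed.

End Diffeomorphism.

Section PushConnection.
Context {R : realType} (N : atlased R).
Hypothesis rN : regular_atlas N.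
Variables (f g : N -> N).
Hypotheses (fK : cancel f g) (gK : cancel g f) (sf : smooth_map f) (sg : smooth_map g).
Variable D : pre_field N -> pre_field N -> pre_field N.

Lemma push_connection : linear_connection D ->
  linear_connection (fun X Y => push f (D (push g X) (push g Y))).
Proof.
move=> cD.
have vg X : vector_field X -> vector_field (push g X) by exact: push_field.
have fg a : smooth_fun a -> smooth_fun (a \o f).
  exact: (smooth_fun_compK rN gK sf sg a).2.
have pD X X' : push g (X + X') = push g X + push g X' by [].
have pZ (a : N -> R) X : push g (fun p => a p *: X p) = (fun p => a (f p) *: push g X p).
  by apply/funext => p; apply/funext => h; rewrite /push (inverseE gK fK).
split.
- by move=> X Y vX vY; apply: (push_field rN fK gK sf sg); apply: (conn_field cD); exact: vg.
- by move=> X X' Y vX vX' vY; rewrite pD (conn_addl cD)//; exact: vg.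
- move=> a X Y sa vX vY.
  rewrite pZ (conn_scalel cD (fg a sa) (vg X vX) (vg Y vY)).
  apply/funext => p; apply/funext => h; rewrite /push (inverseE fK gK) (inverseE gK fK).
  by rewrite -[LHS]/(a (f (g p)) * _) gK.
- by move=> X Y Y' vX vY vY'; rewrite pD (conn_addr cD)//; exact: vg.
- move=> a X Y sa vX vY.
  rewrite pZ (conn_leibniz cD (fg a sa) (vg X vX) (vg Y vY)).
  apply/funext => p; apply/funext => h.
  rewrite -[RHS]/(X p a * Y p h + a p * push f (D (push g X) (push g Y)) p h).
  rewrite /push (inverseE fK gK) (inverseE gK fK).
  rewrite -[LHS]/(X (f (g p)) ((a \o f) \o g) * Y (f (g p)) ((h \o f) \o g) +
     a (f (g p)) * _) gK.
  have E (k : N -> R) : (k \o f) \o g = k by apply/funext => q /=; rewrite gK.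
  by rewrite !E.
Qed.

End PushConnection.

Section ChernTransport.
Context {R : realType} {n : nat} {M : manifold R n}.
Local Notation J1 := (jets M 1).
Implicit Types (p q : jets M 1) (h : J1 -> R).

(** The horizontal and the vertical equations have the same coefficients; in
    this form each argument on them is made once. *)
Lemma chern_frame (s : J1 -> jets M 2) D : is_chern s D ->
  forall c (U : set J1), mcharts M c -> open_in U -> U `<=` dom (jet_chart 1 c) ->
  forall b i,
  [/\ conn_on D U (X_sode s c) (frame s c b i)
        (fun j => - 2^-1 *: \sum_k dforce s c k i j *: frame s c b k j),
      forall l, conn_on D U (X_hor s c l) (frame s c b i)
        (fun j => - 2^-1 *: \sum_k d2force s c k i l j *: frame s c b k j) &
      forall l, conn_on D U (d_xdot c l) (frame s c b i) 0].
Proof.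
move=> [_ hD] c U cc oU Uc b i.
have [_ [h1 h2] [h3 h4] h5 h6] := hD c U cc oU Uc.
case: b; split.
- exact (h1 i).
- move=> l; exact (h3 i l).
- move=> l; exact (h5 i l).
- exact (h2 i).
- move=> l; exact (h4 i l).
- move=> l; exact (h6 i l).
Qed.

Lemma chern_of_frame (s : J1 -> jets M 2) D : linear_connection D ->
  (forall c (U : set J1), mcharts M c -> open_in U -> U `<=` dom (jet_chart 1 c) ->
  (forall Y, vector_field Y -> conn_on D U Y (X_sode s c) 0) /\
  forall b i,
  [/\ conn_on D U (X_sode s c) (frame s c b i)
        (fun j => - 2^-1 *: \sum_k dforce s c k i j *: frame s c b k j),
      forall l, conn_on D U (X_hor s c l) (frame s c b i)
        (fun j => - 2^-1 *: \sum_k d2force s c k i l j *: frame s c b k j) &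
      forall l, conn_on D U (d_xdot c l) (frame s c b i) 0]) -> is_chern s D.
Proof.
move=> cD H; split => // c U cc oU Uc; have [H0 HF] := H c U cc oU Uc.
split.
- exact H0.
- by split=> i; [have [h _ _] := HF true i|have [h _ _] := HF false i]; exact h.
- by split=> i l; [have [_ h _] := HF true i|have [_ h _] := HF false i]; exact (h l).
- by move=> i l; have [_ _ h] := HF true i; exact (h l).
- by move=> i l; have [_ _ h] := HF false i; exact (h l).
Qed.

(** The Chern equations prescribe the connection on all pairs of fields of a
    local frame; they apply to extended frame fields because these agree with
    the frame near p. *)
Lemma chern_unique (s : J1 -> jets M 2) D1 D2 : sode s ->
  is_chern s D1 -> is_chern s D2 ->
  forall X Y, vector_field X -> vector_field Y -> D1 X Y = D2 X Y.
Proof.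
move=> hs h1 h2 X Y vX vY; apply/funext => p.
have r1 := @regular_jets1 R n M.
have [c cc cp] := atlas_cover (regular_manifold M) (jet_base p).
have {}cp : dom (jet_chart 1 c) p by [].
have oT : open_in (setT : set J1).
  by move=> c' cc'; exact: (open_chart r1 cc').
have [E [B [vE oB Bp EB]]] := extend_frame hs cc cp oT I.
have Bc : B `<=` dom (jet_chart 1 c) by move=> q /EB[].
have EF q : B q -> forall a h, smooth_fun h -> E a q h = full_frame s c a q h.
  by move=> /EB[].
have eE a : eq_on B (E a) (full_frame s c a) by move=> q /EF H h /H.
apply: (conn_unique r1 jets1_bumps (E := E) (proj1 h1) (proj1 h2) vE _ _ vX vY).
  by move=> Z vZ; exact: (frame_span hs cc cp oB Bp vE EF vZ).
move=> a a'.
have t1 : tangent p (D1 (E a) (E a') p).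
  by have [] := conn_field (proj1 h1) (vE a) (vE a').
have t2 : tangent p (D2 (E a) (E a') p).
  by have [] := conn_field (proj1 h2) (vE a) (vE a').
apply: (tangent_eq t1 t2) => h sh.
suff [C H] : exists C, forall D, is_chern s D -> D (E a) (E a') p h = C.
  by rewrite (H D1 h1) (H D2 h2).
case: a' {t1 t2} => [[]|[b i]].
  exists 0 => D [_ hD]; have [H0 _ _ _ _] := hD c B cc oB Bc.
  exact: (H0 (E a) (vE a) (E a) (E (inl tt)) (vE _) (vE _) (fun _ _ _ _ => erefl) (eE (inl tt)) p Bp h sh).
case: a => [[]|[[] l]].
- exists ((- 2^-1 *: \sum_k dforce s c k i p *: frame s c b k p) h) => D hD.
  have [H _ _] := chern_frame hD cc oB Bc b i.
  exact: (H _ _ (vE (inl tt)) (vE (inr (b, i))) (eE _) (eE _) p Bp h sh).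
- exists ((- 2^-1 *: \sum_k d2force s c k i l p *: frame s c b k p) h) => D hD.
  have [_ H _] := chern_frame hD cc oB Bc b i.
  exact: (H l _ _ (vE (inr (true, l))) (vE (inr (b, i))) (eE _) (eE _) p Bp h sh).
- exists 0 => D hD; have [_ _ H] := chern_frame hD cc oB Bc b i.
  exact: (H l _ _ (vE (inr (false, l))) (vE (inr (b, i))) (eE _) (eE _) p Bp h sh).
Qed.

End ChernTransport.

(** * Transport of the Chern connection *)

Section Transport.
Context {R : realType} {n : nat} {M : manifold R n}.
Local Notation E1 := (R * 'M[R]_(2, n))%type.
Local Notation J1 := (jets M 1).
Variables (s s' : J1 -> jets M 2).
Hypotheses (hs : sode s) (hs' : sode s').
Variables (Phi Psi : evolution M -> evolution M) (phi psi : evolution M -> M).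
Hypotheses (sphi : smooth_map phi) (phiE : forall t x, Phi (t, x) = (t, phi (t, x))).
Hypotheses (spsi : smooth_map psi) (psiE : forall t x, Psi (t, x) = (t, psi (t, x))).
Hypotheses (PhiK : cancel Phi Psi) (PsiK : cancel Psi Phi).
Let Q : J1 -> J1 := prolong 1 Phi.
Let P : J1 -> J1 := prolong 1 Psi.
Hypothesis ss' : forall j, s (P j) = prolong 2 Psi (s' j).

Let QK : cancel Q P. Proof. by move=> j; exact: (prolong_comp (r := 1) j isT sphi phiE spsi psiE). Qed.
Let PK : cancel P Q. Proof. by move=> j; exact: (prolong_comp (r := 1) j isT spsi psiE sphi phiE). Qed.
Let sQ : smooth_map Q. Proof. exact: (smooth_prolong (r := 1) isT sphi phiE). Qed.
Let sP : smooth_map P. Proof. exact: (smooth_prolong (r := 1) isT spsi psiE). Qed.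
Let r1 := @regular_jets1 R n M.

Variable D : pre_field J1 -> pre_field J1 -> pre_field J1.
Hypothesis hD : is_chern s D.
Let cD := proj1 hD.

Let pushP X q h : push P X q h = X (Q q) (h \o P).
Proof. exact: (pushE PK QK). Qed.

Let vP X : vector_field X -> vector_field (push P X).
Proof. exact: (push_field r1 PK QK sP sQ). Qed.

Let sfP h : smooth_fun h -> smooth_fun (h \o P).
Proof. exact: (smooth_map_comp r1 r1 sP). Qed.

Let sfQ h : smooth_fun h -> smooth_fun (h \o Q).
Proof. exact: (smooth_map_comp r1 r1 sQ). Qed.

Section InCharts.
Variables (c d : chart 'rV[R]_n (mspace M)).
Hypotheses (cc : mcharts M c) (dd : mcharts M d).
Variables (U : set J1).
Hypotheses (oU : open_in U) (Uc : U `<=` dom (jet_chart 1 c)).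

Let tr p i k : R := jac (expr c d psi) i k (coord (jet_chart 1 c) p).

Lemma push_frame b i p h : dom (jet_chart 1 c) p -> dom (jet_chart 1 d) (P p) ->
  smooth_fun h ->
  frame s' c b i p (h \o P) = \sum_k tr p i k * frame s d b k (P p) h.
Proof.
move=> cp dp sh; case: b.
  exact: (push_hor hs hs' spsi psiE ss' cc dd cp dp i sh).
exact: (push_dot spsi psiE cc dd cp dp i sh).
Qed.

Lemma push_sode_eq X q : eq_on U X (X_sode s' c) -> U (Q q) -> dom (jet_chart 1 d) q ->
  forall h, smooth_fun h -> push P X q h = X_sode s d q h.
Proof.
move=> XE Uq dq h sh; rewrite pushP XE//; last exact: sfP.
have dq' : dom (jet_chart 1 d) (P (Q q)) by rewrite QK.
have := push_sode hs hs' spsi psiE ss' cc dd (Uc Uq) dq' sh.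
by rewrite -/P QK.
Qed.

Variable p : J1.
Hypotheses (Up : U p) (dp : dom (jet_chart 1 d) (P p)).

(** Connections act on global fields only. The extensions beta of the Jacobian
    matrix and E of the frame of s, and the expansion of the pushed fields in
    them, have to be valid on one open set A around P p; so they are chosen
    together. *)
Lemma transport_data : exists (beta : 'I_n -> 'I_n -> J1 -> R)
    (E : @frame_index n -> pre_field J1) (A : set J1),
  [/\ forall i k, smooth_fun (beta i k), forall a, vector_field (E a),
      open_in A /\ A (P p),
      (forall q, A q -> [/\ dom (jet_chart 1 d) q, U (Q q) &
         forall a h, smooth_fun h -> E a q h = full_frame s d a q h]) &
      (forall i k, \forall w \near coord (jet_chart 1 c) p,
         in_chart (jet_chart 1 c) (beta i k) w = jac (expr c d psi) i k w) /\
      forall Y b i, vector_field Y -> eq_on U Y (frame s' c b i) -> forall q, A q ->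
         push P Y q = \sum_k beta i k (Q q) *: E (inr (b, k)) q].
Proof.
have cp := Uc Up.
have [oE sE] := expr_smooth spsi cc dd.
pose O : set E1 := jet_over (chart_image (evol_chart c) (psi @^-1` dom d)).
have oO : open O by exact: open_jet_over.
have Op : O (coord (jet_chart 1 c) p) by exact: (domain_coord spsi psiE cc dd cp dp).
have [b [A [sb oA Ap Ab]]] := extend_fun r1 jets1_bumps (jet1_charts cc) cp oU Up oO Op
  (fun ik : 'I_n * 'I_n => smooth_jac oE sE ik.1 ik.2).
have oQA : open_in (Q @^-1` A) by exact: (open_in_preimage r1 r1 sQ).
have QAp : (Q @^-1` A) (P p) by rewrite /preimage /= PK.
have [E [A' [vE oA' A'p A'E]]] := extend_frame hs dd dp oQA QAp.
exists (fun i k => b (i, k)), E, A'; split=> //.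
- by move=> q /A'E[dq QAq Eq]; split => //; have [] := Ab _ QAq.
- split.
    move=> i k; apply: filterS (open_in_mem (jet1_charts cc) cp oA Ap) => _ [p' [cp' Ap'] <-].
    rewrite in_chartE//; last exact: jet1_inj.
    by have [_ _ _ ->] := Ab p' Ap'.
  move=> Y e i vY YE q A'q.
  have [dq QAq Eq] := A'E q A'q; have [cq Uq Oq bq] := Ab _ QAq.
  have vS : vector_field (\sum_k (fun q => (b (i, k) \o Q) q *: E (inr (e, k)) q)).
    by apply: (vector_field_sum r1) => k; apply: (vector_fieldZ r1) => //; exact: sfQ.
  have tS : tangent q (\sum_k b (i, k) (Q q) *: E (inr (e, k)) q).
    by have [/(_ q)] := vS; rewrite fct_sumE.
  apply: (tangent_eq _ tS); first by have [] := vP vY.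
  move=> h sh; rewrite pushP YE//; last exact: sfP.
  have dq' : dom (jet_chart 1 d) (P (Q q)) by rewrite QK.
  rewrite (push_frame e i cq dq' sh) QK fct_sumE; apply: eq_bigr => k _.
  by rewrite -[RHS]/(b (i, k) (Q q) * E (inr (e, k)) q h) bq Eq.
Qed.

Section InFrame.
Variables (beta : 'I_n -> 'I_n -> J1 -> R) (E : @frame_index n -> pre_field J1) (A : set J1).
Hypotheses (sb : forall i k, smooth_fun (beta i k)) (vE : forall a, vector_field (E a)).
Hypotheses (oA : open_in A) (Ap : A (P p)).
Hypothesis AE : forall q, A q -> [/\ dom (jet_chart 1 d) q, U (Q q) &
  forall a h, smooth_fun h -> E a q h = full_frame s d a q h].
Hypothesis betaE : forall i k, \forall w \near coord (jet_chart 1 c) p,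
  in_chart (jet_chart 1 c) (beta i k) w = jac (expr c d psi) i k w.
Hypothesis pushEn : forall Y b i, vector_field Y -> eq_on U Y (frame s' c b i) ->
  forall q, A q -> push P Y q = \sum_k beta i k (Q q) *: E (inr (b, k)) q.

Let vS b i : vector_field (\sum_k (fun q => (beta i k \o Q) q *: E (inr (b, k)) q)).
Proof.
by apply: (vector_field_sum r1) => k; apply: (vector_fieldZ r1) => //; exact: sfQ.
Qed.

Let beta_p i k : beta i k p = tr p i k.
Proof.
have := nbhs_singleton (betaE i k); rewrite in_chartE//; last exact: Uc.
exact: jet1_inj.
Qed.

(** The Leibniz rule in the second argument, after replacing push P Y by its
    expansion, which is allowed by locality. *)
Lemma push_right X Y b i h : vector_field X -> vector_field Y ->
  eq_on U Y (frame s' c b i) -> smooth_fun h ->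
  D (push P X) (push P Y) (P p) h =
  \sum_k (X p (beta i k) * frame s d b k (P p) h +
    tr p i k * D (push P X) (E (inr (b, k))) (P p) h).
Proof.
move=> vX vY YE sh; have [_ _ Ep] := AE Ap.
have loc := conn_local r1 jets1_bumps cD (vP vX) (vP vX) (vP vY) (vS b i) oA Ap.
rewrite loc; last first.
  by move=> q Aq; split => //; rewrite (pushEn vY YE Aq) fct_sumE.
have sbQ k : smooth_fun (beta i k \o Q) by exact: sfQ.
rewrite (conn_sumr r1 cD (P p) sbQ (fun k => vE (inr (b, k))) (vP vX)).
rewrite fct_sumE; apply: eq_bigr => k _.
rewrite -[LHS]/(push P X (P p) (beta i k \o Q) * E (inr (b, k)) (P p) h +
   beta i k (Q (P p)) * D (push P X) (E (inr (b, k))) (P p) h).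
rewrite pushP PK beta_p (Ep (inr (b, k)))//.
have -> : (beta i k \o Q) \o P = beta i k by apply/funext => q /=; rewrite PK.
exact: erefl.
Qed.

Lemma push_left X Z b l h : vector_field X -> vector_field Z ->
  eq_on U X (frame s' c b l) ->
  D (push P X) Z (P p) h = \sum_j tr p l j * D (E (inr (b, j))) Z (P p) h.
Proof.
move=> vX vZ XE.
have loc := conn_local r1 jets1_bumps cD (vP vX) (vS b l) vZ vZ oA Ap.
rewrite loc; last first.
  by move=> q Aq; split => //; rewrite (pushEn vX XE Aq) fct_sumE.
have sbQ k : smooth_fun (beta l k \o Q) by exact: sfQ.
rewrite (conn_suml r1 cD (P p) sbQ (fun k => vE (inr (b, k))) vZ).
rewrite fct_sumE; apply: eq_bigr => k _.
rewrite -[LHS]/(beta l k (Q (P p)) * D (E (inr (b, k))) Z (P p) h).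
by rewrite PK beta_p.
Qed.

End InFrame.
End InCharts.

Lemma eval_comb (a : 'I_n -> R) (f : 'I_n -> (J1 -> R) -> R) h :
  (- 2^-1 *: \sum_k a k *: f k) h = - 2^-1 * \sum_k a k * f k h.
Proof. by rewrite -[LHS]/(- 2^-1 * (\sum_k a k *: f k) h) fct_sumE. Qed.

Lemma contract_swap (a b : 'I_n -> R) (g : 'I_n -> 'I_n -> R) :
  \sum_j a j * (\sum_m b m * g m j) = \sum_m b m * (\sum_j a j * g m j).
Proof.
under eq_bigr do rewrite mulr_sumr.
rewrite exchange_big; apply: eq_bigr => m _; rewrite mulr_sumr.
by apply: eq_bigr => j _; rewrite mulrCA.
Qed.

Lemma contract_half (a C : 'I_n -> R) (g : 'I_n -> 'I_n -> R) :
  \sum_j a j * (- 2^-1 * \sum_m g m j * C m) =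
  - 2^-1 * \sum_m (\sum_j a j * g m j) * C m.
Proof.
under eq_bigr do rewrite mulrCA mulr_sumr.
rewrite -mulr_sumr exchange_big; congr (_ * _); apply: eq_bigr => m _.
by rewrite mulr_suml; apply: eq_bigr => j _; rewrite mulrA.
Qed.

(** The algebra of the two nontrivial Chern equations. Here t is a row of the
    Jacobian matrix T, g and f' are the derivatives of the forces of s and s', C
    is the frame of s: the terms with g from the derivative of the matrix and
    from the connection of s cancel. *)
Lemma transport_sum (t f' C : 'I_n -> R) (g T : 'I_n -> 'I_n -> R) :
  \sum_k ((2^-1 * (\sum_j t j * g k j) - 2^-1 * \sum_r f' r * T r k) * C k +
     t k * (- 2^-1 * \sum_m g m k * C m)) =
  - 2^-1 * \sum_r f' r * \sum_k T r k * C k.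
Proof.
rewrite big_split /=.
have -> : \sum_k t k * (- 2^-1 * \sum_m g m k * C m) =
    - 2^-1 * \sum_k (\sum_j t j * g k j) * C k.
  under [in RHS]eq_bigr do rewrite mulr_suml.
  rewrite [in RHS]exchange_big /= mulr_sumr; apply: eq_bigr => k _.
  rewrite mulrCA mulr_sumr; congr (_ * _).
  by apply: eq_bigr => m _; rewrite mulrA.
have -> : \sum_r f' r * \sum_k T r k * C k = \sum_k (\sum_r f' r * T r k) * C k.
  under [in RHS]eq_bigr do rewrite mulr_suml.
  rewrite [in RHS]exchange_big /=; apply: eq_bigr => r _.
  by rewrite mulr_sumr; apply: eq_bigr => k _; rewrite mulrA.
rewrite !mulr_sumr -big_split; apply: eq_bigr => k _ /=.
rewrite mulrBl !mulNr -!mulrA; ring.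
Qed.

(** Each equation of s' at p is the corresponding equation of s at P p after the
    expansion of the pushed frame. The fields X^s correspond exactly, so that
    the equation for them is immediate; in the others the derivatives of the
    Jacobian matrix make up the difference. *)
Theorem chern_push : is_chern s' (fun X Y => push Q (D (push P X) (push P Y))).
Proof.
apply: chern_of_frame; first exact: (push_connection r1 QK PK sQ sP cD).
move=> c U cc oU Uc.
have pushQ X p h : push Q X p h = X (P p) (h \o Q) by exact: (pushE QK PK).
have hQP (h : J1 -> R) : (h \o Q) \o P = h by apply/funext => p /=; rewrite PK.
have dP p : U p -> exists2 d, mcharts M d & dom (jet_chart 1 d) (P p).
  by move=> _; exact: (atlas_cover (regular_manifold M) (jet_base (P p))).
split.
  move=> Y0 vY0 X Y vX vY XE YE p Up h sh; have [d dd dp] := dP p Up.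
  have [b [E [A [sb vE [oA Ap] AE _]]]] := transport_data cc dd oU Uc Up dp.
  have Ad : A `<=` dom (jet_chart 1 d) by move=> q /AE[].
  have [_ /(_ d A dd oA Ad)[H0 _ _ _ _]] := hD.
  rewrite pushQ; apply: (H0 _ (vP vX) _ _ (vP vX) (vP vY) _ _ _ Ap _ (sfQ sh)).
    by move=> q _ k _.
  by move=> q /AE[dq Uq _]; exact: (push_sode_eq cc dd Uc YE Uq dq).
move=> b i.
have frameQ p d r h : U p -> mcharts M d -> dom (jet_chart 1 d) (P p) -> smooth_fun h ->
    frame s' c b r p h =
    \sum_k jac (expr c d psi) r k (coord (jet_chart 1 c) p) * frame s d b k (P p) (h \o Q).
  move=> Up dd dp sh; rewrite -[in LHS](hQP h).
  exact: (push_frame cc dd b r (Uc _ Up) dp (sfQ sh)).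
split=> [X Y vX vY XE YE p Up h sh|l X Y vX vY XE YE p Up h sh|l X Y vX vY XE YE p Up h sh];
  rewrite pushQ; have [d dd dp] := dP p Up;
  have [beta [E [A [sb vE [oA Ap] AE [bE pE]]]]] := transport_data cc dd oU Uc Up dp;
  have [_ _ Ep] := AE _ Ap; have sh' := sfQ sh;
  have Ad : A `<=` dom (jet_chart 1 d) by move=> q /AE[].
- rewrite (push_right cc Uc Up sb vE oA Ap AE bE pE vX vY YE sh').
  rewrite eval_comb; under [in RHS]eq_bigr => r _ do rewrite (frameQ p d r h Up dd dp sh).
  rewrite -(transport_sum (fun k => jac (expr c d psi) i k (coord (jet_chart 1 c) p))
    _ _ (fun k m => dforce s d k m (P p))).
  apply: eq_bigr => k _; congr (_ * _ + _ * _).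
    rewrite (XE p Up _ (sb i k)).
    exact: (entry_sode hs hs' spsi psiE ss' cc dd (Uc _ Up) dp (sb i k) (bE i k)).
  have [H _ _] := chern_frame hD dd oA Ad b k.
  rewrite (H (push P X) (E (inr (b, k))) (vP vX) (vE _) _ _ (P p) Ap (h \o Q) sh').
  - exact: eval_comb.
  - by move=> q /AE[dq Uq _]; exact: (push_sode_eq cc dd Uc XE Uq dq).
  - by move=> q /AE[_ _ Eq] k' sk'; rewrite Eq.
- rewrite (push_right cc Uc Up sb vE oA Ap AE bE pE vX vY YE sh').
  rewrite eval_comb; under [in RHS]eq_bigr => r _ do rewrite (frameQ p d r h Up dd dp sh).
  (* The part of df^k/dv^m is now played by its derivative along the pushed
     field, with coefficients B_l^j d^2f^k / dv^m dv^j. *)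
  rewrite -(transport_sum (fun k => jac (expr c d psi) i k (coord (jet_chart 1 c) p))
    _ _ (fun k m => \sum_j jac (expr c d psi) l j (coord (jet_chart 1 c) p) *
                              d2force s d k m j (P p))).
  apply: eq_bigr => k _; congr (_ * _ + _ * _).
    rewrite (XE p Up _ (sb i k)).
    rewrite (entry_hor hs hs' spsi psiE ss' cc dd (Uc _ Up) dp (sb i k) (bE i k)).
    exact (congr2 (fun a b => 2^-1 * a - b) (contract_swap _ _ _) erefl).
  have XE' : eq_on U X (frame s' c true l) := XE.
  rewrite (push_left cc Uc Up sb vE oA Ap bE pE _ vX (vE _) XE').
  have [_ H _] := chern_frame hD dd oA Ad b k.
  have Hj j : D (E (inr (true, j))) (E (inr (b, k))) (P p) (h \o Q) =
      - 2^-1 * \sum_m d2force s d m k j (P p) * frame s d b m (P p) (h \o Q).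
    rewrite (H j (E (inr (true, j))) (E (inr (b, k))) (vE _) (vE _) _ _ (P p) Ap (h \o Q) sh').
    - exact: eval_comb.
    - by move=> q /AE[_ _ Eq] k' sk'; rewrite Eq.
    - by move=> q /AE[_ _ Eq] k' sk'; rewrite Eq.
  rewrite (eq_bigr _ (fun j _ => congr1 ( *%R _) (Hj j))).
  exact: contract_half.
- rewrite (push_right cc Uc Up sb vE oA Ap AE bE pE vX vY YE sh').
  rewrite big1// => k _.
  rewrite (XE p Up _ (sb i k)).
  rewrite (entry_dot spsi psiE cc dd (Uc _ Up) dp (bE i k)) mul0r add0r.
  have XE' : eq_on U X (frame s' c false l) := XE.
  rewrite (push_left cc Uc Up sb vE oA Ap bE pE _ vX (vE _) XE').
  rewrite big1 ?mulr0// => j _.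
  have [_ _ H] := chern_frame hD dd oA Ad b k.
  rewrite (H j (E (inr (false, j))) (E (inr (b, k))) (vE _) (vE _) _ _ (P p) Ap (h \o Q) sh').
  - by rewrite mulr0.
  - by move=> q /AE[_ _ Eq] k' sk'; rewrite Eq.
  - by move=> q /AE[_ _ Eq] k' sk'; rewrite Eq.
Qed.

End Transport.

Section Equivariance.
Context {R : realType} {n : nat} {M : manifold R n}.
Local Notation J1 := (jets M 1).

(** The time of Psi z is read off from Phi (Psi z) = z. *)
Lemma vertical_aut_inverse (Phi : evolution M -> evolution M) : vertical_aut Phi ->
  exists phi Psi psi, [/\ smooth_map (phi : evolution M -> M) /\ smooth_map (psi : evolution M -> M),
    forall t x, Phi (t, x) = (t, phi (t, x)), forall t x, Psi (t, x) = (t, psi (t, x)),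
    cancel Phi Psi & cancel Psi Phi].
Proof.
move=> [[sPhi [Psi [sPsi PhiK PsiK]]] [phi [sphi phiE]]].
exists phi, Psi, (snd \o Psi); split => //.
  have rE := @regular_evolution _ _ M.
  by split => //; exact: (smooth_map_comp rE rE sPsi (@smooth_evol_snd _ _ M)).
move=> t x; have := PsiK (t, x); rewrite /=.
by case: (Psi (t, x)) => t' x'; rewrite phiE => -[<-].
Qed.

Lemma jet_proj_mk t (g : @curves R n M) : @jet_proj R n M 2 1 (mk_jet 2 t g) = mk_jet 1 t g.
Proof.
have /asboolP[tE pE dE] := repr_jet (r := 2) t g.
rewrite /jet_proj /jet_time /jet_curve.
case: (repr _) tE pE dE => t' g' /= tE pE dE.
by apply/mk_jetP/asboolP; split => // c cc ct k k1; apply: dE => //; exact: leq_trans k1 _.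
Qed.

(** The prolongations to 2-jets and to 1-jets are compatible with the
    projection, so that Phi . s is a section. *)
Lemma sode_act (s : J1 -> jets M 2) (Phi : evolution M -> evolution M) :
  sode s -> vertical_aut Phi -> sode (act_sode Phi s).
Proof.
move=> [ss sK] /vertical_aut_inverse[phi [Psi [psi [[sphi spsi] phiE psiE PhiK PsiK]]]].
have QK j : prolong 1 Psi (prolong 1 Phi j) = j.
  exact: (prolong_comp (r := 1) j isT sphi phiE spsi psiE).
have PK j : prolong 1 Phi (prolong 1 Psi j) = j.
  exact: (prolong_comp (r := 1) j isT spsi psiE sphi phiE).
have r1 := @regular_jets1 R n M.
have r2 : regular_atlas (jets M 2) by exact: regular_jets.
have IE : inverse (prolong 1 Phi : J1 -> J1) = prolong 1 Psi by exact: inverseE QK PK.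
rewrite /act_sode IE; split.
  apply: (smooth_map_comp r1 r1 (f := prolong 1 Psi)).
    exact: (smooth_prolong (r := 1) isT spsi psiE).
  apply: (smooth_map_comp r1 r2 ss).
  exact: (smooth_prolong (r := 2) isT sphi phiE).
move=> j /=; rewrite -[RHS]PK -[in RHS](sK (prolong 1 Psi j)).
rewrite -(mk_jetK (s (prolong 1 Psi j))).
move: (jet_time _) (jet_curve _) => t g.
rewrite (prolong_mk (r := 2) sphi t g isT phiE) !jet_proj_mk.
by rewrite (prolong_mk (r := 1) sphi t g isT phiE).
Qed.

Lemma chern_act (s : J1 -> jets M 2) (Phi : evolution M -> evolution M)
    (D : pre_field J1 -> pre_field J1 -> pre_field J1) :
  sode s -> vertical_aut Phi -> is_chern s D ->
  is_chern (act_sode Phi s) (act_conn Phi D).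
Proof.
move=> hs hPhi hD; have hs' := sode_act hs hPhi.
have [phi [Psi [psi [[sphi spsi] phiE psiE PhiK PsiK]]]] := vertical_aut_inverse hPhi.
have QK j : prolong 1 Psi (prolong 1 Phi j) = j :> J1.
  exact: (prolong_comp (r := 1) j isT sphi phiE spsi psiE).
have PK j : prolong 1 Phi (prolong 1 Psi j) = j :> J1.
  exact: (prolong_comp (r := 1) j isT spsi psiE sphi phiE).
have IE : inverse (prolong 1 Phi : J1 -> J1) = prolong 1 Psi by exact: inverseE QK PK.
have ss' j : s (prolong 1 Psi j) = prolong 2 Psi (act_sode Phi s j).
  rewrite /act_sode IE /=.
  exact/esym/(prolong_comp (r := 2) _ isT sphi phiE spsi psiE).
rewrite /act_conn IE.
exact: (chern_push hs hs' sphi phiE spsi psiE PhiK PsiK ss' hD).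
Qed.

End Equivariance.

Theorem theorem7p1 (R : realType) (n : nat) (M : manifold R n)
    (hM : connected [set: mspace M])
    (s : jets M 1 -> jets M 2) (hs : sode s)
    (Phi : evolution M -> evolution M) (hPhi : vertical_aut Phi)
    (D : pre_field (jets M 1) -> pre_field (jets M 1) -> pre_field (jets M 1))
    (hD : is_chern s D) :
  [/\ sode (act_sode Phi s),
      is_chern (act_sode Phi s) (act_conn Phi D) &
      forall D' : pre_field (jets M 1) -> pre_field (jets M 1) -> pre_field (jets M 1),
        is_chern (act_sode Phi s) D' ->
        forall X Y : pre_field (jets M 1), vector_field X -> vector_field Y ->
          act_conn Phi D X Y = D' X Y].
Proof.
split; [exact: sode_act | exact: chern_act |].
move=> D' hD' X Y vX vY.
exact: (chern_unique (sode_act hs hPhi) (chern_act hs hPhi hD) hD' vX vY).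
Qed.
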